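(* Let $\lambda\in\overline{\mathrm{Pr}}_k^{\mathcal O_{\rm prin}}$. Then for every $w\in W$ the module $L^{\mathfrak g}_{\mathfrak b}(\lambda)$ is a strongly tame $\Gamma_{\rm st}(w(\Pi_{\rm st}))$-Gelfand–Tsetlin $\mathfrak g$-module.
   Context: Let $\mathfrak g=\mathfrak{sl}_{n+1}(\mathbb C)$, $n\ge1$, $E_{i,j}$ matrix units, $\mathfrak h$ traceless diagonal matrices, $\Delta_+=\{\varepsilon_i-\varepsilon_j:i<j\}$, $\Delta_-=-\Delta_+$, $\Pi_{\rm st}=(\alpha_1,\dots,\alpha_n)$, $\alpha_i=\varepsilon_i-\varepsilon_{i+1}$, $\mathfrak b$ the upper triangular Borel; $e_i=E_{i,i+1},f_i=E_{i+1,i},h_i=E_{ii}-E_{i+1,i+1}$. $(\cdot,\cdot)$ invariant form on $\mathfrak h^*$ with $(\alpha,\alpha)=2$; $\omega_i$ fundamental weights, $P^\vee=\bigoplus\mathbb Z\omega_i$, $\rho=\sum\omega_i$; $W$ Weyl group generated by $s_i$, $w\cdot\mu=w(\mu+\rho)-\rho$. Admissible weights: $k\in\mathbb Q$, $k+n+1=p/q$, $p,q\in\mathbb N$ coprime, $p\ge n+1$; $\overline{\mathrm{Pr}}_{k,\mathbb Z}=\{\sum\lambda_i\omega_i:\lambda_i\in\mathbb N_0,\sum\lambda_i\le p-n-1\}$; $C(w,\eta)$ for $w\in W,\eta\in P^\vee$ means: for all $\alpha\in\Delta_+$, $0\le(\eta,\alpha)\le q-1$ if $w(\alpha)\in\Delta_+$,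 $1\le(\eta,\alpha)\le q$ if $w(\alpha)\in\Delta_-$; $\overline{\mathrm{Pr}}_k=\{w\cdot(\mu-\tfrac pq\eta):\mu\in\overline{\mathrm{Pr}}_{k,\mathbb Z},w\in W,\eta\in P^\vee,C(w,\eta)\}$. $J_\mu=\mathrm{Ann}_{U(\mathfrak g)}L^{\mathfrak g}_{\mathfrak b}(\mu)$, $\mathcal V(J_\mu)\subset\mathfrak g^*$ the zero locus of $\mathrm{gr}J_\mu$; $\overline{\mathrm{Pr}}_k^{\mathcal O_{\rm prin}}=\{\mu\in\overline{\mathrm{Pr}}_k:\mathcal V(J_\mu)=\overline{\mathcal O_{\rm prin}^*}\}$, $\mathcal O_{\rm prin}^*$ the image of the principal nilpotent orbit in $\mathfrak g^*$ via the Killing form. $\overline W\subset\mathrm{Aut}(\mathfrak g)$ is generated by $r_i=\exp(\mathrm{ad}f_i)\exp(-\mathrm{ad}e_i)\exp(\mathrm{ad}f_i)$ and the involution $\sigma$: $e_i\mapsto e_{n+1-i}$, $f_i\mapsto f_{n+1-i}$, $h_i\mapsto-h_{n+1-i}$; it acts on $\mathfrak h^*$, roots and bases. An element $w=s_{i_1}\cdots s_{i_m}\in W$ acts on bases via $r_{i_1}\cdots r_{i_m}$. For $u\in\overline W$ and a module $M$, $M^u$ is $M$ with action $a\cdot v=u^{-1}(a)v$. A $\mathfrak g$-module $M$ is a strongly tame $\Gamma_{\rm st}$-Gelfand–Tsetlin module if it has a basis $\{T(v):v\in S\}$ indexed by a set $S$ of arrays $v=(v_{j,i})_{1\le i\le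 j\le n+1}$ of complex numbers such that for $k=1,\dots,n$: $e_kT(v)=-\sum_{i=1}^k\frac{\prod_{j=1}^{k+1}(v_{k,i}-v_{k+1,j})}{\prod_{j\ne i}(v_{k,i}-v_{k,j})}T(v+\delta^{k,i})$, $f_kT(v)=\sum_{i=1}^k\frac{\prod_{j=1}^{k-1}(v_{k,i}-v_{k-1,j})}{\prod_{j\ne i}(v_{k,i}-v_{k,j})}T(v-\delta^{k,i})$, $h_kT(v)=(2\sum_{i=1}^kv_{k,i}-\sum_{i=1}^{k-1}v_{k-1,i}-\sum_{i=1}^{k+1}v_{k+1,i}-1)T(v)$, with $\delta^{k,i}$ the array having $1$ at $(k,i)$ and $0$ elsewhere, summands with zero denominator omitted and $T(w)=0$ for $w\notin S$. For a base $\Pi'$, $M$ is strongly tame $\Gamma_{\rm st}(\Pi')$-Gelfand–Tsetlin if there is $u\in\overline W$ with $\Pi'=u(\Pi_{\rm st})$ (as ordered sets) and $M^{u^{-1}}$ strongly tame $\Gamma_{\rm st}$-Gelfand–Tsetlin.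
   Formalization: No automorphism σ has the stated values, since [e_i,f_i]=h_i would force h_i to map to +h_{n+1-i}; σ is taken to be the linear anti-automorphism with exactly these values, acting on roots via root spaces. The elements u that realize w(Π_st) still come from the r_i. *)

(* Defs.v *)
(* g = sl_{n+1}(C) realized inside 'M[C]_(n.+1) (traceless
   matrices), C an arbitrary numClosedFieldType (covers the complex numbers).
   All indices are 0-based: e_i = E_{i,i+1}, i < n, etc. *)
From HB Require Import structures.
From mathcomp Require Import all_boot all_order all_fingroup all_algebra.
Set Implicit Arguments. Unset Strict Implicit. Unset Printing Implicit Defensive.
Import Order.TTheory GRing.Theory Num.Theory.
Local Open Scope ring_scope.

Section Defs.
Variables (C : numClosedFieldType) (n : nat).
Local Notation M := 'M[C]_(n.+1).

(* matrix unit E_{i,j} with nat indices (all uses are in range) *)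
Definition Emx (i j : nat) : M := delta_mx (inord i) (inord j).
Definition ech (i : nat) : M := Emx i i.+1.
Definition fch (i : nat) : M := Emx i.+1 i.
Definition hch (i : nat) : M := Emx i i - Emx i.+1 i.+1.
Definition lbr (x y : M) : M := x *m y - y *m x.
Definition in_sl (x : M) : Prop := \tr x = 0.

Definition is_gmodule (V : lmodType C) (rho : M -> V -> V) : Prop :=
  [/\ (forall x (a : C) (u v : V), rho x (a *: u + v) = a *: rho x u + rho x v),
      (forall x y (a : C) (v : V), in_sl x -> in_sl y ->
          rho (a *: x + y) v = a *: rho x v + rho y v) &
      (forall x y (v : V), in_sl x -> in_sl y ->
          rho (lbr x y) v = rho x (rho y v) - rho y (rho x v))].

Definition is_submodule (V : lmodType C) (rho : M -> V -> V) (W : V -> Prop) :=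
  [/\ W 0, (forall (a : C) u v, W u -> W v -> W (a *: u + v)) &
      (forall x v, in_sl x -> W v -> W (rho x v))].

Definition simple_gmodule (V : lmodType C) (rho : M -> V -> V) : Prop :=
  (exists v : V, v != 0) /\
  forall W, is_submodule rho W -> (forall v, W v -> v = 0) \/ (forall v, W v).

Definition hw_vector (V : lmodType C) (rho : M -> V -> V) (lam : 'I_n -> C) (v : V) :=
  v != 0 /\ forall i : 'I_n, rho (ech i) v = 0 /\ rho (hch i) v = lam i *: v.

(* Elements of T(g) (hence representatives of elements of U(g)) and of S(g):
   finite lists of (coefficient, word of elements of g). *)
Definition gpoly (P : seq (C * seq M)) : Prop :=
  forall cw, cw \in P -> forall x, x \in cw.2 -> in_sl x.

Definition act_poly (V : lmodType C) (rho : M -> V -> V) (P : seq (C * seq M)) (v : V) : V :=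
  \sum_(cw <- P) cw.1 *: foldr (fun x acc => rho x acc) v cw.2.

Definition killing (x y : M) : C := (2 * n.+1)%:R * \tr (x *m y).

(* points of g^* are written xi_y = killing y (.), y traceless *)
Definition poly_eval (y : M) (P : seq (C * seq M)) : C :=
  \sum_(cw <- P) cw.1 * \prod_(x <- cw.2) killing y x.

Definition sym_eval (y : M) (d : nat) (P : seq (C * seq M)) : C :=
  \sum_(cw <- P | size cw.2 == d) cw.1 * \prod_(x <- cw.2) killing y x.

(* V(Ann M): y such that xi_y is a zero of gr Ann(M); gr Ann(M) in degree d
   consists of the degree-d parts of the representatives of degree <= d of the
   elements of Ann(M) (PBW). *)
Definition assoc_var (V : lmodType C) (rho : M -> V -> V) (y : M) : Prop :=
  in_sl y /\
  forall (P : seq (C * seq M)) (d : nat), gpoly P ->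
    (forall cw, cw \in P -> (size cw.2 <= d)%N) ->
    (forall v, act_poly rho P v = 0) -> sym_eval y d P = 0.

Definition zclosure (S : M -> Prop) (y : M) : Prop :=
  in_sl y /\
  forall f : seq (C * seq M), gpoly f ->
    (forall z, S z -> poly_eval z f = 0) -> poly_eval y f = 0.

Definition eprin : M := \sum_(i < n) ech i.
Definition Oprin (y : M) : Prop :=
  exists g : M, g \in unitmx /\ y = g *m eprin *m invmx g.

(* epsilon-coordinates of the weight with Dynkin labels nu *)
Definition eps_coord (nu : 'I_n -> C) (j : 'I_n.+1) : C :=
  \sum_(l < n | (j <= l)%N) nu l.
(* w in W = S_{n+1}, acting by w(eps_j) = eps_{w j} *)
Definition weyl_act (w : 'S_n.+1) (nu : 'I_n -> C) : 'I_n -> C :=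
  fun i => eps_coord nu (((w^-1)%g) (inord i)) - eps_coord nu ((invg w) (inord i.+1)).
Definition dot_act (w : 'S_n.+1) (nu : 'I_n -> C) : 'I_n -> C :=
  fun i => weyl_act w (fun l => nu l + 1) i - 1.

Definition PrZ (p : nat) (mu : 'I_n -> nat) : Prop :=
  (\sum_(i < n) mu i <= p - n.+1)%N.

(* condition C(w, eta); (eta, eps_a - eps_b) = sum_{a <= l < b} eta_l *)
Definition condC (q : nat) (w : 'S_n.+1) (eta : 'I_n -> int) : Prop :=
  forall a b : 'I_n.+1, (a < b)%N ->
    let s := \sum_(l < n | ((a <= l) && (l < b))%N) eta l in
    if (w a < w b)%N then (0 <= s) && (s <= q%:Z - 1) else (1 <= s) && (s <= q%:Z).

Definition Pr_adm (p q : nat) (lam : 'I_n -> C) : Prop :=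
  exists (mu : 'I_n -> nat) (w : 'S_n.+1) (eta : 'I_n -> int),
    [/\ PrZ p mu, condC q w eta &
        forall i, lam i = dot_act w (fun l => (mu l)%:R - (p%:R / q%:R) * (eta l)%:~R) i].

Definition Pr_adm_prin (V : lmodType C) (rho : M -> V -> V) (p q : nat) (lam : 'I_n -> C) :=
  Pr_adm p q lam /\ forall y, assoc_var rho y <-> zclosure Oprin y.

(* exp(ad x) for x with x^2 = 0 (then (ad x)^3 = 0) *)
Definition expad (x y : M) : M := y + lbr x y + 2%:R^-1 *: lbr x (lbr x y).
Definition r_aut (i : nat) (y : M) : M :=
  expad (fch i) (expad (- ech i) (expad (fch i) y)).
(* sigma: e_i -> e_{n+1-i}, f_i -> f_{n+1-i}, h_i -> -h_{n+1-i} *)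
Definition Jmx : M := \matrix_(i, j) (((i + j)%N == n)%:R).
Definition sigma_aut (y : M) : M := Jmx *m y^T *m Jmx.

Inductive Wbar : (M -> M) -> Prop :=
| Wbar_id : Wbar id
| Wbar_r (i : 'I_n) u : Wbar u -> Wbar (r_aut i \o u)
| Wbar_sigma u : Wbar u -> Wbar (sigma_aut \o u).

(* u(alpha_i) = w(alpha_i) for all i, u acting on roots through root spaces *)
Definition same_base (u : M -> M) (w : 'S_n.+1) : Prop :=
  forall i : 'I_n, exists c : C, c != 0 /\
    u (ech i) = c *: delta_mx (w (inord i)) (w (inord i.+1)).

(* arrays v_{j,i}, 0 <= i <= j <= n, stored in a finite function; entries
   with i > j are required to be 0 *)
Definition GTarr := {ffun 'I_n.+1 * 'I_n.+1 -> C}.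
Definition ent (v : GTarr) (j i : nat) : C := v (inord j, inord i).
Definition shift (v : GTarr) (k i : nat) (s : C) : GTarr :=
  [ffun p => v p + (if p == (inord k, inord i) then s else 0)].

Definition gt_den (v : GTarr) (k i : nat) : C :=
  \prod_(j < k.+1 | j != i :> nat) (ent v k i - ent v k j).

Definition strongly_tame_GT (V : lmodType C) (pi : M -> V -> V) : Prop :=
  exists (S : GTarr -> Prop) (T : GTarr -> V),
  [/\ (forall v, S v -> forall j i : 'I_n.+1, (j < i)%N -> v (j, i) = 0),
      (forall v, ~ S v -> T v = 0),
      (forall (s : seq GTarr) (c : GTarr -> C), uniq s -> (forall v, v \in s -> S v) ->
          \sum_(v <- s) c v *: T v = 0 -> forall v, v \in s -> c v = 0),
      (forall x : V, exists (s : seq GTarr) (c : GTarr -> C),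
          (forall v, v \in s -> S v) /\ x = \sum_(v <- s) c v *: T v) &
      (forall v, S v -> forall k : 'I_n,
        [/\ pi (ech k) (T v) =
              - \sum_(i < k.+1)
                  (if gt_den v k i != 0 then
                     ((\prod_(j < k.+2) (ent v k i - ent v k.+1 j)) / gt_den v k i)
                       *: T (shift v k i 1)
                   else 0),
            pi (fch k) (T v) =
              \sum_(i < k.+1)
                  (if gt_den v k i != 0 then
                     ((\prod_(j < k) (ent v k i - ent v k.-1 j)) / gt_den v k i)
                       *: T (shift v k i (-1))
                   else 0) &
            pi (hch k) (T v) =
              (2%:R * \sum_(i < k.+1) ent v k i - \sum_(i < k) ent v k.-1 i
                - \sum_(i < k.+2) ent v k.+1 i - 1) *: T v])].

(* M is strongly tame Gamma_st(w(Pi_st))-GT: exists u in Wbar with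
   u(Pi_st) = w(Pi_st) and M^{u^{-1}} (action a.v = u(a) v) strongly tame *)
Definition strongly_tame_GT_base (V : lmodType C) (rho : M -> V -> V) (w : 'S_n.+1) :=
  exists u : M -> M, [/\ Wbar u, same_base u w &
    strongly_tame_GT (fun a v => rho (u a) v)].

End Defs.

(* Main.v *)
Require Import Defs.
From HB Require Import structures.
From mathcomp Require Import all_boot all_order all_fingroup all_algebra.
From mathcomp Require Import boolp functions.
From mathcomp Require Import zify ring.
Set Implicit Arguments. Unset Strict Implicit. Unset Printing Implicit Defensive.
Import Order.TTheory GRing.Theory Num.Theory.
Local Open Scope ring_scope.

(* Write L_a = (lambda + rho)_a. Admissibility makes every integral difference L_a - L_b (a < b) positive.

   If some difference is integral, the annihilator of L(lambda) is too large. Order the Borel so that the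
   position n-1 comes first, and let X_j be the (n, n-1) entry of the j-th power of the matrix (E_ab) over
   U(gl). The X_j (1 <= j <= n) commute with the lowering operators and with gl on the positions 0..n-2, so in
   the tableau module of that Borel a monomial in the X_j maps the highest weight vector to a combination of
   tableaux that differ from it in row n-1 only, one entry of which has a bounded range. Hence there are fewer
   tableaux than monomials, some polynomial in the X_j kills the highest weight vector and therefore the module,
   and its symbol does not vanish at the principal nilpotents y, for which the numbers (y^j)_{0,n} are arbitrary.

   So no difference is integral. For each w, the span of the tableaux with the sign pattern of w is a
   gl-module under the truncated formulas, with a highest weight vector for the Borel w(b). For w = 1 it is
   generated by that vector and has no other singular vector, so it is L(lambda). For general w the tableaux
   of a given height are indexed by PBW exponents just as for w = 1, so the graded dimensions agree, and this
   forces the correspondence generated by the two highest weight vectors to be an isomorphism. *)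

(** The order with position n-1 first and n last is chosen for two reasons. It makes [E_{n,n-1}] the
    lowest root vector, and each new position k+1 precedes or follows all positions up to k, so the
    truncated formulas keep nonzero denominators even when integral differences occur; for a general
    order they need not. The count sets K^n monomials with exponents below K against tableaux given
    by n amounts of lowering of size O(K), one of them bounded, hence O(K^(n-1)) many. In the
    nonintegral case L(lambda) is compared with the tableau module inside their product: the
    submodule generated by the pair of highest weight vectors is a relation, and simplicity of
    L(lambda), together with the grading by height, makes it total and injective on that side. The
    other half, that every tableau occurs and that only 0 is related to 0, is proved directly for
    the standard order, where entries can be raised one at a time. For other w it becomes a count in
    each height, possible because the lift of w matches the grading elements of the two Borel
    subalgebras, so that heights in L(lambda) do not depend on w. *)

(* [ring] only handles commutative rings; [zmod] decides abelian group identities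
   between noncommutative monomials. *)
Inductive zexpr := ZVar of nat | ZAdd of zexpr & zexpr | ZOpp of zexpr | ZZero.

Section ZmodReflection.
Variable V : zmodType.
Fixpoint zeval (env : seq V) t := match t with
  | ZVar i => nth 0 env i | ZAdd a b => zeval env a + zeval env b
  | ZOpp a => - zeval env a | ZZero => 0 end.
Fixpoint zcoef t (i : nat) : int := match t with
  | ZVar j => (i == j)%:R | ZAdd a b => zcoef a i + zcoef b i
  | ZOpp a => - zcoef a i | ZZero => 0 end.

Lemma zevalE env t : zeval env t = \sum_(i < size env) nth 0 env i *~ zcoef t i.
Proof.
elim: t => [j|a IHa b IHb|a IHa|] /=.
- case: (ltnP j (size env)) => hj.
    rewrite (bigD1 (Ordinal hj)) //= eqxx big1 ?addr0 // => i ne.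
    by rewrite (_ : (i == j :> nat) = false) //; apply/eqP => e; case/eqP: ne; apply: val_inj.
  rewrite nth_default // big1 // => i _.
  by rewrite (_ : (i == j :> nat) = false) //; apply/eqP => e; move: hj; rewrite -e leqNgt ltn_ord.
- by rewrite IHa IHb -big_split; apply: eq_bigr => i _; rewrite mulrzDr.
- by rewrite IHa -sumrN; apply: eq_bigr => i _; rewrite mulrNz.
- by rewrite big1 // => i _; rewrite mulr0z.
Qed.

Lemma zevalP env t1 t2 :
  all (fun i => zcoef t1 i == zcoef t2 i) (iota 0 (size env)) -> zeval env t1 = zeval env t2.
Proof.
move=> /allP h; rewrite !zevalE; apply: eq_bigr => i _.
by rewrite (eqP (h i _)) // mem_iota add0n ltn_ord.
Qed.
End ZmodReflection.

(* atoms are compared up to conversion: the same product may carry different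
   canonical-structure paths *)
Ltac zlookup x l := match l with
  | cons ?y _ => let _ := match goal with _ => unify x y end in constr:(O)
  | cons _ ?l' => let n := zlookup x l' in constr:(S n)
  | @nil ?T => constr:(O) end.
Ltac zinsert x l := match l with
  | cons ?y _ => let _ := match goal with _ => unify x y end in l
  | cons ?y ?l' => let l2 := zinsert x l' in constr:(cons y l2)
  | @nil ?T => constr:(cons x (@nil T)) end.
Ltac zatoms t l := match t with
  | @GRing.add _ ?a ?b => let l1 := zatoms a l in zatoms b l1
  | @GRing.opp _ ?a => zatoms a l
  | @GRing.zero _ => l
  | ?x => zinsert x l end.
Ltac zreify t l := match t with
  | @GRing.add _ ?a ?b => let a1 := zreify a l in let b1 := zreify b l in constr:(ZAdd a1 b1)
  | @GRing.opp _ ?a => let a1 := zreify a l in constr:(ZOpp a1)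
  | @GRing.zero _ => constr:(ZZero)
  | ?x => let n := zlookup x l in constr:(ZVar n) end.
Ltac zmod := match goal with |- @eq ?T ?a ?b =>
  let l0 := zatoms a (@nil T) in let l := zatoms b l0 in
  let ta := zreify a l in let tb := zreify b l in
  refine (@zevalP _ l ta tb _); vm_compute; reflexivity end.

Ltac nateq := repeat match goal with |- context[@eq_op _ ?a ?b] =>
  first [have -> : (a == b) = true by lia | have -> : (a == b) = false by lia] end.

(** * Serre relations and the relations of gl *)

Section Bracket.
Variable A : pzRingType.
Implicit Types a b c : A.

Definition br a b := a * b - b * a.

Lemma brN a b : br b a = - br a b. Proof. by rewrite /br opprB. Qed.
Lemma br0 a : br a 0 = 0. Proof. by rewrite /br mulr0 mul0r subrr. Qed.
Lemma br0l a : br 0 a = 0. Proof. by rewrite /br mulr0 mul0r subrr. Qed.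
Lemma brBl a b c : br (a - b) c = br a c - br b c.
Proof. rewrite /br !mulrBl !mulrBr; zmod. Qed.
Lemma brBr a b c : br c (a - b) = br c a - br c b.
Proof. rewrite /br !mulrBl !mulrBr; zmod. Qed.
Lemma brNl a b : br (- a) b = - br a b. Proof. by rewrite /br mulNr mulrN opprD opprK. Qed.
Lemma brNr a b : br a (- b) = - br a b. Proof. by rewrite /br mulNr mulrN opprD opprK. Qed.
Lemma jacobi a b c : br (br a b) c = br (br a c) b + br a (br b c).
Proof. rewrite /br !mulrBl !mulrBr !mulrA; zmod. Qed.
Lemma jacobi' a b c : br a (br b c) = br (br a b) c + br b (br a c).
Proof. rewrite /br !mulrBl !mulrBr !mulrA; zmod. Qed.
End Bracket.

Section SerreUpper.
Variables (A : pzRingType) (n : nat) (e f H : nat -> A).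
Hypothesis two_inj : forall z : A, z + z = 0 -> z = 0.
Hypothesis eC : forall i j, (i.+1 < j)%N || (j.+1 < i)%N -> br (e i) (e j) = 0.
Hypothesis eS : forall i j, (i.+1 == j) || (j.+1 == i) -> br (e i) (br (e i) (e j)) = 0.
Hypothesis ef : forall i j, br (e i) (f j) = if (i == j) && (i < n)%N then H i - H i.+1 else 0.
Hypothesis He : forall a k, br (H a) (e k) = e k *+ (a == k) - e k *+ (a == k.+1).

Let eS' i j : (i.+1 == j) || (j.+1 == i) -> br (br (e i) (e j)) (e j) = 0.
Proof. by move=> h; rewrite brN (brN (e j)) brNr opprK eS // orbC. Qed.

(* [raise i d] plays the role of E_{i, i+d+1} *)
Fixpoint raise (i d : nat) : A := if d is d'.+1 then br (raise i d') (e (i + d)%N) else e i.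

Lemma raise_commute i d k : (k.+1 < i)%N || (i + d + 1 < k)%N -> br (raise i d) (e k) = 0.
Proof.
elim: d => [|d IH] h /=; first by apply: eC; lia.
rewrite jacobi IH ?br0l ?add0r; last by lia.
by rewrite eC ?br0 //; lia.
Qed.

(** Adding a simple root to a string of simple roots that already contains it never gives a root of
    type A. The Serre relations yield this by strong induction on the length; the hard case is the
    last but one [k], which is the statement in [A_3] that the highest root vector commutes with the
    middle simple one. *)
Lemma raise_raise i d k : (i <= k <= i + d)%N -> br (raise i d) (e k) = 0.
Proof.
move: k; have [m] := ubnP d; elim: m d => // m IHm d hd k hk.
case: d hd hk => [|[|d]] hd hk /=.
- by rewrite (_ : k = i) /br ?subrr //; lia.
- have e1 : (i + 1 = i.+1)%N by lia.
  have [->|->] : k = i \/ k = i.+1 by lia.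
    by rewrite brN eS ?oppr0 // e1 eqxx.
  by rewrite e1 eS' // eqxx.
set a := raise i d; have E1 : (i + d.+1 = (i + d).+1)%N by lia.
have E2 : (i + d.+2 = (i + d).+2)%N by lia.
have hU : raise i d.+1 = br a (e (i + d).+1) by rewrite /= E1.
have [k1|[k2|k3]] : k = (i + d).+2 \/ k = (i + d).+1 \/ (k <= i + d)%N by lia.
- rewrite k1 E2 E1 jacobi.
  have ac : br a (e (i + d).+2) = 0 by apply: raise_commute; lia.
  rewrite (_ : br (br a (e (i + d).+1)) _ = br a (br (e (i + d).+1) (e (i + d).+2))); last first.
    by rewrite jacobi ac br0l add0r.
  rewrite jacobi ac br0l add0r (_ : br (e (i+d).+2) _ = 0) ?br0 ?addr0; last by rewrite /br subrr.
  by rewrite eS' ?br0 // eqxx.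
(* The Jacobi identity turns [[[[a,b],c],b]] into [[[a,b],[b,c]]] and that into [[b,[[a,b],c]]],
   which is its own negative. *)
- rewrite k2 E1 E2.
  have ac : br a (e (i + d).+2) = 0 by apply: raise_commute; lia.
  set b := e (i + d).+1; set c := e (i + d).+2.
  have aab : br (br a b) b = 0 by rewrite -/b -hU; apply: (IHm d.+1); lia.
  have bbc : br b (br b c) = 0 by apply: eS; lia.
  have Z1 : br (br a b) c = br a (br b c) by rewrite jacobi ac br0l add0r.
  have Z2 : br (br a (br b c)) b = br (br a b) (br b c).
    by rewrite jacobi (brN b (br b c)) bbc oppr0 br0 addr0.
  have Z3 : br (br a b) (br b c) = br b (br (br a b) c).
    by rewrite jacobi' aab br0l add0r.
  apply: two_inj; by rewrite {1}Z1 Z2 Z3 (brN _ b) addNr.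
- rewrite E1 E2 jacobi -hU (IHm d.+1) ?br0l ?add0r; [|lia|lia].
  by rewrite eC ?br0 //; lia.
Qed.

Lemma raise_prev i d : br (raise i.+1 d) (e i) = - raise i d.+1.
Proof.
elim: d => [|d IH]; first by rewrite /= addn1 brN.
rewrite [raise i.+1 d.+1]/= jacobi IH eC ?br0 ?addr0; last by lia.
by rewrite brNl [raise i d.+2]/= (_ : i.+1 + d.+1 = i + d.+2)%N //; lia.
Qed.

Lemma raise_e i d k : br (raise i d) (e k) =
  (if k == (i + d).+1 then raise i d.+1 else 0) - (if k.+1 == i then raise k d.+1 else 0).
Proof.
case: (eqVneq k (i + d).+1) => [->|ne1].
  by rewrite ifN ?subr0 /= ?addnS //; lia.
case: (eqVneq k.+1 i) => [<-|ne2]; first by rewrite raise_prev sub0r.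
rewrite subr0; case: (leqP i k) => h1; last by apply: raise_commute; lia.
case: (leqP k (i + d)) => h2; first by apply: raise_raise; lia.
by apply: raise_commute; lia.
Qed.

Lemma H_raise a i d : br (H a) (raise i d) = raise i d *+ (a == i) - raise i d *+ (a == (i + d).+1).
Proof.
elim: d => [|d IH] /=; first by rewrite addn0 He.
rewrite jacobi' IH He /br addnS.
case: (a == i); case: (a == (i + d).+1); case: (a == (i + d).+2);
 rewrite /= ?mulr1n ?mulr0n ?mul0r ?mulr0 ?subr0 ?sub0r ?subrr ?addr0 ?add0r ?mulNr ?mulrN
   ?mulr0 ?mul0r ?subr0 ?sub0r ?addr0 ?add0r ?opprK ?subrr; try zmod.
Qed.

Lemma raise_f i d k : (i + d < n)%N -> br (raise i d) (f k) =
  if d is d'.+1 then (if k == (i + d)%N then raise i d' else 0) - (if k == i then raise i.+1 d' else 0)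
  else if k == i then H i - H i.+1 else 0.
Proof.
elim: d => [|d IH] hn.
  by rewrite /= ef eq_sym; case: eqP => //= _; rewrite ifT //; lia.
rewrite [raise i d.+1]/= jacobi ef addnS IH; last by lia.
case: d IH hn => [|d] IH hn /=.
  rewrite addn0 (eq_sym _ k); case: (eqVneq k i) => [->|ne].
    nateq; rewrite br0 addr0 brBl !He; nateq; rewrite !mulr0n !mulr1n; zmod.
  rewrite br0l add0r subr0; case: eqP => [_|_] /=; last by rewrite br0.
  rewrite ifT; last by lia.
  by rewrite brN brBl !He; nateq; rewrite !mulr0n !mulr1n; zmod.
rewrite brBl (eq_sym _ k) (_ : br (if k == _ then raise i d else 0) _ = 0); last first.
  by case: eqP => _; rewrite ?br0l // raise_commute //; lia.
have -> : br (br (raise i d) (e (i + d.+1)%N)) 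
    (if (k == (i + d.+1).+1) && ((i + d.+1).+1 < n)%N
    then H (i + d.+1).+1 - H (i + d.+1).+2 else 0) = if k == (i + d.+1).+1 then raise i d.+1 else 0.
  case: eqP => [_|_] /=; last by rewrite br0.
  rewrite ifT; last by lia.
  by rewrite -/(raise i d.+1) brN brBl !H_raise; nateq; rewrite !mulr0n !mulr1n; zmod.
rewrite sub0r addrC; congr (_ - _); case: eqP => [_|_]; last by rewrite br0l.
by rewrite /= (_ : (i + d.+1).+1 = (i.+1 + d.+1)%N) // addnS addSn.
Qed.
End SerreUpper.

Section GlRelations.
Variables (A : pzRingType) (n : nat) (e f H : nat -> A).
Hypothesis two_inj : forall z : A, z + z = 0 -> z = 0.
Hypothesis eC : forall i j, (i.+1 < j)%N || (j.+1 < i)%N -> br (e i) (e j) = 0.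
Hypothesis eS : forall i j, (i.+1 == j) || (j.+1 == i) -> br (e i) (br (e i) (e j)) = 0.
Hypothesis fC : forall i j, (i.+1 < j)%N || (j.+1 < i)%N -> br (f i) (f j) = 0.
Hypothesis fS : forall i j, (i.+1 == j) || (j.+1 == i) -> br (f i) (br (f i) (f j)) = 0.
Hypothesis ef : forall i j, br (e i) (f j) = if (i == j) && (i < n)%N then H i - H i.+1 else 0.
Hypothesis He : forall a k, br (H a) (e k) = e k *+ (a == k) - e k *+ (a == k.+1).
Hypothesis Hf : forall a k, br (H a) (f k) = f k *+ (a == k.+1) - f k *+ (a == k).
Hypothesis HH : forall a b, br (H a) (H b) = 0.

Lemma br_conv (a b : A) : @br A^c a b = br b a. Proof. by []. Qed.

(** Lowering root vectors are raising ones in the opposite ring, whose bracket is reversed; every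
    fact about [raise] thus serves twice. *)
Definition lowr (i d : nat) : A := @raise A^c f i d.

(** The candidate for [E_{i,j}]. Working with the diagonal [H i] instead of the coroots makes the
    relations those of gl, which are uniform in the indices. *)
Definition glX (i j : nat) : A :=
  if (i < j)%N then raise e i (j - i.+1) else if (j < i)%N then lowr j (i - j.+1) else H i.

Let cC i j : (i.+1 < j)%N || (j.+1 < i)%N -> @br A^c (f i) (f j) = 0.
Proof. by move=> h; rewrite br_conv fC // orbC. Qed.
Let cef i j : @br A^c (f i) (e j) = if (i == j) && (i < n)%N then H i - H i.+1 else 0.
Proof. by rewrite br_conv ef eq_sym; case: eqP => [->|]. Qed.
Let cHe a k : @br A^c (H a) (f k) = f k *+ (a == k) - f k *+ (a == k.+1).
Proof. by rewrite br_conv brN Hf opprB. Qed.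

Lemma glX_e i j k : (i <= n)%N -> (j <= n)%N -> (k < n)%N ->
  br (glX i j) (e k) = glX i k.+1 *+ (j == k) - glX k j *+ (k.+1 == i).
Proof.
move=> hi hj hk; rewrite /glX; case: (ltngtP i j) => hij.
- rewrite (@raise_e _ e two_inj eC eS) (_ : (i + (j - i.+1)).+1 = j); last by lia.
  rewrite (eq_sym k j); congr (_ - _).
    case: eqP => // E; rewrite ifT; last by lia.
    by rewrite mulr1n; congr raise; lia.
  case: eqP => // h; rewrite ifT; last by lia.
  by rewrite mulr1n; congr raise; lia.
- have := @raise_f A^c n f e H cC cef cHe j (i - j.+1) k; rewrite br_conv brN => h.
  rewrite -[LHS]opprK h; last by lia.
  case E: (i - j.+1)%N => [|d].
    have ij : i = j.+1 by lia.
    rewrite ij (eq_sym k j); case: eqP => [<-|ne].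
      by rewrite eqxx !mulr1n !ltnn opprB.
    by nateq; rewrite !mulr0n subrr oppr0.
  rewrite (eq_sym j k) (_ : (j + d.+1)%N = i.-1); last by lia.
  rewrite opprB; congr (_ - _).
    case: eqP => // jk; rewrite ifN ?ifT; try lia.
    by rewrite mulr1n jk (_ : (i - j.+2)%N = d) //; lia.
  rewrite (_ : (k == i.-1) = (k.+1 == i)); last by lia.
  case: eqP => // ki; rewrite ifN ?ifT; try lia.
  by rewrite mulr1n (_ : (k - j.+1)%N = d) //; lia.
- rewrite hij He; congr (_ - _).
    by case: eqP => // <-; rewrite ltnSn subnn.
  by rewrite eq_sym; case: eqP => // <-; rewrite ltnSn subnn.
Qed.

Lemma glX_H i j a : br (glX i j) (H a) = glX i j *+ (a == j) - glX i j *+ (a == i).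
Proof.
rewrite brN -[RHS]opprB; congr (- _); rewrite /glX; case: (ltngtP i j) => hij.
- rewrite (@H_raise _ e H He); congr (_ *+ _ - _ *+ _).
  by rewrite (_ : (i + (j - i.+1)).+1 = j) //; lia.
- have := @H_raise A^c f H cHe a j (i - j.+1); rewrite br_conv brN => h.
  rewrite -[LHS]opprK h opprB (_ : (j + (i - j.+1)).+1 = i) //; lia.
- by rewrite HH hij subrr.
Qed.
End GlRelations.

Section GlRelations2.
Variables (A : pzRingType) (n : nat) (e f H : nat -> A).
Hypothesis two_inj : forall z : A, z + z = 0 -> z = 0.
Hypothesis eC : forall i j, (i.+1 < j)%N || (j.+1 < i)%N -> br (e i) (e j) = 0.
Hypothesis eS : forall i j, (i.+1 == j) || (j.+1 == i) -> br (e i) (br (e i) (e j)) = 0.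
Hypothesis fC : forall i j, (i.+1 < j)%N || (j.+1 < i)%N -> br (f i) (f j) = 0.
Hypothesis fS : forall i j, (i.+1 == j) || (j.+1 == i) -> br (f i) (br (f i) (f j)) = 0.
Hypothesis ef : forall i j, br (e i) (f j) = if (i == j) && (i < n)%N then H i - H i.+1 else 0.
Hypothesis He : forall a k, br (H a) (e k) = e k *+ (a == k) - e k *+ (a == k.+1).
Hypothesis Hf : forall a k, br (H a) (f k) = f k *+ (a == k.+1) - f k *+ (a == k).
Hypothesis HH : forall a b, br (H a) (H b) = 0.
Notation X := (glX e f H).

Lemma glX_conv i j : @glX A^c f e H i j = X j i.
Proof. by rewrite /glX; case: (ltngtP i j) => // ->. Qed.

Lemma glX_f i j k : (i <= n)%N -> (j <= n)%N -> (k < n)%N ->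
  br (X i j) (f k) = X i k *+ (j == k.+1) - X k.+1 j *+ (k == i).
Proof.
move=> hi hj hk.
have := @glX_e A^c n f e H two_inj _ _ _ _ _ _ j i k hj hi hk.
rewrite !glX_conv br_conv => h; rewrite brN h; first by rewrite opprB (eq_sym k.+1) (eq_sym k).
- by move=> a b ab; rewrite br_conv fC // orbC.
- by move=> a b ab; rewrite !br_conv brN (brN (f a)) brNr opprK fS.
- by move=> a b ab; rewrite br_conv eC // orbC.
- by move=> a b; rewrite br_conv ef eq_sym; case: eqP => [->|].
- by move=> a b; rewrite br_conv brN Hf opprB.
- by move=> a b; rewrite br_conv brN He opprB.
Qed.

Definition glrel k l := forall i j, (i <= n)%N -> (j <= n)%N ->
  br (X i j) (X k l) = X i l *+ (j == k) - X k j *+ (l == i).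

(** The bracket with [X i j] is a derivation and [X k m] is the bracket of [X k l] and [X l m], so
    the relations spread from the simple roots to all roots without a case analysis on pairs of
    roots. *)
Lemma glrel_step k l m : (k <= n)%N -> (l <= n)%N -> (m <= n)%N -> k != m ->
  glrel k l -> glrel l m -> glrel k m.
Proof.
move=> hk hl hm km P Q i j hi hj.
have E : X k m = br (X k l) (X l m).
  by rewrite Q // eqxx (eq_sym m) (negbTE km) mulr0n subr0.
rewrite {1}E jacobi' P // brBl.
have mn (a b : A) (c : bool) : br (a *+ c) b = br a b *+ c.
  by case: c; rewrite ?mulr1n ?mulr0n ?br0l.
have nm (a b : A) (c : bool) : br b (a *+ c) = br b a *+ c.
  by case: c; rewrite ?mulr1n ?mulr0n ?br0.
rewrite !mn !Q // brBr !nm (brN (X i m)) (P i m) // (brN (X l j)) (P l j) //.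
rewrite (eq_sym m k) (negbTE km) mulr0n !(eq_sym l) eqxx.
by case: (j == k); case: (i == l); case: (j == l); case: (m == i);
  rewrite ?mulr0n ?mulr1n ?(eq_sym m k) ?(negbTE km) ?mulr0n ?mulr1n; zmod.
Qed.

Lemma glX_rel k l : (k <= n)%N -> (l <= n)%N -> glrel k l.
Proof.
have Pe k' : (k' < n)%N -> glrel k' k'.+1.
  move=> hk i j hi hj; have -> : X k' k'.+1 = e k' by rewrite /glX ltnSn subnn.
  by apply: (@glX_e A n e f H).
have Pf k' : (k' < n)%N -> glrel k'.+1 k'.
  move=> hk i j hi hj; have -> : X k'.+1 k' = f k'.
    by rewrite /glX ltnSn subnn ltnNge leqnSn.
  by rewrite glX_f.
have PH k' : glrel k' k'.
  move=> i j hi hj; have -> : X k' k' = H k' by rewrite /glX ltnn.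
  rewrite (@glX_H A e f H) //; congr (_ - _).
    by rewrite eq_sym; case: eqP => // ->.
  by case: eqP => // ->.
move=> hk hl; case: (ltngtP k l) => [kl|lk|->] //.
- rewrite -(subnKC kl) in hl *; elim: (l - k.+1)%N hl => [|d IH] hd; first by rewrite addn0; apply: Pe; lia.
  apply: (@glrel_step _ (k.+1 + d)) => //; try lia; first by apply: IH; lia.
  by rewrite addnS; apply: Pe; lia.
- rewrite -(subnKC lk) in hk *; elim: (k - l.+1)%N hk => [|d IH] hd; first by rewrite addn0; apply: Pf; lia.
  apply: (@glrel_step _ (l.+1 + d)) => //; try lia; last by apply: IH; lia.
  by rewrite addnS; apply: Pf; lia.
Qed.
End GlRelations2.

(** * The ring of linear endomorphisms of a module *)

Record endo (R : pzRingType) (W : lmodType R) := Endo {efun :> W -> W; efun_linear : linear efun}.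

Section EndoRing.
Variables (R : comPzRingType) (W : lmodType R).
Local Notation E := (endo W).

Lemma endo_ext (f g : E) : f =1 g -> f = g.
Proof.
case: f g => f lf [g lg] /= /funext e; subst g; congr Endo; exact: Prop_irrelevance.
Qed.

HB.instance Definition _ := gen_eqMixin E.
HB.instance Definition _ := gen_choiceMixin E.

Lemma endoD (f : E) u v : f (u + v) = f u + f v.
Proof. by have := efun_linear f 1 u v; rewrite !scale1r. Qed.
Lemma endo0 (f : E) : f 0 = 0.
Proof. by have := endoD f 0 0; rewrite addr0 => /esym/eqP; rewrite -subr_eq0 addrK => /eqP. Qed.
Lemma endoZ (f : E) a u : f (a *: u) = a *: f u.
Proof. by have := efun_linear f a u 0; rewrite !addr0 endo0 addr0. Qed.
Lemma endoN (f : E) u : f (- u) = - f u.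
Proof. by rewrite -scaleN1r endoZ scaleN1r. Qed.
Lemma endoB (f : E) u v : f (u - v) = f u - f v.
Proof. by rewrite endoD endoN. Qed.
Lemma endo_sum (f : E) I (r : seq I) (P : pred I) (F : I -> W) :
  f (\sum_(i <- r | P i) F i) = \sum_(i <- r | P i) f (F i).
Proof. exact: (big_morph f (endoD f) (endo0 f)). Qed.

Fact endo_add_lin (f g : E) : linear (fun u => f u + g u).
Proof. by move=> a u v; rewrite !endoD !endoZ scalerDr addrACA. Qed.
Fact endo_opp_lin (f : E) : linear (fun u => - f u).
Proof. by move=> a u v; rewrite endoD endoZ scalerN opprD. Qed.
Fact endo_zero_lin : linear (fun u : W => 0 : W).
Proof. by move=> a u v; rewrite scaler0 addr0. Qed.
Fact endo_one_lin : linear (fun u : W => u).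
Proof. by []. Qed.
Fact endo_mul_lin (f g : E) : linear (fun u => f (g u)).
Proof. by move=> a u v; rewrite !endoD !endoZ. Qed.
Fact endo_scale_lin (c : R) (f : E) : linear (fun u => c *: f u).
Proof. by move=> a u v; rewrite endoD endoZ scalerDr !scalerA mulrC. Qed.

Definition endo_add f g : E := Endo (endo_add_lin f g).
Definition endo_opp f : E := Endo (endo_opp_lin f).
Definition endo_zero : E := Endo endo_zero_lin.
Definition endo_one : E := Endo endo_one_lin.
Definition endo_mul f g : E := Endo (endo_mul_lin f g).

Fact endo_addA : associative endo_add.
Proof. by move=> f g h; apply: endo_ext => u /=; rewrite addrA. Qed.
Fact endo_addC : commutative endo_add.
Proof. by move=> f g; apply: endo_ext => u /=; rewrite addrC. Qed.
Fact endo_add0 : left_id endo_zero endo_add.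
Proof. by move=> f; apply: endo_ext => u /=; rewrite add0r. Qed.
Fact endo_addN : left_inverse endo_zero endo_opp endo_add.
Proof. by move=> f; apply: endo_ext => u /=; rewrite addNr. Qed.
HB.instance Definition _ := GRing.isZmodule.Build E endo_addA endo_addC endo_add0 endo_addN.

Fact endo_mulA : associative endo_mul.
Proof. by move=> f g h; apply: endo_ext. Qed.
Fact endo_mul1 : left_id endo_one endo_mul.
Proof. by move=> f; apply: endo_ext. Qed.
Fact endo_1mul : right_id endo_one endo_mul.
Proof. by move=> f; apply: endo_ext. Qed.
Fact endo_mulDl : left_distributive endo_mul endo_add.
Proof. by move=> f g h; apply: endo_ext. Qed.
Fact endo_mulDr : right_distributive endo_mul endo_add.
Proof. by move=> f g h; apply: endo_ext => u /=; rewrite endoD. Qed.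
HB.instance Definition _ := GRing.Zmodule_isPzRing.Build E
  endo_mulA endo_mul1 endo_1mul endo_mulDl endo_mulDr.

Lemma endo_subE (f g : E) u : (f - g) u = f u - g u. Proof. by []. Qed.
Lemma endo_brE (f g : E) u : br f g u = f (g u) - g (f u). Proof. by []. Qed.
Lemma endo_mulbE (f : E) (b : bool) u : (f *+ b) u = f u *+ b. Proof. by case: b. Qed.
End EndoRing.

(** * Gelfand-Tsetlin tableaux *)

Section Tableaux.
Variables (C : numClosedFieldType) (n : nat).
Local Notation arr := (GTarr C n).
Implicit Types (u v z : arr).

Lemma inord_eq (a b : nat) : (a <= n)%N -> (b <= n)%N -> (inord a == inord b :> 'I_n.+1) = (a == b).
Proof. by move=> ha hb; rewrite -val_eqE /= !inordK. Qed.

Lemma ent_shift v k i s k' i' : (k <= n)%N -> (i <= n)%N -> (k' <= n)%N -> (i' <= n)%N ->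
  ent (shift v k i s) k' i' = ent v k' i' + (if (k' == k) && (i' == i) then s else 0).
Proof. by move=> *; rewrite /ent ffunE xpair_eqE !inord_eq. Qed.

Lemma ent_shift_row v k i s k' i' : (k <= n)%N -> (i <= n)%N -> (k' <= n)%N -> (i' <= n)%N ->
  k' != k -> ent (shift v k i s) k' i' = ent v k' i'.
Proof. by move=> h1 h2 h3 h4 ne; rewrite ent_shift // (negbTE ne) addr0. Qed.

Lemma shiftC v k i s k' i' s' :
  shift (shift v k i s) k' i' s' = shift (shift v k' i' s') k i s.
Proof. by apply/ffunP => p; rewrite !ffunE -!addrA; congr (_ + _); rewrite addrC. Qed.

Lemma shiftK v k i s : shift (shift v k i s) k i (- s) = v.
Proof. by apply/ffunP => p; rewrite !ffunE -addrA; case: eqP; rewrite ?subrr !addr0. Qed.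

Lemma shiftKV v k i s : shift (shift v k i (- s)) k i s = v.
Proof. by rewrite -{2}(opprK s) shiftK. Qed.

(* A move is (s, k, i): entry (k, i) goes up by one if s (as under e_k) and down
   otherwise (as under f_k). *)
Definition move := (bool * nat * nat)%type.
Implicit Types (m : move) (p : seq move).
Definition sg (s : bool) : C := if s then 1 else -1.
Definition mv m v := shift v m.1.2 m.2 (sg m.1.1).
Definition umv m v := shift v m.1.2 m.2 (- sg m.1.1).
Definition okm m := (m.1.2 < n)%N && (m.2 <= m.1.2)%N.

Lemma mvK m v : umv m (mv m v) = v. Proof. exact: shiftK. Qed.
Lemma umvK m v : mv m (umv m v) = v. Proof. exact: shiftKV. Qed.
Lemma mvC m m' v : mv m (mv m' v) = mv m' (mv m v). Proof. exact: shiftC. Qed.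
Lemma umvC m m' v : umv m (umv m' v) = umv m' (umv m v). Proof. exact: shiftC. Qed.

(** The row that enters the numerator of a move in row [k]. For a lowering move in row 0 the
    truncated predecessor is harmless, because [nsz] is then 0 and the product is empty. *)
Definition nb (s : bool) (k : nat) := if s then k.+1 else k.-1.
Definition nsz (s : bool) (k : nat) := if s then k.+2 else k.
Definition gt_num (s : bool) k i v := \prod_(j < nsz s k) (ent v k i - ent v (nb s k) j).
(** The coefficient of a move without the global minus sign of [e_k]; the sign is restored in [eop],
    when the moves become a representation. *)
Definition fc m v := gt_num m.1.1 m.1.2 m.2 v / gt_den v m.1.2 m.2.

Fixpoint fcp p v := if p is m :: p' then fc m v * fcp p' (mv m v) else 1.
Fixpoint endp p v := if p is m :: p' then endp p' (mv m v) else v.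

Variables (pw : nat -> nat) (l : nat -> C).

Definition isZ (x : C) := exists z : int, x = z%:~R.

Lemma intC_inj (a b : int) : (a%:~R = b%:~R :> C) -> a = b.
Proof. by move=> /eqP; rewrite eqr_int => /eqP. Qed.

Lemma isZB x y : isZ x -> isZ y -> isZ (x - y).
Proof. by move=> [a ->] [b ->]; exists (a - b); rewrite rmorphB. Qed.
Lemma isZD x y : isZ x -> isZ y -> isZ (x + y).
Proof. by move=> [a ->] [b ->]; exists (a + b); rewrite rmorphD. Qed.
Lemma isZN x : isZ x -> isZ (- x).
Proof. by move=> [a ->]; exists (- a); rewrite rmorphN. Qed.
Lemma isZ0 : isZ 0. Proof. by exists 0. Qed.
Lemma isZsg s : isZ (sg s). Proof. by case: s; [exists 1|exists (-1)]. Qed.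

Definition good (b : bool) (x : C) := forall z : int, x = z%:~R -> if b then 0 < z else z <= 0.

(* [pw i] is the rank of the position i in the ordering that defines the Borel subalgebra. A tableau is
   allowed when, among the integral differences v_{k,i} - v_{k+1,j}, exactly those with [cbit k i j] are
   positive. *)
Definition cbit (k i j : nat) := (pw i < pw j)%N || (i == j) && (pw k.+1 < pw i)%N.

Definition lattice v := [/\ (forall j i : 'I_n.+1, (j < i)%N -> v (j, i) = 0),
  (forall i, (i <= n)%N -> ent v n i = l i) &
  (forall k i, (k <= n)%N -> (i <= k)%N -> isZ (ent v k i - l i))].

Definition inS v := lattice v /\ forall k i j, (k < n)%N -> (i <= k)%N -> (j <= k.+1)%N ->
  good (cbit k i j) (ent v k i - ent v k.+1 j).

(* A chain of moves with nonzero coefficients can only destroy comparisons v_{k,i} > v_{k+1,j}; hence such a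
   chain between two members of S never leaves S. *)
Definition les v v' := forall k i j, (k < n)%N -> (i <= k)%N -> (j <= k.+1)%N ->
  forall z z' : int, ent v k i - ent v k.+1 j = z%:~R -> ent v' k i - ent v' k.+1 j = z'%:~R ->
  0 < z' -> 0 < z.

Lemma lattice_diff v v' k i j : lattice v -> lattice v' -> (k < n)%N -> (i <= k)%N -> (j <= k.+1)%N ->
  isZ (ent v k i - ent v k.+1 j) -> isZ (ent v' k i - ent v' k.+1 j).
Proof.
move=> [_ _ h] [_ _ h'] hk hi hj hz.
have -> : ent v' k i - ent v' k.+1 j = (ent v k i - ent v k.+1 j)
   + ((ent v' k i - l i) - (ent v k i - l i)) - ((ent v' k.+1 j - l j) - (ent v k.+1 j - l j)) by ring.
by apply: isZB; [apply: isZD => //|]; apply: isZB; (apply: h || apply: h'); lia.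
Qed.

(** Positivity is inherited backwards along [les]: a required positive difference of [z] comes from
    [v'], and a forbidden one would already be present in [v]. *)
Lemma inS_mid v z v' : inS v -> inS v' -> lattice z -> les v z -> les z v' -> inS z.
Proof.
move=> [lv bv] [lv' bv'] lz h h'; split=> // k i j hk hi hj y hy.
have [a ha] : isZ (ent v k i - ent v k.+1 j) by apply: (lattice_diff lz) => //; exists y.
have [b hb] : isZ (ent v' k i - ent v' k.+1 j) by apply: (lattice_diff lz) => //; exists y.
have := bv k i j hk hi hj _ ha; have := bv' k i j hk hi hj _ hb.
case: (cbit k i j) => hb0 ha0; first exact: (h' k i j hk hi hj _ _ hy hb).
rewrite leNgt; apply/negP => y0; have := h k i j hk hi hj _ _ ha hy y0; lia.
Qed.

Lemma les_refl v : les v v.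
Proof. by move=> k i j _ _ _ z z' -> /intC_inj ->. Qed.

Lemma les_trans v z v' : lattice v -> lattice z -> les v z -> les z v' -> les v v'.
Proof.
move=> lv lz h h' k i j hk hi hj a b ha hb b0.
have [c hc] : isZ (ent z k i - ent z k.+1 j) by apply: (lattice_diff lv) => //; exists a.
exact: (h k i j hk hi hj _ _ ha hc (h' k i j hk hi hj _ _ hc hb b0)).
Qed.

Lemma lattice_mv m v : okm m -> lattice v -> lattice (mv m v).
Proof.
case: m => [[s k] i] /andP[/= hk hi] [h1 h2 h3]; split.
- move=> a b ab; rewrite ffunE h1 // add0r; case: eqP => // -[ha hb].
  by move: ab; rewrite ha hb !inordK; lia.
- by move=> a ha; rewrite ent_shift_row ?h2 //=; lia.
- move=> a b ha hb; rewrite ent_shift /=; try lia.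
  rewrite addrAC; apply: isZD; first exact: h3.
  by case: ifP => _; [exact: isZsg|exact: isZ0].
Qed.

Lemma gt_num_neq0 s k i v j : gt_num s k i v != 0 -> (j < nsz s k)%N -> ent v k i != ent v (nb s k) j.
Proof.
move=> h hj; apply: contraNneq h => e; rewrite /gt_num (bigD1 (Ordinal hj)) //=.
by rewrite e subrr mul0r.
Qed.

(** A comparison between adjacent rows can only be created by passing from difference 0 to
    difference 1, and at difference 0 the numerator of the move has a vanishing factor. *)
Lemma les_mv_num m v : okm m -> lattice v -> gt_num m.1.1 m.1.2 m.2 v != 0 -> les v (mv m v).
Proof.
case: m => [[s k] i] /andP[/= hk hi] lv h.
move=> a b c ha hb hc z z' hz; rewrite /mv /= !ent_shift; try lia.
case: (eqVneq a k) => [ak|ak]; [rewrite (_ : (a.+1 == k) = false); last by lia|case: (eqVneq a.+1 k) => [ak1|ak1]].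
- rewrite /= addr0; case: (eqVneq b i) => [bi|bi]; last by rewrite addr0 hz => /intC_inj ->.
  case: s h => h; rewrite /sg.
    have := gt_num_neq0 h (j := c); rewrite /= -ak /= => /(_ _)/eqP ne.
    rewrite addrAC hz => e.
    have -> : z' = z + 1 by apply: intC_inj; rewrite -e rmorphD.
    suff : z != 0 by lia.
    apply/eqP => z0; apply: ne; first lia.
    by apply/eqP; rewrite -subr_eq0 -bi hz z0.
  rewrite addrAC hz => e.
  have -> : z' = z - 1 by apply: intC_inj; rewrite -e rmorphB.
  by lia.
- rewrite /= addr0; case: (eqVneq c i) => [ci|ci]; last by rewrite addr0 hz => /intC_inj ->.
  case: s h => h; rewrite /sg.
    rewrite opprD addrA hz => e.
    have -> : z' = z - 1 by apply: intC_inj; rewrite -e rmorphB.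
    by lia.
  have := gt_num_neq0 h (j := b); rewrite /= -ak1 /= => /(_ _)/eqP ne.
  rewrite opprD opprK addrA hz => e.
  have -> : z' = z + 1 by apply: intC_inj; rewrite -e rmorphD.
  suff : z != 0 by lia.
  apply/eqP => z0; apply: ne; first lia.
  by apply/esym/eqP; rewrite -subr_eq0 -ci hz z0.
- by rewrite /= !addr0 hz => /intC_inj ->.
Qed.

Lemma les_mv m v : okm m -> lattice v -> fc m v != 0 -> les v (mv m v).
Proof. by move=> okm1 lv; rewrite /fc mulf_eq0 negb_or => /andP[h _]; exact: les_mv_num. Qed.

(** The move followed by its inverse is a chain from [v] back to [v], so [inS_mid] applies to the
    tableau in the middle. *)
Lemma inS_mv m v : okm m -> inS v -> gt_num m.1.1 m.1.2 m.2 v != 0 ->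
  gt_num (~~ m.1.1) m.1.2 m.2 (mv m v) != 0 -> inS (mv m v).
Proof.
move=> okm1 iv h1 h2; have lm := lattice_mv okm1 (proj1 iv).
apply: (inS_mid iv iv lm (les_mv_num okm1 (proj1 iv) h1)).
have := @les_mv_num (~~ m.1.1, m.1.2, m.2) (mv m v) okm1 lm h2.
suff -> : mv (~~ m.1.1, m.1.2, m.2) (mv m v) = v by [].
by rewrite /mv /=; case: (m.1.1); rewrite /= ?shiftK ?shiftKV.
Qed.

Lemma fcp_les p v : all okm p -> lattice v -> fcp p v != 0 -> les v (endp p v) /\ lattice (endp p v).
Proof.
elim: p v => [|m p IH] v /=; first by move=> _ lv _; split=> //; exact: les_refl.
move=> /andP[okm1 okp] lv; rewrite mulf_eq0 negb_or => /andP[h1 h2].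
have lm := lattice_mv okm1 lv; have [h3 h4] := IH _ okp lm h2; split=> //.
exact: les_trans lv lm (les_mv okm1 lv h1) h3.
Qed.

(* coefficients of the formulas truncated to S *)
Definition tc m v := if `[< inS v >] && `[< inS (mv m v) >] then fc m v else 0.
Fixpoint tcp p v := if p is m :: p' then tc m v * tcp p' (mv m v) else 1.

(** Truncation does not see the intermediate tableaux: a chain with nonzero untruncated product
    between two members of S is squeezed by [les] and stays in S. Relations among truncated
    operators thereby reduce to identities of rational functions. *)
Lemma tcpE p v : all okm p -> p != [::] ->
  tcp p v = if `[< inS v >] && `[< inS (endp p v) >] then fcp p v else 0.
Proof.
move=> okp p0; case: ifP => [/andP[/asboolP iv /asboolP ie]|/negbT].
  have [f0|f0] := eqVneq (fcp p v) 0.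
    rewrite f0; elim: p v f0 {okp p0 iv ie} => [|m p IH] v /=; first by move/eqP; rewrite oner_eq0.
    move/eqP; rewrite mulf_eq0 => /orP[/eqP h|/eqP h]; last by rewrite IH ?mulr0.
    by rewrite /tc h; case: ifP; rewrite mul0r.
  elim: p v okp iv ie f0 {p0} => //= m p IH v /andP[okm1 okp] iv ie.
  rewrite mulf_eq0 negb_or => /andP[h1 h2].
  have [lv _] := iv; have lm := lattice_mv okm1 lv.
  have [h3 h4] := fcp_les okp lm h2.
  have im : inS (mv m v) by apply: (inS_mid iv ie lm _ h3); exact: les_mv.
  by rewrite /tc (asboolT iv) (asboolT im) /= IH.
rewrite negb_and => h.
elim: p v okp p0 h => //= m p IH v /andP[okm1 okp] _ h.
rewrite /tc; case: asboolP h => //= iv; last by rewrite mul0r.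
case: p IH okp => [|m' p] IH okp /=; first by move=> /negbTE ->; rewrite mul0r.
by move=> h; rewrite -[tc _ _ * _]/(tcp (m' :: p) (mv m v)) IH ?mulr0 // h orbT.
Qed.


Hypothesis pw_inj : forall i j, (i <= n)%N -> (j <= n)%N -> pw i = pw j -> i = j.
(** If position [k+1] came between two integrally related positions [i] and [j], the conditions on
    rows [k] and [k+1] would not separate the entries [(k,i)] and [(k,j)], and a denominator could
    vanish. *)
Hypothesis sep : forall k i j, (k < n)%N -> (i <= k)%N -> (j <= k)%N ->
  (pw i < pw k.+1)%N -> (pw k.+1 < pw j)%N -> ~ isZ (l i - l j).

Lemma lattice_int v i : lattice v -> exists a : nat -> nat -> int,
  forall k j, (k <= n)%N -> (j <= k)%N -> isZ (l j - l i) -> ent v k j = l i + (a k j)%:~R.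
Proof.
move=> [_ _ h].
have /choice[a ha] : forall kj : nat * nat, exists y : int,
    (kj.1 <= n)%N -> (kj.2 <= kj.1)%N -> isZ (l kj.2 - l i) -> ent v kj.1 kj.2 = l i + y%:~R.
  move=> [k j] /=; case: (pselect [/\ (k <= n)%N, (j <= k)%N & isZ (l j - l i)]); last first.
    by move=> ne; exists 0 => h1 h2 h3; case: ne.
  move=> [h1 h2 h3]; have [y hy] := isZD (h _ _ h1 h2) h3; exists y => _ _ _.
  by rewrite -hy; ring.
by exists (fun k j => a (k, j)) => k j; apply: (ha (k, j)).
Qed.

Section InS.
Variables (v : arr).
Hypothesis vS : inS v.

Lemma inS_bit i (a : nat -> nat -> int) k j j' :
  (forall k j, (k <= n)%N -> (j <= k)%N -> isZ (l j - l i) -> ent v k j = l i + (a k j)%:~R) ->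
  (k < n)%N -> (j <= k)%N -> (j' <= k.+1)%N -> isZ (l j - l i) -> isZ (l j' - l i) ->
  if cbit k j j' then a k.+1 j' < a k j else a k j <= a k.+1 j'.
Proof.
move=> ha hk hj hj' z1 z2; have [_ /(_ k j j' hk hj hj' (a k j - a k.+1 j'))] := vS.
rewrite !ha //; try lia; rewrite rmorphB /= opprD addrACA subrr add0r => /(_ erefl).
by case: ifP => _; lia.
Qed.

Lemma row_isZ k i j : (k <= n)%N -> (i <= k)%N -> (j <= k)%N -> isZ (ent v k j - ent v k i) -> isZ (l j - l i).
Proof.
move=> hk hi hj hz; have [[_ _ h] _] := vS.
have -> : l j - l i = ent v k j - ent v k i - ((ent v k j - l j) - (ent v k i - l i)) by ring.
by apply: isZB => //; apply: isZB; apply: h.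
Qed.

(** An entry of row [k+1] lies between the two, strictly below the larger one or weakly above the
    smaller one as needed: [(k+1,i)] when position [k+1] precedes [i], and [(k+1,j)] when it follows
    [j]. The remaining case is excluded by [sep]. *)
Lemma row_gt k i j : (k < n)%N -> (i <= k)%N -> (j <= k)%N -> (pw i < pw j)%N ->
  forall z : int, ent v k i - ent v k j = z%:~R -> 0 < z.
Proof.
move=> hk hi hj ij z hz; have [a ha] := @lattice_int v j (proj1 vS).
have zi : isZ (l i - l j) by apply: (@row_isZ k) => //; [lia|exists z].
have zj : isZ (l j - l j) by rewrite subrr; exact: isZ0.
have -> : z = a k i - a k j.
  by apply: intC_inj; rewrite -hz !ha //; [rewrite rmorphB /=; ring|lia|lia].
have ne : (i == j) = false by apply/eqP => e; move: ij; rewrite e ltnn.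
have := inS_bit ha hk hi (leqW hj) zi zj; rewrite /cbit ij /= => h1.
have := inS_bit ha hk hi (leqW hi) zi zi; rewrite /cbit ltnn eqxx /= => h2.
have := inS_bit ha hk hj (leqW hi) zj zi; rewrite /cbit (ltnNge (pw j)) (ltnW ij) eq_sym ne /= => h3.
have := inS_bit ha hk hj (leqW hj) zj zj; rewrite /cbit ltnn eqxx /= => h4.
have nk t : (t <= k)%N -> pw t <> pw k.+1 by move=> ht /pw_inj; lia.
case: (ltngtP (pw k.+1) (pw i)) h2 h4 => [c|c|c]; [|case: (ltngtP (pw k.+1) (pw j)) => [c'|c'|c']|].
- by rewrite (ltn_trans c ij); lia.
- by case: (sep hk hi hj c c').
- lia.
- by case: (nk j hj).
- by case: (nk i hi).
Qed.

Lemma row_inj k i j : (k < n)%N -> (i <= k)%N -> (j <= k)%N -> i != j -> ent v k i != ent v k j.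
Proof.
move=> hk hi hj ij; apply/eqP => e; have e0 : ent v k i - ent v k j = 0%:~R by rewrite e subrr.
have e1 : ent v k j - ent v k i = 0%:~R by rewrite e subrr.
case: (ltngtP (pw i) (pw j)) => c.
- by have := row_gt hk hi hj c e0.
- by have := row_gt hk hj hi c e1.
- by move: ij; rewrite (@pw_inj i j) ?eqxx //; lia.
Qed.

Lemma gt_den_neq0 k i : (k < n)%N -> (i <= k)%N -> gt_den v k i != 0.
Proof.
move=> hk hi; apply/prodf_neq0 => j ne; rewrite subr_eq0.
by apply: row_inj => //; [have := ltn_ord j; lia|rewrite eq_sym].
Qed.

Lemma adj_order k i j : (k < n)%N -> (i <= k)%N -> (j <= k)%N -> ent v k j = ent v k i + 1 -> (pw j < pw i)%N.
Proof.
move=> hk hi hj e; case: (ltngtP (pw j) (pw i)) => // c.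
  have e1 : ent v k i - ent v k j = (-1)%:~R by rewrite e; ring.
  by have := row_gt hk hi hj c e1.
have ij : i = j by apply: pw_inj => //; lia.
by move/eqP: e; rewrite ij -subr_eq0 opprD addrA subrr sub0r oppr_eq0 oner_eq0.
Qed.

(** For consecutive values the squeeze of [row_gt] leaves no room: the separating entry of row [k+1]
    equals the smaller of the two. This supplies a zero of the numerator wherever a denominator of
    the diagonal relation degenerates. *)
Lemma cross_up k i j : (k < n)%N -> (i <= k)%N -> (j <= k)%N -> ent v k j = ent v k i + 1 ->
  exists2 q, (q <= k.+1)%N & ent v k.+1 q = ent v k i.
Proof.
move=> hk hi hj e; have ji := adj_order hk hi hj e.
have [a ha] := @lattice_int v i (proj1 vS).
have zj : isZ (l j - l i) by apply: (@row_isZ k) => //; [lia|rewrite e; exists 1; ring].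
have zi : isZ (l i - l i) by rewrite subrr; exact: isZ0.
have E : a k j = a k i + 1.
  apply: intC_inj; rewrite rmorphD /=; apply: (addrI (l i)).
  by rewrite addrA -!ha //; lia.
have ne : (i == j) = false by apply/eqP => ij; move: ji; rewrite ij ltnn.
have := inS_bit ha hk hi (leqW hi) zi zi; rewrite /cbit ltnn eqxx /= => h1.
have := inS_bit ha hk hi (leqW hj) zi zj; rewrite /cbit (ltnNge (pw i)) (ltnW ji) ne /= => h2.
have := inS_bit ha hk hj (leqW hi) zj zi; rewrite /cbit ji /= => h3.
have := inS_bit ha hk hj (leqW hj) zj zj; rewrite /cbit ltnn eqxx /= => h4.
case: (ltnP (pw k.+1) (pw j)) h4 h1 => c.
  move=> h4 _; exists j; first lia.
  by rewrite !ha //; try lia; congr (_ + _%:~R); lia.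
case: (ltnP (pw k.+1) (pw i)) => c' _ h1.
  case: (sep hk hj hi _ c') => //.
  have : pw k.+1 <> pw j by move/pw_inj; lia.
  by lia.
exists i; first lia.
by rewrite !ha //; try lia; congr (_ + _%:~R); lia.
Qed.

(** In the row with index [k-1] the separating entry equals the larger of the two. It is entry [i]
    if the position that is new in row [k] precedes [i], and entry [j] otherwise, so it never is the
    new position itself. *)
Lemma cross_dn k i j : (k < n)%N -> (i <= k)%N -> (j <= k)%N -> ent v k j = ent v k i + 1 ->
  exists2 q, (q < k)%N & ent v k.-1 q = ent v k j.
Proof.
move=> hk hi hj e; have ji := adj_order hk hi hj e.
have [a ha] := @lattice_int v i (proj1 vS).
have zj : isZ (l j - l i) by apply: (@row_isZ k) => //; [lia|rewrite e; exists 1; ring].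
have zi : isZ (l i - l i) by rewrite subrr; exact: isZ0.
have E : a k j = a k i + 1.
  apply: intC_inj; rewrite rmorphD /=; apply: (addrI (l i)).
  by rewrite addrA -!ha //; lia.
have ne : (i == j) = false by apply/eqP => ij; move: ji; rewrite ij ltnn.
case: k hk hi hj e zj E => [|k] hk hi hj e zj E; first lia.
have hk' : (k < n)%N by lia.
suff [q hq [zq qE]] : exists2 q, (q <= k)%N & isZ (l q - l i) /\ a k q = a k.+1 j.
  by exists q => //=; rewrite !ha ?qE //; lia.
have useJ : (j <= k)%N -> (pw j < pw k.+1)%N -> exists2 q, (q <= k)%N & isZ (l q - l i) /\ a k q = a k.+1 j.
  move=> jk c; exists j => //; split=> //.
  have := inS_bit ha hk' jk hi zj zi; rewrite /cbit ji /= => h3.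
  have := inS_bit ha hk' jk hj zj zj; rewrite /cbit ltnn eqxx /= (ltnNge (pw k.+1)) (ltnW c) /= => h4.
  lia.
have useI : (i <= k)%N -> (pw k.+1 < pw i)%N -> exists2 q, (q <= k)%N & isZ (l q - l i) /\ a k q = a k.+1 j.
  move=> ik c; exists i => //; split=> //.
  have := inS_bit ha hk' ik hi zi zi; rewrite /cbit ltnn eqxx /= c => h1.
  have := inS_bit ha hk' ik hj zi zj; rewrite /cbit (ltnNge (pw i)) (ltnW ji) ne /= => h2.
  lia.
case: (ltngtP (pw k.+1) (pw i)) => c.
- have [e1|ik] : i = k.+1 \/ (i <= k)%N by lia.
    by move: c; rewrite e1 ltnn.
  by apply: useI.
- apply: useJ; last exact: ltn_trans ji c.
  suff : j <> k.+1 by lia.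
  by move=> e1; move: ji c; rewrite e1 => h /(ltn_trans h); rewrite ltnn.
- have e1 : k.+1 = i by apply: pw_inj; lia.
  apply: useJ; last by rewrite c.
  by suff : j <> k.+1 by [lia]; move=> e2; move: ne; rewrite -e1 e2 eqxx.
Qed.
End InS.
End Tableaux.

(** * Lagrange interpolation and the identity behind [[e_k, f_k] = h_k] *)

Section Lagrange.
Variable F : fieldType.
Implicit Types (rs gs cs : seq F) (R : {poly F}).

(** Compare the coefficients of degree [size rs - 1] on both sides of the interpolation formula. *)
Lemma lagrange_lead rs R : uniq rs -> (size R <= size rs)%N ->
  \sum_(r <- rs) R.[r] / \prod_(r' <- rs | r' != r) (r - r') = R`_(size rs).-1.
Proof.
move=> urs hR.
pose B r := \prod_(r' <- rs | r' != r) ('X - r'%:P).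
have BE r : B r = \prod_(r' <- [seq r' <- rs | r' != r]) ('X - r'%:P) by rewrite big_filter.
have szB r : r \in rs -> size (B r) = size rs.
  move=> hr; rewrite BE size_prod_XsubC -rem_filter // size_rem // prednK //.
  by case: rs hr {urs hR B BE}.
have lB r : r \in rs -> (B r)`_(size rs).-1 = 1.
  move=> hr; rewrite -(szB r hr) -/(lead_coef (B r)) BE.
  by have := monic_prod_XsubC [seq r' <- rs | r' != r] predT id; rewrite monicE => /eqP.
pose d r := \prod_(r' <- rs | r' != r) (r - r').
have hB r s : r \in rs -> s \in rs -> (B r).[s] = if s == r then d r else 0.
  move=> hr hs; rewrite horner_prod; case: eqP => [->|/eqP ne].
    by apply: eq_bigr => i _; rewrite hornerXsubC.
  by rewrite (big_rem s hs) /= ne hornerXsubC subrr mul0r.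
have d0 r : d r != 0.
  by rewrite /d prodf_seq_neq0; apply/allP => x _; apply/implyP => ne; rewrite subr_eq0 eq_sym.
pose P := \sum_(r <- rs) (R.[r] / d r) *: B r.
have RP : R = P.
  apply/eqP; rewrite -subr_eq0; apply/eqP.
  apply: (@roots_geq_poly_eq0 _ _ rs) => //.
    apply/allP => s hs; rewrite rootE hornerD hornerN horner_sum (bigD1_seq s) //=.
    rewrite hornerZ hB // eqxx divfK // big_seq_cond big1 ?addr0 ?subrr // => r /andP[hr ne].
    by rewrite hornerZ hB // eq_sym (negbTE ne) mulr0.
  apply: leq_trans (size_polyD _ _) _; rewrite geq_max hR size_polyN /=.
  rewrite /P big_seq; apply: (big_ind (fun q : {poly F} => (size q <= size rs)%N)).
  - by rewrite size_poly0.
  - by move=> a b ha hb; apply: leq_trans (size_polyD _ _) _; rewrite geq_max ha hb.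
  - by move=> r hr; apply: leq_trans (size_scale_leq _ _) _; rewrite szB.
rewrite {2}RP /P coef_sum big_seq [RHS]big_seq; apply: eq_bigr => r hr.
by rewrite coefZ lB // mulr1.
Qed.

(** At the nodes, the monic polynomial with roots [gs] agrees with its difference from the monic
    polynomial with roots [rs]. That difference has smaller degree, and its top coefficient is read
    off from the sums of roots. *)
Lemma lagrange_residue rs gs : uniq rs -> size rs = size gs ->
  \sum_(r <- rs) (\prod_(g <- gs) (r - g)) / \prod_(r' <- rs | r' != r) (r - r')
  = \sum_(r <- rs) r - \sum_(g <- gs) g.
Proof.
move=> urs sz; case E : (size rs) => [|m].
  have -> : gs = [::] by apply: size0nil; rewrite -sz.
  by rewrite (size0nil E) !big_nil subr0.
pose G := \prod_(g <- gs) ('X - g%:P); pose Q := \prod_(r <- rs) ('X - r%:P).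
have szG : size G = m.+2 by rewrite size_prod_XsubC -sz E.
have szQ : size Q = m.+2 by rewrite size_prod_XsubC E.
have lG : G`_m.+1 = 1.
  by have := monic_prod_XsubC gs predT id; rewrite monicE /lead_coef -/G szG => /eqP.
have lQ : Q`_m.+1 = 1.
  by have := monic_prod_XsubC rs predT id; rewrite monicE /lead_coef -/Q szQ => /eqP.
have hR : (size (G - Q)%R <= size rs)%N.
  rewrite E; apply/leq_sizeP => j hj; rewrite coefB.
  have [->|h] : j = m.+1 \/ (m.+1 < j)%N by lia.
    by rewrite lG lQ subrr.
  by rewrite !nth_default ?subrr // ?szG ?szQ.
have := lagrange_lead urs hR; rewrite coefB.
have -> : Q`_(size rs).-1 = - \sum_(r <- rs) r by rewrite coefPn_prod_XsubC // E.
have -> : G`_(size rs).-1 = - \sum_(r <- gs) r by rewrite sz coefPn_prod_XsubC // -sz E.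
rewrite opprK => h; rewrite [RHS]addrC -h; rewrite big_seq [RHS]big_seq; apply: eq_bigr => r hr.
have -> : (G - Q).[r] = G.[r].
  by rewrite hornerD hornerN [Q.[r]]horner_prod (big_rem r hr) /= hornerXsubC subrr mul0r subr0.
rewrite /G horner_prod; by congr (_ / _); apply: eq_bigr => g _; rewrite hornerXsubC.
Qed.

(** The members of [cs] are double nodes and double zeros of the numerator: their factors cancel at
    every simple node, and so do their contributions to the two sums of roots. *)
Lemma lagrange_cancel ps gs cs ps' gs' : uniq ps' -> {in ps', forall r, r \notin cs} ->
  perm_eq ps (cs ++ cs ++ ps') -> perm_eq gs (cs ++ cs ++ gs') -> size ps' = size gs' ->
  \sum_(r <- ps') (\prod_(g <- gs) (r - g)) / \prod_(r' <- ps | r' != r) (r - r')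
  = \sum_(r <- ps) r - \sum_(g <- gs) g.
Proof.
move=> u h hp hg sz; transitivity (\sum_(r <- ps') r - \sum_(g <- gs') g); last first.
  by rewrite (perm_big _ hp) /= (perm_big _ hg) /= !big_cat /=; ring.
rewrite -lagrange_residue // big_seq [RHS]big_seq.
apply: eq_bigr => r hr; rewrite (perm_big _ hp) (perm_big _ hg) /= !big_cat /=.
have -> : \prod_(i <- cs | i != r) (r - i) = \prod_(i <- cs) (r - i).
  rewrite big_seq_cond [RHS]big_seq_cond; apply: eq_bigl => i; rewrite andbT.
  by case hi : (i \in cs) => //=; apply: contraTneq hi => ->; exact: h.
have c0 : \prod_(i <- cs) (r - i) != 0.
  rewrite prodf_seq_neq0; apply/allP => i hi /=; rewrite subr_eq0.
  by apply: contraTneq hi => <-; exact: h.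
by rewrite !invfM mulrACA divff // mul1r mulrACA divff // mul1r.
Qed.

Lemma perm_cat_sub cs gs : uniq cs -> {subset cs <= gs} -> exists gs', perm_eq gs (cs ++ gs').
Proof.
elim: cs gs => [|c cs IH] gs /=; first by exists gs.
move=> /andP[nc uc] sub; have hc : c \in gs by apply: sub; rewrite inE eqxx.
have [|gs' h] := IH (rem c gs) uc.
  move=> x hx; have := sub x; rewrite inE hx orbT => /(_ isT) hg.
  by move: hg; rewrite (perm_mem (perm_to_rem hc)) inE => /orP[/eqP e|//]; rewrite -e hx in nc.
by exists gs'; rewrite (perm_trans (perm_to_rem hc)) //= perm_cons.
Qed.

(* This is [e_k, f_k] = h_k on a tableau: interpolation at the nodes X_i and X_i - 1, where the nodes that
   occur twice are cancelled by zeros of the numerator. *)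
Lemma gt_lagrange k (X : 'I_k.+1 -> F) (Y : 'I_k.+2 -> F) (Z : 'I_k -> F) : injective X ->
  (forall i j, X j = X i + 1 -> (exists q, Y q = X i) /\ (exists q, Z q = X j)) ->
  \sum_i (\prod_q (X i - Y q)) * (\prod_q (X i + 1 - Z q)) /
     (\prod_(j | j != i) (X i - X j) * \prod_(j | j != i) (X i + 1 - X j))
  - \sum_i (\prod_q (X i - 1 - Y q)) * (\prod_q (X i - Z q)) /
     (\prod_(j | j != i) (X i - X j) * \prod_(j | j != i) (X i - 1 - X j))
  = 2%:R * \sum_i X i - \sum_i Y i - \sum_i Z i - 1.
Proof.
move=> Xinj cross.
pose xs := [seq X i | i <- enum 'I_k.+1]; pose ys := [seq Y i | i <- enum 'I_k.+2].
pose zs := [seq Z i - 1 | i <- enum 'I_k]; pose xm := [seq x - 1 | x <- xs].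
have uxs : uniq xs by rewrite map_inj_uniq ?enum_uniq.
have pinj : injective (fun x : F => x - 1) by move=> a b /addIr.
pose cs := [seq x <- xs | x + 1 \in xs].
pose p1 := [seq x <- xs | x + 1 \notin xs]; pose p2 := [seq x - 1 | x <- xs & x - 1 \notin xs].
have ucs : uniq cs by rewrite filter_uniq.
have ne1 (x : F) : x != x - 1 by rewrite -subr_eq0 opprB addrCA subrr addr0 oner_neq0.
have xsP x : reflect (exists i, X i = x) (x \in xs).
  apply: (iffP mapP) => [[i _ ->]|[i <-]]; exists i => //; exact: mem_enum.
have [ys' hys] : exists s, perm_eq ys (cs ++ s).
  apply: perm_cat_sub => // x; rewrite mem_filter => /andP[/xsP[j hj] /xsP[i hi]].
  have [|[q hq] _] := cross i j; first by rewrite hi hj.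
  by apply/mapP; exists q; rewrite ?mem_enum // hq hi.
have [zs' hzs] : exists s, perm_eq zs (cs ++ s).
  apply: perm_cat_sub => // x; rewrite mem_filter => /andP[/xsP[j hj] /xsP[i hi]].
  have [|_ [q hq]] := cross i j; first by rewrite hi hj.
  by apply/mapP; exists q; rewrite ?mem_enum // hq hj addrK.
have hxm : perm_eq xm (cs ++ p2).
  have : perm_eq xm ([seq x - 1 | x <- xs & x - 1 \in xs] ++ p2).
    by rewrite -map_cat; apply: perm_map; rewrite perm_sym perm_filterC.
  move/perm_trans; apply; rewrite perm_cat2r; apply: uniq_perm => //.
    by rewrite map_inj_uniq ?filter_uniq.
  move=> x; rewrite mem_filter; apply/mapP/andP => [[y]|[h1 h2]].
    by rewrite mem_filter => /andP[h1 h2] ->; rewrite subrK.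
  by exists (x + 1); rewrite ?mem_filter ?addrK // h2 h1.
have hxs : perm_eq xs (cs ++ p1) by rewrite perm_sym perm_filterC.
have perm2 (a b a' b' : seq F) : perm_eq a (cs ++ a') -> perm_eq b (cs ++ b') ->
    perm_eq (a ++ b) (cs ++ cs ++ (a' ++ b')).
  move=> h1 h2; apply: perm_trans (perm_cat h1 h2) _.
  by rewrite -!catA perm_cat2l !catA perm_cat2r perm_catC.
have hps := perm2 _ _ _ _ hxs hxm; have hgs := perm2 _ _ _ _ hys hzs.
have p2P x : (x \in p2) = (x + 1 \in xs) && (x \notin xs).
  apply/mapP/andP => [[y]|[h1 h2]].
    by rewrite mem_filter => /andP[h1 h2] ->; rewrite subrK.
  by exists (x + 1); rewrite ?mem_filter ?addrK // h2 h1.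
have ups : uniq (p1 ++ p2).
  rewrite cat_uniq filter_uniq //= map_inj_uniq ?filter_uniq // andbT.
  apply/hasPn => x; rewrite p2P => /andP[h1 h2] /=.
  by rewrite mem_filter negb_and h2 orbT.
have hcs : {in p1 ++ p2, forall r, r \notin cs}.
  move=> r; rewrite mem_cat p2P !mem_filter => /orP[/andP[h1 h2]|/andP[h1 h2]].
    by rewrite (negbTE h1).
  by rewrite negb_and h2 orbT.
have sxs : size xs = k.+1 by rewrite size_map size_enum_ord.
have sxm : size xm = k.+1 by rewrite size_map sxs.
have sys : size ys = k.+2 by rewrite size_map size_enum_ord.
have szs : size zs = k by rewrite size_map size_enum_ord.
have hsz : size (p1 ++ p2) = size (ys' ++ zs').
  have := perm_size hps; have := perm_size hgs; rewrite !size_cat sxs sxm sys szs; move: (size cs) (size ys') (size zs') (size p1) (size p2) => *; lia.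
have := lagrange_cancel ups hcs hps hgs hsz.
have prodE (T : finType) (f : T -> F) (r : F) : \prod_(g <- [seq f i | i <- enum T]) (r - g) = \prod_i (r - f i).
  by rewrite big_map big_enum.
have prodE2 (T : finType) (f : T -> F) (r : F) : \prod_(g <- [seq f i | i <- enum T] | g != r) (r - g) = \prod_(i | f i != r) (r - f i).
  by rewrite big_map big_enum_cond.
have sumE (T : finType) (f : T -> F) : \sum_(g <- [seq f i | i <- enum T]) g = \sum_i f i.
  by rewrite big_map big_enum.
have xmE : xm = [seq X i - 1 | i <- enum 'I_k.+1] by rewrite /xm -map_comp.
have -> : \sum_(r <- xs ++ xm) r - \sum_(g <- ys ++ zs) g = 2%:R * \sum_i X i - \sum_i Y i - \sum_i Z i - 1.
  rewrite !big_cat /= xmE !sumE !big_split /= !sumr_const !card_ord.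
  by rewrite mulrS; ring.
move=> <-; rewrite big_cat /=; congr (_ + _).
- rewrite /p1 big_filter big_map big_enum_cond /= [RHS]big_mkcond /=; apply: eq_bigr => i _.
  have /xsP hi : X i \in xs by apply/xsP; exists i.
  case: ifP => h; last first.
    move/negbFE/xsP: h => [j hj]; have [[q hq] _] := cross i j hj.
    by rewrite (bigD1 q) //= hq subrr !mul0r.
  congr (_ / _).
    rewrite big_cat /= prodE; congr (_ * _); rewrite /zs big_map big_enum /=.
    by apply: eq_bigr => q _; ring.
  rewrite big_cat xmE !prodE2 /=; congr (_ * _).
    by apply: eq_bigl => j; rewrite (inj_eq Xinj).
  rewrite [RHS](bigD1 i) /=; last by rewrite eq_sym ne1.
  rewrite opprB addrCA subrr addr0 mul1r; apply: eq_big => [j|j _]; last by ring.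
  case: eqP => [->|ne] //=; first by rewrite andbF.
  rewrite andbT; apply/esym; apply: contraNneq h => <-.
  by rewrite subrK; apply/xsP; exists j.
- rewrite /p2 big_map big_filter big_map big_enum_cond /= -sumrN [RHS]big_mkcond /=; apply: eq_bigr => i _.
  case: ifP => h; last first.
    move/negbFE/xsP: h => [j hj]; have [|_ [q hq]] := cross j i; first by rewrite hj subrK.
    by rewrite [\prod_(q0 < k) _](bigD1 q) //= hq subrr mul0r mulr0 mul0r oppr0.
  have -> : \prod_(g <- ys ++ zs) (X i - 1 - g) = \prod_q (X i - 1 - Y q) * \prod_q (X i - Z q).
    rewrite big_cat /= prodE; congr (_ * _); rewrite /zs big_map big_enum /=.
    by apply: eq_bigr => q _; ring.
  rewrite -mulrN -invrN; congr (_ / _).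
  rewrite big_cat xmE !prodE2 /= [X in _ = X * _](bigD1 i) /=; last first.
    exact: ne1.
  have -> : X i - 1 - X i = -1 by ring.
  rewrite mulN1r mulNr mulrC; congr (- (_ * _)).
    apply: eq_bigl => j; case: eqP => [->|ne] //=; first by rewrite andbF.
    by rewrite andbT; apply/esym; apply: contraNneq h => <-; apply/xsP; exists j.
  apply: eq_big => [j|j _]; last by ring.
  by rewrite (inj_eq pinj) (inj_eq Xinj).
Qed.
End Lagrange.

(** * How the coefficient of one move changes under another move *)

Section Coefficients.
Variables (C : numClosedFieldType) (n : nat).
Local Notation arr := (GTarr C n).
Implicit Types (u v z : arr) (s : bool).
Local Notation sg := (sg C).

Lemma gt_num_ext s k i z z' : (forall q, (q < nsz s k)%N -> ent z' (nb s k) q = ent z (nb s k) q) ->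
  ent z' k i = ent z k i -> gt_num s k i z' = gt_num s k i z.
Proof. by move=> h e; apply: eq_bigr => q _; rewrite e h. Qed.

Lemma gt_den_ext k i z z' : (forall q, (q <= k)%N -> ent z' k q = ent z k q) -> (i <= k)%N ->
  gt_den z' k i = gt_den z k i.
Proof. by move=> h hi; apply: eq_bigr => q _; rewrite !h //; have := ltn_ord q; lia. Qed.

Lemma nb_size s k q : (k < n)%N -> (q < nsz s k)%N -> (nb s k <= n)%N /\ (q <= n)%N.
Proof. by case: s => /=; lia. Qed.

Lemma nb_neq s k q : (q < nsz s k)%N -> (nb s k == k) = false.
Proof. by case: s => /=; lia. Qed.

Lemma fc_indep (m m' : move) z : okm n m -> okm n m' -> m'.1.2 != m.1.2 -> m'.1.2 != nb m.1.1 m.1.2 ->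
  fc m (mv m' z) = fc m z.
Proof.
case: m => [[s k] i]; case: m' => [[s' k'] i'] /andP[/= hk hi] /andP[/= hk' hi'] n1 n2.
have E b q : (b <= n)%N -> (q <= n)%N -> b != k' -> ent (mv (s', k', i') z) b q = ent z b q.
  by move=> hb hq ne; apply: ent_shift_row => //=; lia.
rewrite /fc /=; congr (_ / _).
  apply: gt_num_ext => [q hq|]; last by apply: E; lia.
  by have [h1 h2] := nb_size hk hq; apply: E => //; rewrite eq_sym.
by apply: gt_den_ext => // q hq; apply: E; lia.
Qed.

(** The products over the entries that a second move leaves alone. Once they are split off, each
    relation is a rational identity in the few entries that do move. *)
Definition gR s k i j z := \prod_(q < nsz s k | q != j :> nat) (ent z k i - ent z (nb s k) q).
Definition gR2 s k i j j' z :=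
  \prod_(q < nsz s k | (q != j :> nat) && (q != j' :> nat)) (ent z k i - ent z (nb s k) q).
Definition dR k i j z := \prod_(q < k.+1 | (q != i :> nat) && (q != j :> nat)) (ent z k i - ent z k q).

Lemma gt_numD1 s k i j z : (j < nsz s k)%N ->
  gt_num s k i z = (ent z k i - ent z (nb s k) j) * gR s k i j z.
Proof. by move=> hj; rewrite /gt_num (bigD1 (Ordinal hj)). Qed.

Lemma gRD1 s k i j j' z : (j' < nsz s k)%N -> j' != j ->
  gR s k i j z = (ent z k i - ent z (nb s k) j') * gR2 s k i j j' z.
Proof. by move=> hj ne; rewrite /gR (bigD1 (Ordinal hj)). Qed.

Lemma gt_denD1 k i j z : (j <= k)%N -> j != i -> gt_den z k i = (ent z k i - ent z k j) * dR k i j z.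
Proof.
rewrite -ltnS => hj ne; rewrite /gt_den (bigD1 (Ordinal hj)) //=; congr (_ * _).
Qed.

Lemma fc_after s k i j m z z' (a b : C) : (k < n)%N -> (i <= k)%N -> (j <= k)%N -> j != i -> (m < nsz s k)%N ->
  (forall q, (q < nsz s k)%N -> ent z' (nb s k) q = ent z (nb s k) q + (if q == m then a else 0)) ->
  (forall q, (q <= k)%N -> ent z' k q = ent z k q + (if q == j then b else 0)) ->
  fc (s, k, i) z' = (ent z k i - ent z (nb s k) m - a) * gR s k i m z /
     ((ent z k i - ent z k j - b) * dR k i j z).
Proof.
move=> hk hi hj ne hm h1 h2; rewrite /fc /= (gt_numD1 _ _ hm) (gt_denD1 _ hj ne).
have ei : ent z' k i = ent z k i by rewrite h2 // eq_sym (negbTE ne) addr0.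
rewrite ei h1 // eqxx h2 // eqxx.
have -> : gR s k i m z' = gR s k i m z.
  apply: eq_bigr => q nq; rewrite ei h1 // (_ : (q == m :> nat) = false) ?addr0 //; exact/negbTE.
have -> : dR k i j z' = dR k i j z.
  apply: eq_bigr => q /andP[_ nq]; rewrite ei h2; last by have := ltn_ord q; lia.
  by rewrite (negbTE nq) addr0.
by congr (_ * _ / (_ * _)); ring.
Qed.

Lemma fc_after_nb s k i m z z' (a : C) : (k < n)%N -> (i <= k)%N -> (m < nsz s k)%N ->
  (forall q, (q < nsz s k)%N -> ent z' (nb s k) q = ent z (nb s k) q + (if q == m then a else 0)) ->
  (forall q, (q <= k)%N -> ent z' k q = ent z k q) ->
  fc (s, k, i) z' = (ent z k i - ent z (nb s k) m - a) * gR s k i m z / gt_den z k i.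
Proof.
move=> hk hi hm h1 h2; rewrite /fc /= (gt_numD1 _ _ hm) (gt_den_ext h2 hi) h2 // h1 // eqxx.
have -> : gR s k i m z' = gR s k i m z.
  apply: eq_bigr => q nq; rewrite h2 // h1 // (_ : (q == m :> nat) = false) ?addr0 //; exact/negbTE.
by congr (_ * _ / _); ring.
Qed.

Lemma fc_after_nb2 s k i m m' z z' (a b : C) : (k < n)%N -> (i <= k)%N ->
  (m < nsz s k)%N -> (m' < nsz s k)%N -> m' != m ->
  (forall q, (q < nsz s k)%N -> ent z' (nb s k) q =
     ent z (nb s k) q + (if q == m then a else 0) + (if q == m' then b else 0)) ->
  (forall q, (q <= k)%N -> ent z' k q = ent z k q) ->
  fc (s, k, i) z' = (ent z k i - ent z (nb s k) m - a) * (ent z k i - ent z (nb s k) m' - b)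
     * gR2 s k i m m' z / gt_den z k i.
Proof.
move=> hk hi hm hm' ne h1 h2; rewrite /fc /= (gt_numD1 _ _ hm) (gRD1 _ _ hm' ne) (gt_den_ext h2 hi) h2 //.
rewrite !h1 // !eqxx eq_sym (negbTE ne).
have -> : gR2 s k i m m' z' = gR2 s k i m m' z.
  apply: eq_bigr => q /andP[n1 n2]; rewrite h2 // h1 // (negbTE n1) (negbTE n2) !addr0 //.
by rewrite mulrA; congr (_ * _ / _); ring.
Qed.

Lemma fc_after_row s k i j z z' (b : C) : (k < n)%N -> (i <= k)%N -> (j <= k)%N -> j != i ->
  (forall q, (q < nsz s k)%N -> ent z' (nb s k) q = ent z (nb s k) q) ->
  (forall q, (q <= k)%N -> ent z' k q = ent z k q + (if q == j then b else 0)) ->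
  fc (s, k, i) z' = gt_num s k i z / ((ent z k i - ent z k j - b) * dR k i j z).
Proof.
move=> hk hi hj ne h1 h2; rewrite /fc /= (gt_denD1 _ hj ne).
have ei : ent z' k i = ent z k i by rewrite h2 // eq_sym (negbTE ne) addr0.
rewrite (gt_num_ext h1 ei) ei h2 // eqxx.
have -> : dR k i j z' = dR k i j z.
  apply: eq_bigr => q /andP[_ nq]; rewrite ei h2; last by have := ltn_ord q; lia.
  by rewrite (negbTE nq) addr0.
by congr (_ / (_ * _)); ring.
Qed.

Lemma ent_mv s k i z k' q : (k < n)%N -> (i <= k)%N -> (k' <= n)%N -> (q <= n)%N ->
  ent (mv (s, k, i) z) k' q = ent z k' q + (if (k' == k) && (q == i) then sg s else 0).
Proof. by move=> h1 h2 h3 h4; rewrite ent_shift //=; lia. Qed.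

(** With [t] the difference of the two moving entries and [s] the sign of the first move, both
    orders give the factor [-t (t + s)], and nothing else is affected. *)
Lemma fc_comm_nb s k i j z : (k < n)%N -> (i <= k)%N -> (nb s k < n)%N -> (j <= nb s k)%N -> (j < nsz s k)%N ->
  let m1 := (s, k, i) in let m2 := (~~ s, nb s k, j) in
  fc m2 z * fc m1 (mv m2 z) = fc m1 z * fc m2 (mv m1 z).
Proof.
move=> hk hi hk' hj hj' m1 m2.
have nk : (nb s k == k) = false by exact: nb_neq hj'.
have hi' : (i < nsz (~~ s) (nb s k))%N by case: s {m1 m2} hj hj' nk hk' => /=; lia.
have nbK : nb (~~ s) (nb s k) = k by case: s {m1 m2 hi'} hj hj' nk hk' => /=; lia.
have A1 : fc m1 (mv m2 z) = (ent z k i - ent z (nb s k) j - sg (~~ s)) * gR s k i j z / gt_den z k i.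
  apply: fc_after_nb => // q hq.
    by have [h1 h2] := nb_size hk hq; rewrite ent_mv // eqxx.
  by rewrite ent_mv ?[k == _]eq_sym ?nk ?addr0 //; lia.
have A2 : fc m1 z = (ent z k i - ent z (nb s k) j - 0) * gR s k i j z / gt_den z k i.
  by apply: fc_after_nb => // q hq; case: eqP; rewrite addr0.
have B1 : fc m2 (mv m1 z) = (ent z (nb s k) j - ent z k i - sg s) * gR (~~ s) (nb s k) j i z / gt_den z (nb s k) j.
  have := @fc_after_nb (~~ s) (nb s k) j i z (mv m1 z) (sg s); rewrite nbK; apply => // q hq.
    by have [h1 h2] := nb_size hk' hq; rewrite ent_mv ?eqxx //; lia.
  by rewrite ent_mv ?nk ?addr0 //; case: (s) hq hk' => /=; lia.
have B2 : fc m2 z = (ent z (nb s k) j - ent z k i - 0) * gR (~~ s) (nb s k) j i z / gt_den z (nb s k) j.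
  have := @fc_after_nb (~~ s) (nb s k) j i z z 0; rewrite nbK; apply => // q hq.
  by case: eqP; rewrite addr0.
rewrite A1 A2 B1 B2; move: (_^-1) (_^-1) (gR _ _ _ _ _) (gR _ _ _ _ _) (ent _ _ _) (ent _ _ _) => a b c d e f.
by rewrite /sg; case: (s) => /=; ring.
Qed.

(** The moves meet only in one factor of each denominator; with [t] the difference of the entries,
    the products [(t + s)(-t)] and [t(-t - s)] agree. *)
Lemma fc_comm_row s k i j z : (k < n)%N -> (i <= k)%N -> (j <= k)%N -> j != i ->
  let m1 := (s, k, i) in let m2 := (~~ s, k, j) in
  fc m2 z * fc m1 (mv m2 z) = fc m1 z * fc m2 (mv m1 z).
Proof.
move=> hk hi hj ne m1 m2; have ne' : i != j by rewrite eq_sym.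
have row t i' q : (q < nsz t k)%N -> (i' <= k)%N -> forall s', ent (mv (s', k, i') z) (nb t k) q = ent z (nb t k) q.
  move=> hq hi' s'; have [h1 h2] := nb_size hk hq.
  by rewrite ent_mv // (nb_neq hq) addr0.
have own i' s' q : (q <= k)%N -> (i' <= k)%N -> ent (mv (s', k, i') z) k q = ent z k q + (if q == i' then sg s' else 0).
  by move=> hq hi'; rewrite ent_mv ?eqxx //; lia.
have A1 : fc m1 (mv m2 z) = gt_num s k i z / ((ent z k i - ent z k j - sg (~~ s)) * dR k i j z).
  by apply: fc_after_row => // q hq; rewrite ?row ?own.
have A2 : fc m1 z = gt_num s k i z / ((ent z k i - ent z k j - 0) * dR k i j z).
  by apply: fc_after_row => // q hq; case: eqP; rewrite addr0.
have B1 : fc m2 (mv m1 z) = gt_num (~~ s) k j z / ((ent z k j - ent z k i - sg s) * dR k j i z).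
  by apply: fc_after_row => // q hq; rewrite ?row ?own.
have B2 : fc m2 z = gt_num (~~ s) k j z / ((ent z k j - ent z k i - 0) * dR k j i z).
  by apply: fc_after_row => // q hq; case: eqP; rewrite addr0.
rewrite A1 A2 B1 B2 !subr0 !invfM.
have -> : ent z k i - ent z k j - sg (~~ s) = - (ent z k j - ent z k i - sg s).
  by rewrite /sg; case: (s) => /=; ring.
rewrite -(opprB (ent z k i) (ent z k j)) !invrN.
move: (_^-1) (_^-1) (_^-1) (_^-1) => a b c d; ring.
Qed.

Lemma num_self s k i z t : (k < n)%N -> (i <= k)%N ->
  gt_num s k i (shift z k i t) = \prod_(q < nsz s k) (ent z k i + t - ent z (nb s k) q).
Proof.
move=> hk hi; apply: eq_bigr => q _; have [h1 h2] := nb_size hk (ltn_ord q).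
by rewrite !ent_shift ?eqxx ?(nb_neq (ltn_ord q)) ?addr0 //; lia.
Qed.

Lemma den_self k i z t : (k < n)%N -> (i <= k)%N ->
  gt_den (shift z k i t) k i = \prod_(q < k.+1 | q != i :> nat) (ent z k i + t - ent z k q).
Proof.
move=> hk hi; apply: eq_bigr => q ne; have := ltn_ord q => hq.
by rewrite !ent_shift ?eqxx ?(negbTE ne) ?addr0 //; lia.
Qed.
End Coefficients.

(** * Operators on tableaux *)

Section Operators.
Variables (C : numClosedFieldType) (n : nat).
Local Notation arr := (GTarr C n).
Implicit Types (u v z : arr) (s : bool).
Local Notation sg := (sg C).
Variables (pw : nat -> nat) (l : nat -> C).
Hypothesis pw_inj : forall i j, (i <= n)%N -> (j <= n)%N -> pw i = pw j -> i = j.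
Hypothesis sep : forall k i j, (k < n)%N -> (i <= k)%N -> (j <= k)%N ->
  (pw i < pw k.+1)%N -> (pw k.+1 < pw j)%N -> ~ isZ (l i - l j).
Local Notation inS := (@inS C n pw l).
Local Notation tc := (@tc C n pw l).
Local Notation tcp := (@tcp C n pw l).
Local Notation W := (arr -> C^o).

(** The value at [v] collects the contributions of the tableaux from which [v] is reached, so the
    operator lives on all functions of arrays and no span of tableaux has to be constructed as a
    module. *)
Definition opf s k (phi : W) : W := fun v =>
  \sum_(i < k.+1) tc (s, k, i : nat) (umv (s, k, i : nat) v) * phi (umv (s, k, i : nat) v).

Fact opf_linear s k : linear (opf s k).
Proof.
move=> a f g; apply/funext => v; rewrite /opf !fctE scaler_sumr -big_split /=.
by apply: eq_bigr => i _; rewrite mulrDr mulrCA.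
Qed.
Definition opE s k : endo W := Endo (opf_linear s k).
Definition op s k : endo W := if (k < n)%N then opE s k else 0.

Lemma op_lt s k : (k < n)%N -> op s k = opE s k. Proof. by rewrite /op => ->. Qed.
Lemma op_ge s k : (n <= k)%N -> op s k = 0. Proof. by rewrite /op ltnNge => ->. Qed.

Lemma opf2 s1 k1 s2 k2 (phi : W) v : opf s1 k1 (opf s2 k2 phi) v =
  \sum_(i < k1.+1) \sum_(j < k2.+1)
    let m1 : move := (s1, k1, i : nat) in let m2 : move := (s2, k2, j : nat) in
    let z := umv m2 (umv m1 v) in tcp [:: m2; m1] z * phi z.
Proof.
apply: eq_bigr => i _; rewrite mulr_sumr; apply: eq_bigr => j _ /=.
by rewrite mulr1 umvK mulrA [tc _ (umv _ v) * _]mulrC.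
Qed.

Lemma opf3 s1 k1 s2 k2 s3 k3 (phi : W) v : opf s1 k1 (opf s2 k2 (opf s3 k3 phi)) v =
  \sum_(i < k1.+1) \sum_(j < k2.+1) \sum_(h < k3.+1)
    let m1 : move := (s1, k1, i : nat) in let m2 : move := (s2, k2, j : nat) in
    let m3 : move := (s3, k3, h : nat) in
    let z := umv m3 (umv m2 (umv m1 v)) in tcp [:: m3; m2; m1] z * phi z.
Proof.
rewrite opf2; apply: eq_bigr => i _; apply: eq_bigr => j _ /=.
rewrite mulr_sumr; apply: eq_bigr => h _ /=.
by rewrite !mulr1 !umvK !mulrA; congr (_ * _); rewrite [_ * tc (s3, _, _) _]mulrC mulrA.
Qed.

Lemma tcpE' (p : seq move) z : all (okm n) p -> p != [::] ->
  (inS z -> inS (endp p z) -> tcp p z = fcp p z) /\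
  (~ (inS z /\ inS (endp p z)) -> tcp p z = 0).
Proof.
move=> h1 h2; rewrite tcpE //; split=> [a b|ne]; first by rewrite !asboolT.
by case: ifP => // /andP[/asboolP a /asboolP b]; case: ne.
Qed.

Lemma okm_ord s k (i : 'I_k.+1) : (k < n)%N -> okm n (s, k, i : nat).
Proof. by move=> hk; rewrite /okm /= hk -ltnS ltn_ord. Qed.

Lemma tcp_comm (m1 m2 : move) z : okm n m1 -> okm n m2 ->
  fc m2 z * fc m1 (mv m2 z) = fc m1 z * fc m2 (mv m1 z) ->
  tcp [:: m2; m1] z = tcp [:: m1; m2] z.
Proof.
move=> ok1 ok2 h; rewrite !tcpE /= ?ok1 ?ok2 // mvC; case: ifP => // _.
by rewrite !mulr1.
Qed.

Lemma op_comm s1 k1 s2 k2 : (k1 < n)%N -> (k2 < n)%N ->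
  (forall i j z, (i <= k1)%N -> (j <= k2)%N -> let m1 := (s1, k1, i) in let m2 := (s2, k2, j) in
     fc m2 z * fc m1 (mv m2 z) = fc m1 z * fc m2 (mv m1 z)) ->
  br (op s1 k1) (op s2 k2) = 0.
Proof.
move=> h1 h2 h; apply: endo_ext => phi; rewrite endo_brE !op_lt //; apply/eqP; rewrite subr_eq0; apply/eqP.
apply/funext => v; rewrite /= !opf2 exchange_big; apply: eq_bigr => j _; apply: eq_bigr => i _ /=.
rewrite -!/(tcp [:: _; _] _) umvC; congr (_ * _).
apply: (@tcp_comm (s1, k1, i : nat) (s2, k2, j : nat)); rewrite ?okm_ord //; apply: h; rewrite -ltnS //.
Qed.

Lemma op_comm_far s k k' : (k.+1 < k')%N || (k'.+1 < k)%N -> br (op s k) (op s k') = 0.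
Proof.
move=> h; case: (ltnP k n) => hk; last by rewrite op_ge // br0l.
case: (ltnP k' n) => hk'; last by rewrite (op_ge s hk') br0.
apply: op_comm => // i j z hi hj m1 m2.
have ok1 : okm n m1 by apply/andP.
have ok2 : okm n m2 by apply/andP.
by rewrite !(@fc_indep C n) // 1?mulrC //= /nb; case: (s) => /=; lia.
Qed.

Lemma op_comm_ef k k' : k != k' -> br (op true k) (op false k') = 0.
Proof.
move=> ne; case: (ltnP k n) => hk; last by rewrite op_ge // br0l.
case: (ltnP k' n) => hk'; last by rewrite (op_ge false hk') br0.
apply: op_comm => // i j z hi hj m1 m2.
have ok1 : okm n m1 by apply/andP.
have ok2 : okm n m2 by apply/andP.
case: (eqVneq k' k.+1) => [e|ne'].
  by rewrite /m2 e; apply: (@fc_comm_nb C n true) => /=; lia.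
by rewrite !(@fc_indep C n) // 1?mulrC //= 1?eq_sym //; apply/eqP => h; move: ne ne'; rewrite /= in h; lia.
Qed.

(** The eigenvalue of [E_{a,a}]. Entries are coordinates of a weight shifted by rho, and the summand
    [a] undoes the shift. *)
Definition wt a v : C := \sum_(i < a.+1) ent v a i - \sum_(i < a) ent v a.-1 i + a%:R.
(** Set to 0 outside S, like the truncated moves, so that the relations hold on the whole function
    space. *)
Definition Hf a (phi : W) : W := fun v => if `[< inS v >] then wt a v * phi v else 0.
Fact Hf_linear a : linear (Hf a).
Proof.
move=> c f g; apply/funext => v; rewrite /Hf !fctE; case: ifP => _; last by rewrite scaler0 addr0.
by rewrite mulrDr mulrCA.
Qed.
Definition Hop a : endo W := if (a <= n)%N then Endo (Hf_linear a) else 0.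

Lemma Hop_le a : (a <= n)%N -> Hop a = Endo (Hf_linear a). Proof. by rewrite /Hop => ->. Qed.

(** Paths that move two different entries of row [k] cancel by [fc_comm_row]. The paths that return
    to [v] are summed by [gt_lagrange], whose hypotheses are [row_inj] and the two crossing
    lemmas. *)
Lemma op_diag k (phi : W) v : (k < n)%N ->
  opf true k (opf false k phi) v - opf false k (opf true k phi) v =
  - Hf k phi v + Hf k.+1 phi v.
Proof.
move=> hk; rewrite !opf2.
have off s i j (z : arr) : (i <= k)%N -> (j <= k)%N -> j != i ->
  tcp [:: (~~ s, k, j); (s, k, i)] z = tcp [:: (s, k, i); (~~ s, k, j)] z.
  move=> hi hj ne; apply: tcp_comm; try by apply/andP.
  exact: fc_comm_row.
rewrite [X in _ - X]exchange_big /= -sumrB.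
pose T i := tcp [:: (false, k, i); (true, k, i)] v - tcp [:: (true, k, i); (false, k, i)] v.
transitivity (\sum_(i < k.+1) T i * phi v).
  apply: eq_bigr => i _; rewrite -sumrB (bigD1 i) //= big1 ?addr0.
    by rewrite /umv /= opprK shiftK shiftKV -mulrBl.
  move=> j ne; rewrite -!/(tcp [:: _; _] _) (@umvC _ _ (true, k, i : nat)) -mulrBl.
  by rewrite (off true i j) ?subrr ?mul0r // -ltnS.
rewrite -mulr_suml /Hf.
case: asboolP => iv; last first.
  rewrite big1 ?mul0r ?oppr0 ?addr0 // => i _; rewrite /T.
  by rewrite !(proj2 (@tcpE' _ _ _ _)) ?subrr //= ?okm_ord //; case.
rewrite -mulNr -mulrDl; congr (_ * _).
pose X (i : 'I_k.+1) := ent v k i; pose Y (i : 'I_k.+2) := ent v k.+1 i; pose Z (i : 'I_k) := ent v k.-1 i.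
have Xinj : injective X.
  move=> i j e; apply/val_inj/eqP/negPn/negP => ne.
  by have /eqP := row_inj pw_inj sep iv hk (ltn_ord i) (ltn_ord j) ne; rewrite /X in e.
have cross i j : X j = X i + 1 -> (exists q, Y q = X i) /\ (exists q, Z q = X j).
  move=> e; split.
    by have [q hq hq'] := cross_up pw_inj sep iv hk (ltn_ord i) (ltn_ord j) e; exists (Ordinal (hq : q < k.+2)%N).
  by have [q hq hq'] := cross_dn pw_inj sep iv hk (ltn_ord i) (ltn_ord j) e; exists (Ordinal hq).
have := gt_lagrange Xinj cross; rewrite /wt /= => L.
apply: oppr_inj; rewrite opprD opprK -sumrN.
transitivity (2%:R * \sum_i X i - \sum_i Y i - \sum_i Z i - 1); last first.
  by rewrite -[k.+1%:R]natr1; ring.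
rewrite -L -sumrB; apply: eq_bigr => i _; rewrite /T opprB.
have e1 : endp [:: (true, k, i : nat); (false, k, i : nat)] v = v by rewrite /= /mv /= shiftK.
have e2 : endp [:: (false, k, i : nat); (true, k, i : nat)] v = v by rewrite /= /mv /= shiftKV.
rewrite !(proj1 (@tcpE' _ _ _ _)) ?e1 ?e2 //= ?okm_ord //.
rewrite /fc /= !mulr1 /mv /=.
have hi : (i <= k)%N by rewrite -ltnS ltn_ord.
rewrite (num_self false v 1 hk hi) (num_self true v (-1) hk hi) (den_self v 1 hk hi) (den_self v (-1) hk hi).
rewrite /gt_num /gt_den !mulf_div /=.
by congr (_ - _ / _); rewrite mulrC.
Qed.
End Operators.

(** * The cubic Serre relations for the truncated moves *)

Section SerreOperators.
Variables (C : numClosedFieldType) (n : nat).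
Local Notation arr := (GTarr C n).
Implicit Types (u v z : arr) (s : bool).
Local Notation sg := (sg C).
Variables (pw : nat -> nat) (l : nat -> C).
Hypothesis pw_inj : forall i j, (i <= n)%N -> (j <= n)%N -> pw i = pw j -> i = j.
Hypothesis sep : forall k i j, (k < n)%N -> (i <= k)%N -> (j <= k)%N ->
  (pw i < pw k.+1)%N -> (pw k.+1 < pw j)%N -> ~ isZ (l i - l j).
Local Notation inS := (@inS C n pw l).
Local Notation tc := (@tc C n pw l).
Local Notation tcp := (@tcp C n pw l).
Local Notation op := (@op C n pw l).

(* Otherwise the entry of row k+1 that sits at one of the two entries would be overtaken. *)
Lemma adj_up z z' k i j (t : C) : inS z -> inS z' -> (k < n)%N -> (i <= k)%N -> (j <= k)%N ->
  (forall q, (q <= k.+1)%N -> ent z' k.+1 q = ent z k.+1 q) ->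
  ent z' k i = ent z k i + t -> ent z' k j = ent z k j + t -> t = 1 \/ t = -1 ->
  ent z k j <> ent z k i + 1.
Proof.
move=> iz iz' hk hi hj hr ei ej ht e; have [q hq hq'] := cross_up pw_inj sep iz hk hi hj e.
have [_ b] := iz; have [_ b'] := iz'; case: ht => ht.
  have := b k i q hk hi hq 0; have := b' k i q hk hi hq 1.
  rewrite hr // ei hq' ht subrr [_ + 1]addrC addrK => /(_ erefl) + /(_ erefl).
  by case: (cbit _ _ _ _).
have := b k j q hk hj hq 1; have := b' k j q hk hj hq 0.
rewrite hr // ej hq' ht e addrK subrr [_ + 1]addrC addrK => /(_ erefl) + /(_ erefl).
by case: (cbit _ _ _ _).
Qed.

Lemma adj_dn z z' k i j (t : C) : inS z -> inS z' -> (k < n)%N -> (i <= k)%N -> (j <= k)%N ->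
  (forall q, (q < k)%N -> ent z' k.-1 q = ent z k.-1 q) ->
  ent z' k i = ent z k i + t -> ent z' k j = ent z k j + t -> t = 1 \/ t = -1 ->
  ent z k j <> ent z k i + 1.
Proof.
move=> iz iz' hk hi hj hr ei ej ht e; have [q hq hq'] := cross_dn pw_inj sep iz hk hi hj e.
case: k hk hi hj hr ei ej e hq hq' => // k hk hi hj hr ei ej e hq hq'; rewrite /= in hr hq'.
have hk' : (k < n)%N by lia.
have [_ b] := iz; have [_ b'] := iz'; case: ht => ht.
  have := b k q i hk' hq hi 1; have := b' k q i hk' hq hi 0.
  rewrite hr // ei hq' ht e subrr [_ + 1]addrC addrK => /(_ erefl) + /(_ erefl).
  by case: (cbit _ _ _ _).
have := b k q j hk' hq hj 0; have := b' k q j hk' hq hj 1.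
rewrite hr // ej hq' ht subrr opprD addrA subrr sub0r opprK => /(_ erefl) + /(_ erefl).
by case: (cbit _ _ _ _).
Qed.

Lemma adj_nb s z z' k i j (t : C) : inS z -> inS z' -> (k < n)%N -> (i <= k)%N -> (j <= k)%N ->
  (forall q, (q < nsz s k)%N -> ent z' (nb s k) q = ent z (nb s k) q) ->
  ent z' k i = ent z k i + t -> ent z' k j = ent z k j + t -> t = 1 \/ t = -1 ->
  ent z k j <> ent z k i + 1.
Proof. case: s => /=; [exact: adj_up|exact: adj_dn]. Qed.

Lemma sg_pm s : sg s = 1 \/ sg s = -1. Proof. by case: s; [left|right]. Qed.

Lemma sum_sym_eq0 (I : finType) (F : I -> I -> C) : (forall i j, F i j + F j i = 0) ->
  \sum_i \sum_j F i j = 0.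
Proof.
move=> h; apply/eqP; suff : (\sum_i \sum_j F i j) *+ 2 == 0 by rewrite mulrn_eq0.
rewrite mulr2n {2}exchange_big -big_split big1 //= => i _.
by rewrite -big_split big1 //= => j _; rewrite h.
Qed.

Section Row.
Variables (s : bool) (r : nat).
Hypotheses (hr : (r < n)%N) (hr' : (nb s r < n)%N) (hs : (nb s r != r)).
Local Notation r' := (nb s r).

Lemma nsz_nb q : (q < nsz s r)%N = (q <= r')%N.
Proof. by case: s hs => //=; case: r => //= ; lia. Qed.

Let nr : (r' == r) = false. Proof. exact: negbTE. Qed.
Let nr2 : (r == r') = false. Proof. by rewrite eq_sym. Qed.

Lemma ent_mv_own i z q : (i <= r)%N -> (q <= r)%N ->
  ent (mv (s, r, i) z) r q = ent z r q + (if q == i then sg s else 0).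
Proof. by move=> hi hq; rewrite ent_mv ?eqxx //; lia. Qed.
Lemma ent_mv_own' i z q : (i <= r)%N -> (q <= r')%N -> ent (mv (s, r, i) z) r' q = ent z r' q.
Proof. by move=> hi hq; rewrite ent_mv ?nr ?addr0 //; lia. Qed.
Lemma ent_mv_nb m z q : (m <= r')%N -> (q <= r')%N ->
  ent (mv (s, r', m) z) r' q = ent z r' q + (if q == m then sg s else 0).
Proof. by move=> hi hq; rewrite ent_mv ?eqxx //; lia. Qed.
Lemma ent_mv_nb' m z q : (m <= r')%N -> (q <= r)%N -> ent (mv (s, r', m) z) r q = ent z r q.
Proof. by move=> hi hq; rewrite ent_mv ?nr2 ?addr0 //; lia. Qed.

Lemma fc_nb_own m i z : (m <= r')%N -> (i <= r)%N -> fc (s, r', m) (mv (s, r, i) z) = fc (s, r', m) z.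
Proof.
move=> hm hi; apply: (@fc_indep C n) => //=; try by apply/andP.
  by rewrite eq_sym hs.
by move: hm hr' nr; case: s => /=; lia.
Qed.

(** The contribution to the double commutator of row [r] with row [r'] of the paths moving the
    entries [i], [j] of row [r] and [m] of row [r']. As [i] and [j] are summed over ordered pairs,
    only the symmetrization has to vanish. *)
Definition serre1 i j m z : C := tcp [:: (s, r', m); (s, r, j); (s, r, i)] z
  - 2%:R * tcp [:: (s, r, j); (s, r', m); (s, r, i)] z + tcp [:: (s, r, j); (s, r, i); (s, r', m)] z.

Lemma okr i : (i <= r)%N -> okm n (s, r, i). Proof. by move=> h; apply/andP. Qed.
Lemma okr' m : (m <= r')%N -> okm n (s, r', m). Proof. by move=> h; apply/andP. Qed.

Lemma serre1_same i m z : (i <= r)%N -> (m <= r')%N -> serre1 i i m z = 0.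
Proof.
move=> hi hm; rewrite /serre1.
have e1 : endp [:: (s, r, i); (s, r', m); (s, r, i)] z = endp [:: (s, r', m); (s, r, i); (s, r, i)] z.
  by rewrite /= [mv (s, r', m) (mv _ _)]mvC.
have e2 : endp [:: (s, r, i); (s, r, i); (s, r', m)] z = endp [:: (s, r', m); (s, r, i); (s, r, i)] z.
  by rewrite /= [mv (s, r', m) (mv _ (mv _ _))]mvC [mv (s, r', m) (mv _ _)]mvC.
have ok1 := okr hi; have ok2 := okr' hm.
rewrite !tcpE ?e1 ?e2 /= ?ok1 ?ok2 //.
case: ifP => _; last by rewrite mulr0 subr0 addr0.
rewrite !mulr1 !fc_nb_own //.
have A z0 : fc (s, r, i) z0 = (ent z0 r i - ent z0 r' m - 0) * gR s r i m z0 / gt_den z0 r i.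
  by apply: fc_after_nb; rewrite ?nsz_nb // => q _; case: eqP; rewrite addr0.
have B z0 : fc (s, r, i) (mv (s, r', m) z0) = (ent z0 r i - ent z0 r' m - sg s) * gR s r i m z0 / gt_den z0 r i.
  apply: fc_after_nb; rewrite ?nsz_nb // => q; rewrite ?nsz_nb => hq.
    by rewrite ent_mv_nb.
  by rewrite ent_mv_nb'.
rewrite -(mvC (s, r', m)) !B !A ent_mv_own // ent_mv_own' // eqxx.
move: (gR _ _ _ _ _) (gR _ _ _ _ _) (_^-1) (_^-1) (fc _ _) (ent _ _ _) (ent _ _ _) => a b c d e f g.
ring.
Qed.

(** When both ends of the path are in S, the entries [i] and [j] cannot have consecutive values. All
    denominators are then nonzero and the claim is an identity of rational functions. *)
Lemma serre1_diff i j m z : (i <= r)%N -> (j <= r)%N -> i != j -> (m <= r')%N ->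
  serre1 i j m z + serre1 j i m z = 0.
Proof.
move=> hi hj ij hm; have ji : j != i by rewrite eq_sym.
have oki := okr hi; have okj := okr hj; have okm' := okr' hm.
set ze := mv (s, r, i) (mv (s, r, j) (mv (s, r', m) z)).
have e1 : endp [:: (s, r', m); (s, r, j); (s, r, i)] z = ze by [].
have e2 : endp [:: (s, r, j); (s, r', m); (s, r, i)] z = ze by rewrite /= [mv (s, r', m) _]mvC.
have e3 : endp [:: (s, r, j); (s, r, i); (s, r', m)] z = ze.
  by rewrite /= [mv (s, r', m) _]mvC [mv (s, r', m) _]mvC.
have e4 : endp [:: (s, r', m); (s, r, i); (s, r, j)] z = ze by rewrite /= mvC.
have e5 : endp [:: (s, r, i); (s, r', m); (s, r, j)] z = ze.
  by rewrite /= [mv (s, r', m) _]mvC mvC.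
have e6 : endp [:: (s, r, i); (s, r, j); (s, r', m)] z = ze.
  by rewrite /= [mv (s, r', m) _]mvC [mv (s, r', m) _]mvC mvC.
rewrite /serre1 !tcpE ?e1 ?e2 ?e3 ?e4 ?e5 ?e6 /= ?oki ?okj ?okm' //.
case: ifP => [/andP[/asboolP iz /asboolP iz']|_]; last by rewrite !mulr0 !subr0 !addr0.
have eze q : (q <= r)%N -> ent ze r q = ent z r q + (if q == j then sg s else 0) + (if q == i then sg s else 0).
  by move=> hq; rewrite /ze !ent_mv_own // ent_mv_nb'.
have xij : ent z r i != ent z r j by exact: (row_inj pw_inj sep iz).
(* The neighbour of row [r] on the side away from [r'] is untouched by the three moves; an entry of
   this row would be overtaken if the values were consecutive. *)
have other q : (q <= n)%N -> nb (~~ s) r != r -> (nb (~~ s) r <= n)%N -> ent ze (nb (~~ s) r) q = ent z (nb (~~ s) r) q.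
  move=> hq ho ho'; have hmn : (m <= n)%N by lia.
  rewrite /ze !ent_mv ?(negbTE ho) ?addr0 //; try lia.
  rewrite (_ : (nb (~~ s) r == r') = false) ?addr0 //.
  by move: hs ho; case: (s) => /=; lia.
have nadj a b : (a <= r)%N -> (b <= r)%N -> ((a == i) && (b == j)) || ((a == j) && (b == i)) ->
    ent z r b <> ent z r a + 1.
  move=> ha hb hab.
  have ea : ent ze r a = ent z r a + sg s.
    by rewrite eze //; case/orP: hab => /andP[/eqP -> _]; rewrite eqxx ?(negbTE ij) ?(negbTE ji) addr0.
  have eb : ent ze r b = ent z r b + sg s.
    by rewrite eze //; case/orP: hab => /andP[_ /eqP ->]; rewrite eqxx ?(negbTE ij) ?(negbTE ji) addr0.
  case E : s other => other.
    apply: (adj_dn iz iz' hr ha hb _ ea eb (sg_pm s)) => q hq.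
    by have := other q; rewrite /=; apply; lia.
  apply: (adj_up iz iz' hr ha hb _ ea eb (sg_pm s)) => q hq.
  by have := other q; rewrite /=; apply; lia.
have n1 : ent z r j <> ent z r i + 1 by apply: nadj; rewrite ?eqxx.
have n2 : ent z r i <> ent z r j + 1 by apply: nadj; rewrite ?eqxx ?orbT.
rewrite !mulr1 !fc_nb_own //.
have A a b (z' : arr) (al be : C) : (a <= r)%N -> (b <= r)%N -> b != a ->
   (forall q, (q <= r')%N -> ent z' r' q = ent z r' q + (if q == m then al else 0)) ->
   (forall q, (q <= r)%N -> ent z' r q = ent z r q + (if q == b then be else 0)) ->
   fc (s, r, a) z' = (ent z r a - ent z r' m - al) * gR s r a m z / ((ent z r a - ent z r b - be) * dR r a b z).
  by move=> ha hb hab h1 h2; apply: fc_after; rewrite ?nsz_nb // => q; rewrite nsz_nb; apply: h1.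
have if0 (b : bool) : (if b then 0 else 0) = 0 :> C by case: b.
have A0 a b : (a <= r)%N -> (b <= r)%N -> b != a -> fc (s, r, a) z =
    (ent z r a - ent z r' m - 0) * gR s r a m z / ((ent z r a - ent z r b - 0) * dR r a b z).
  by move=> ha hb hab; apply: A => // q _; rewrite if0 addr0.
have Am a b : (a <= r)%N -> (b <= r)%N -> b != a -> fc (s, r, a) (mv (s, r', m) z) =
    (ent z r a - ent z r' m - sg s) * gR s r a m z / ((ent z r a - ent z r b - 0) * dR r a b z).
  move=> ha hb hab; apply: A => // q hq; first by rewrite ent_mv_nb.
  by rewrite if0 ent_mv_nb' // addr0.
have Ab a b : (a <= r)%N -> (b <= r)%N -> b != a -> fc (s, r, a) (mv (s, r, b) z) =
    (ent z r a - ent z r' m - 0) * gR s r a m z / ((ent z r a - ent z r b - sg s) * dR r a b z).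
  move=> ha hb hab; apply: A => // q hq; first by rewrite if0 ent_mv_own' // addr0.
  by rewrite ent_mv_own.
have Abm a b : (a <= r)%N -> (b <= r)%N -> b != a -> fc (s, r, a) (mv (s, r, b) (mv (s, r', m) z)) =
    (ent z r a - ent z r' m - sg s) * gR s r a m z / ((ent z r a - ent z r b - sg s) * dR r a b z).
  move=> ha hb hab; apply: A => // q hq; first by rewrite ent_mv_own' // ent_mv_nb.
  by rewrite ent_mv_own // ent_mv_nb'.
rewrite !(mvC (s, r', m)).
rewrite (A0 i j) // (A0 j i) // (Am i j) // (Am j i) // (Ab i j) // (Ab j i) // (Abm i j) // (Abm j i) //.
have dC : dR r j i z = \prod_(q < r.+1 | (q != j :> nat) && (q != i :> nat)) (ent z r j - ent z r q) by [].
have d1 : ent z r i - ent z r j != 0 by rewrite subr_eq0.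
have d2 : ent z r j - ent z r i - 1 != 0 by rewrite subr_eq0 subr_eq addrC; apply/eqP.
have d3 : ent z r i - ent z r j - 1 != 0 by rewrite subr_eq0 subr_eq addrC; apply/eqP.
rewrite !invfM; move: (gR _ _ _ _ _) (gR _ _ _ _ _) (dR _ _ _ _)^-1 (dR _ _ _ _)^-1 (fc _ _) (ent z r' m) => a b c d e y.
move: (ent z r i) (ent z r j) d1 d2 d3 => xi xj d1 d2 d3.
have d1' : xj - xi != 0 by rewrite -opprB oppr_eq0.
have d2' : xi - xj + 1 != 0 by rewrite (_ : _ + 1 = - (xj - xi - 1)) ?oppr_eq0 //; ring.
have d3' : xj - xi + 1 != 0 by rewrite (_ : _ + 1 = - (xi - xj - 1)) ?oppr_eq0 //; ring.
by rewrite /sg; case: (s); field; rewrite ?d1 ?d1' ?d2 ?d2' ?d3 ?d3'.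
Qed.

Definition serre2 i m m' z : C := tcp [:: (s, r, i); (s, r', m); (s, r', m')] z
  - 2%:R * tcp [:: (s, r', m); (s, r, i); (s, r', m')] z + tcp [:: (s, r', m); (s, r', m'); (s, r, i)] z.

Lemma serre2_same i m z : (i <= r)%N -> (m <= r')%N -> serre2 i m m z = 0.
Proof.
move=> hi hm; rewrite /serre2.
have e1 : endp [:: (s, r', m); (s, r, i); (s, r', m)] z = endp [:: (s, r, i); (s, r', m); (s, r', m)] z.
  by rewrite /= [mv (s, r, i) (mv _ _)]mvC.
have e2 : endp [:: (s, r', m); (s, r', m); (s, r, i)] z = endp [:: (s, r, i); (s, r', m); (s, r', m)] z.
  by rewrite /= [mv (s, r, i) (mv _ (mv _ _))]mvC [mv (s, r, i) (mv _ _)]mvC.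
have ok1 := okr hi; have ok2 := okr' hm.
rewrite !tcpE ?e1 ?e2 /= ?ok1 ?ok2 //.
case: ifP => _; last by rewrite mulr0 subr0 addr0.
have A z0 al : (forall q, (q <= r')%N -> ent z0 r' q = ent z r' q + (if q == m then al else 0)) ->
    (forall q, (q <= r)%N -> ent z0 r q = ent z r q) ->
    fc (s, r, i) z0 = (ent z r i - ent z r' m - al) * gR s r i m z / gt_den z r i.
  by move=> h1 h2; apply: fc_after_nb; rewrite ?nsz_nb // => q; rewrite nsz_nb; apply: h1.
have A0 : fc (s, r, i) z = (ent z r i - ent z r' m - 0) * gR s r i m z / gt_den z r i.
  by apply: A => // q _; case: eqP; rewrite addr0.
have A1 : fc (s, r, i) (mv (s, r', m) z) = (ent z r i - ent z r' m - sg s) * gR s r i m z / gt_den z r i.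
  by apply: A => q hq; rewrite (ent_mv_nb, ent_mv_nb').
have A2 : fc (s, r, i) (mv (s, r', m) (mv (s, r', m) z)) =
    (ent z r i - ent z r' m - (sg s + sg s)) * gR s r i m z / gt_den z r i.
  apply: A => q hq; last by rewrite !ent_mv_nb'.
  by rewrite !ent_mv_nb // -addrA; case: eqP; rewrite ?addr0.
rewrite !mulr1 -?(mvC (s, r, i)) !fc_nb_own // A0 A1 A2.
move: (gR _ _ _ _ _) (_^-1) (fc _ _) (fc _ _) (ent _ _ _) (ent _ _ _) => a b c d e f.
ring.
Qed.

(** Now the two entries lie in row [r'], and the untouched row that forbids consecutive values is
    the one beyond [r']. *)
Lemma serre2_diff i m m' z : (i <= r)%N -> (m <= r')%N -> (m' <= r')%N -> m != m' ->
  serre2 i m m' z + serre2 i m' m z = 0.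
Proof.
move=> hi hm hm' nm; have nm' : m' != m by rewrite eq_sym.
have oki := okr hi; have okm := okr' hm; have okm' := okr' hm'.
set ze := mv (s, r', m') (mv (s, r', m) (mv (s, r, i) z)).
have e1 : endp [:: (s, r, i); (s, r', m); (s, r', m')] z = ze by [].
have e2 : endp [:: (s, r', m); (s, r, i); (s, r', m')] z = ze by rewrite /= [mv (s, r, i) _]mvC.
have e3 : endp [:: (s, r', m); (s, r', m'); (s, r, i)] z = ze.
  by rewrite /= [mv (s, r, i) _]mvC [mv (s, r, i) _]mvC.
have e4 : endp [:: (s, r, i); (s, r', m'); (s, r', m)] z = ze by rewrite /= mvC.
have e5 : endp [:: (s, r', m'); (s, r, i); (s, r', m)] z = ze.
  by rewrite /= [mv (s, r, i) _]mvC mvC.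
have e6 : endp [:: (s, r', m'); (s, r', m); (s, r, i)] z = ze.
  by rewrite /= [mv (s, r, i) _]mvC [mv (s, r, i) _]mvC mvC.
rewrite /serre2 !tcpE ?e1 ?e2 ?e3 ?e4 ?e5 ?e6 /= ?oki ?okm ?okm' //.
case: ifP => [/andP[/asboolP iz /asboolP iz']|_]; last by rewrite !mulr0 !subr0 !addr0.
have eze q : (q <= r')%N -> ent ze r' q = ent z r' q + (if q == m then sg s else 0) + (if q == m' then sg s else 0).
  by move=> hq; rewrite /ze !ent_mv_nb // ent_mv_own'.
have other q : (q <= n)%N -> nb s r' != r' -> nb s r' != r -> (nb s r' <= n)%N -> ent ze (nb s r') q = ent z (nb s r') q.
  move=> hq ho ho' hn; rewrite /ze !ent_mv ?(negbTE ho) ?(negbTE ho') ?addr0 //; lia.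
have nadj a b : (a <= r')%N -> (b <= r')%N -> ((a == m) && (b == m')) || ((a == m') && (b == m)) ->
    ent z r' b <> ent z r' a + 1.
  move=> ha hb hab.
  have ea : ent ze r' a = ent z r' a + sg s.
    by rewrite eze //; case/orP: hab => /andP[/eqP -> _]; rewrite eqxx ?(negbTE nm) ?(negbTE nm') addr0.
  have eb : ent ze r' b = ent z r' b + sg s.
    by rewrite eze //; case/orP: hab => /andP[_ /eqP ->]; rewrite eqxx ?(negbTE nm) ?(negbTE nm') addr0.
  have hq0 : forall q, (q < nsz s r')%N -> ent ze (nb s r') q = ent z (nb s r') q.
    move=> q hq; have [h1 h2] := nb_size hr' hq; apply: other => //.
      by rewrite (nb_neq hq).
    by move: hq hs; case: (s) => /=; lia.
  exact: (adj_nb iz iz' hr' ha hb hq0 ea eb (sg_pm s)).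
have n1 : ent z r' m' <> ent z r' m + 1 by apply: nadj; rewrite ?eqxx.
have n2 : ent z r' m <> ent z r' m' + 1 by apply: nadj; rewrite ?eqxx ?orbT.
have ymm : ent z r' m != ent z r' m' by exact: (row_inj pw_inj sep iz).
have if0 (b : bool) : (if b then 0 else 0) = 0 :> C by case: b.
have A z0 al be : (forall q, (q <= r')%N -> ent z0 r' q = ent z r' q + (if q == m then al else 0) + (if q == m' then be else 0)) ->
    (forall q, (q <= r)%N -> ent z0 r q = ent z r q) ->
    fc (s, r, i) z0 = (ent z r i - ent z r' m - al) * (ent z r i - ent z r' m' - be) * gR2 s r i m m' z / gt_den z r i.
  by move=> h1 h2; apply: fc_after_nb2; rewrite ?nsz_nb // => q; rewrite nsz_nb; apply: h1.
have A00 := @A z 0 0; have Am := @A (mv (s, r', m) z) (sg s) 0.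
have Am' := @A (mv (s, r', m') z) 0 (sg s).
have Amm := @A (mv (s, r', m') (mv (s, r', m) z)) (sg s) (sg s).
have B a b z0 (be : C) : (a <= r')%N -> (b <= r')%N -> b != a ->
   (forall q, (q < nsz s r')%N -> ent z0 (nb s r') q = ent z (nb s r') q) ->
   (forall q, (q <= r')%N -> ent z0 r' q = ent z r' q + (if q == b then be else 0)) ->
   fc (s, r', a) z0 = gt_num s r' a z / ((ent z r' a - ent z r' b - be) * dR r' a b z).
  by move=> ha hb hab h1 h2; apply: fc_after_row.
have B0 a b : (a <= r')%N -> (b <= r')%N -> b != a ->
   fc (s, r', a) z = gt_num s r' a z / ((ent z r' a - ent z r' b - 0) * dR r' a b z).
  by move=> ha hb hab; apply: B => // q _; rewrite if0 addr0.
have B1 a b : (a <= r')%N -> (b <= r')%N -> b != a ->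
   fc (s, r', a) (mv (s, r', b) z) = gt_num s r' a z / ((ent z r' a - ent z r' b - sg s) * dR r' a b z).
  move=> ha hb hab; apply: B => // q hq; last by rewrite ent_mv_nb.
  by have [h1 h2] := nb_size hr' hq; rewrite ent_mv // (nb_neq hq) addr0.
rewrite !mulr1 -?(mvC (s, r, i)) !fc_nb_own //.
rewrite -[mv (s, r', m) (mv (s, r', m') z)]mvC.
rewrite A00 ?Am ?Am' ?Amm; first last.
all: try (by move=> q hq; rewrite ?ent_mv_nb' ?ent_mv_nb ?if0 ?addr0).
all: try (by move=> q hq; rewrite ?ent_mv_nb' ?ent_mv_nb ?if0 ?addr0 //; lia).
rewrite (B0 m m') // (B0 m' m) // (B1 m m') // (B1 m' m) //.
have d1 : ent z r' m - ent z r' m' != 0 by rewrite subr_eq0.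
have d2 : ent z r' m' - ent z r' m - 1 != 0 by rewrite subr_eq0 subr_eq addrC; apply/eqP.
have d3 : ent z r' m - ent z r' m' - 1 != 0 by rewrite subr_eq0 subr_eq addrC; apply/eqP.
rewrite !invfM; move: (gR2 _ _ _ _ _ _) (dR _ _ _ _)^-1 (dR _ _ _ _)^-1 (gt_den _ _ _)^-1 (gt_num _ _ _ _) (gt_num _ _ _ _) => a b c d e f.
move: (ent z r' m) (ent z r' m') (ent z r i) d1 d2 d3 => xi xj y d1 d2 d3.
have d1' : xj - xi != 0 by rewrite -opprB oppr_eq0.
have d2' : xi - xj + 1 != 0 by rewrite (_ : _ + 1 = - (xj - xi - 1)) ?oppr_eq0 //; ring.
have d3' : xj - xi + 1 != 0 by rewrite (_ : _ + 1 = - (xi - xj - 1)) ?oppr_eq0 //; ring.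
by rewrite /sg; case: (s); field; rewrite ?d1 ?d1' ?d2 ?d2' ?d3 ?d3'.
Qed.
End Row.
End SerreOperators.

(** * The representation of gl on functions of arrays *)

Section TableauModule.
Variables (C : numClosedFieldType) (n : nat).
Local Notation arr := (GTarr C n).
Implicit Types (u v z : arr) (s : bool).
Local Notation sg := (sg C).
Variables (pw : nat -> nat) (l : nat -> C).
Hypothesis pw_inj : forall i j, (i <= n)%N -> (j <= n)%N -> pw i = pw j -> i = j.
Hypothesis sep : forall k i j, (k < n)%N -> (i <= k)%N -> (j <= k)%N ->
  (pw i < pw k.+1)%N -> (pw k.+1 < pw j)%N -> ~ isZ (l i - l j).
Local Notation inS := (@inS C n pw l).
Local Notation tc := (@tc C n pw l).
Local Notation tcp := (@tcp C n pw l).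
Local Notation W := (arr -> C^o).
Local Notation op := (@op C n pw l).
Local Notation opf := (@opf C n pw l).
Local Notation Hop := (@Hop C n pw l).

Lemma br_br_endo (a b : endo W) phi : br a (br a b) phi = a (a (b phi)) - a (b (a phi)) - a (b (a phi)) + b (a (a phi)).
Proof. rewrite endo_brE (endo_brE a b phi) (endo_brE a b (a phi)) endoB; zmod. Qed.

Lemma sum3_rot (I J K : finType) (F : I -> J -> K -> C) :
  \sum_i \sum_j \sum_k F i j k = \sum_k \sum_i \sum_j F i j k.
Proof. by rewrite [RHS]exchange_big; apply: eq_bigr => i _; rewrite exchange_big. Qed.

Section Row.
Variables (s : bool) (r : nat).
Hypotheses (hr : (r < n)%N) (hr' : (nb s r < n)%N) (hs : nb s r != r).
Local Notation r' := (nb s r).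

Lemma op_serre1 : br (op s r) (br (op s r) (op s r')) = 0.
Proof.
apply: endo_ext => phi; rewrite br_br_endo; apply/funext => v.
rewrite !op_lt //= !fctE !opf3.
pose z (i j m : nat) := umv (s, r', m) (umv (s, r, j) (umv (s, r, i) v)).
rewrite sum3_rot /= [X in _ - X - _]exchange_big /= [X in _ - _ - X]exchange_big /=.
transitivity (\sum_(m < r'.+1) \sum_(i < r.+1) \sum_(j < r.+1) serre1 pw l s r i j m (z i j m) * phi (z i j m)).
  rewrite -!sumrB -big_split /=; apply: eq_bigr => m _.
  rewrite -!sumrB -big_split /=; apply: eq_bigr => i _.
  rewrite -!sumrB -big_split /=; apply: eq_bigr => j _; rewrite /serre1 /=.
  have -> : umv (s, r, j : nat) (umv (s, r', m : nat) (umv (s, r, i : nat) v)) = z i j m by rewrite umvC.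
  have -> : umv (s, r, j : nat) (umv (s, r, i : nat) (umv (s, r', m : nat) v)) = z i j m.
    by rewrite /z [RHS]umvC; congr umv; rewrite umvC.
  rewrite -/(z i j m); ring.
rewrite big1 // => m _; apply: sum_sym_eq0 => i j.
have zC : z j i m = z i j m by rewrite /z [umv (s, r, i : nat) _]umvC.
rewrite zC -mulrDl; case: (eqVneq (i : nat) (j : nat)) => [->|ne].
  by rewrite serre1_same ?addr0 ?mul0r // -ltnS.
by rewrite serre1_diff ?mul0r // -ltnS.
Qed.

Lemma op_serre2 : br (op s r') (br (op s r') (op s r)) = 0.
Proof.
apply: endo_ext => phi; rewrite br_br_endo; apply/funext => v.
rewrite !op_lt //= !fctE !opf3.
pose z (i m m' : nat) := umv (s, r, i) (umv (s, r', m) (umv (s, r', m') v)).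
rewrite sum3_rot /= [X in _ - X - _]exchange_big /= [X in _ - _ - X]exchange_big /=.
transitivity (\sum_(i < r.+1) \sum_(m' < r'.+1) \sum_(m < r'.+1) serre2 pw l s r i m m' (z i m m') * phi (z i m m')).
  rewrite -!sumrB -big_split /=; apply: eq_bigr => i _.
  rewrite -!sumrB -big_split /=; apply: eq_bigr => m' _.
  rewrite -!sumrB -big_split /=; apply: eq_bigr => m _; rewrite /serre2 /=.
  have -> : umv (s, r', m : nat) (umv (s, r, i : nat) (umv (s, r', m' : nat) v)) = z i m m' by rewrite umvC.
  have -> : umv (s, r', m : nat) (umv (s, r', m' : nat) (umv (s, r, i : nat) v)) = z i m m'.
    by rewrite /z [RHS]umvC; congr umv; rewrite umvC.
  rewrite -/(z i m m'); ring.
rewrite big1 // => i _; apply: sum_sym_eq0 => m' m.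
have zC : z i m' m = z i m m' by rewrite /z [umv (s, r', m' : nat) _]umvC.
rewrite zC -mulrDl; case: (eqVneq (m : nat) (m' : nat)) => [->|ne].
  by rewrite serre2_same ?addr0 ?mul0r // -ltnS.
by rewrite serre2_diff ?mul0r // -ltnS.
Qed.
End Row.

Definition eop k := - op true k.
Definition fop k := op false k.

Lemma op_serre s i j : (i.+1 == j) || (j.+1 == i) -> br (op s i) (br (op s i) (op s j)) = 0.
Proof.
move=> h; case: (ltnP i n) => hi; last by rewrite op_ge ?br0l.
case: (ltnP j n) => hj; last by rewrite [op s j]op_ge ?br0 ?br0.
have [r [hr hr' hs hij]] : exists r, [/\ (r < n)%N, (nb s r < n)%N, nb s r != r &
    (i = r /\ j = nb s r) \/ (i = nb s r /\ j = r)].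
  case: s; case/orP: h => /eqP h.
  - exists i => /=; split; lia.
  - exists j => /=; split; lia.
  - exists j => /=; split; lia.
  - exists i => /=; split; lia.
by case: hij => [[-> ->]|[-> ->]]; [exact: op_serre1|exact: op_serre2].
Qed.

Lemma wt_mv s k i v a : (k < n)%N -> (i <= k)%N -> (a <= n)%N ->
  wt a (mv (s, k, i) v) = wt a v + sg s * ((a == k)%:R - (a == k.+1)%:R).
Proof.
move=> hk hi ha; rewrite /wt.
have rowsum b m : (b <= n)%N -> (m <= b.+1)%N -> (b == k -> m = k.+1) ->
   \sum_(q < m) ent (mv (s, k, i) v) b q = \sum_(q < m) ent v b q + sg s * (b == k)%:R.
  move=> hb hm hbk; under eq_bigr => q _.
    rewrite ent_mv //; last by have := ltn_ord q; lia.
    over.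
  rewrite big_split /=; congr (_ + _); case: eqP hbk => [e /(_ isT) em|_ _]; last by rewrite big1 ?mulr0.
  have him : (i < m)%N by lia.
  rewrite (bigD1 (Ordinal him)) //= eqxx big1 ?addr0 ?mulr1 // => q ne.
  by rewrite ifN.
rewrite rowsum ?ltnS //; last by move/eqP->.
case: a ha => [|a] ha.
  by rewrite !big_ord0 /= subr0 /= ; ring.
rewrite /= rowsum ?leqnSn //; [|lia|by move/eqP->].
by rewrite eqSS; ring.
Qed.

Lemma tc_supp (m : move) v : ~ (inS v /\ inS (mv m v)) -> tc m v = 0.
Proof. by move=> h; rewrite /tc; case: ifP => // /andP[/asboolP a /asboolP b]; case: h. Qed.

Lemma Hop_gt a : (n < a)%N -> Hop a = 0.
Proof. by rewrite /Hop ltnNge => /negbTE ->. Qed.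

Lemma H_op s a k : br (Hop a) (op s k) =
  if s then op s k *+ (a == k) - op s k *+ (a == k.+1) else op s k *+ (a == k.+1) - op s k *+ (a == k).
Proof.
case: (ltnP k n) => hk; last by rewrite op_ge // br0 !mul0rn subrr; case: s.
case: (leqP a n) => ha; last first.
  have -> : (a == k) = false by lia.
  have -> : (a == k.+1) = false by lia.
  by rewrite Hop_gt // br0l !mulr0n subrr; case: s.
apply: endo_ext => phi; apply/funext => v.
have -> : (if s then op s k *+ (a == k) - op s k *+ (a == k.+1) else op s k *+ (a == k.+1) - op s k *+ (a == k)) phi v
   = sg s * ((a == k)%:R - (a == k.+1)%:R) * op s k phi v.
  have eN (f : endo W) : (- f) phi v = - f phi v by [].
  have e0 : (0 : endo W) phi v = 0 by [].
  by rewrite /sg; case: s; case: eqP => _; case: eqP => _; rewrite ?mulr1n ?mulr0n ?subrr ?subr0 ?sub0r ?eN ?e0; ring.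
rewrite endo_brE Hop_le // op_lt //= fctE /Hf /opf.
have -> : (if `[< inS v >] then wt a v * (\sum_(i < k.+1) tc (s, k, i : nat) (umv (s, k, i : nat) v) * phi (umv (s, k, i : nat) v)) else 0)
   = \sum_(i < k.+1) wt a v * (tc (s, k, i : nat) (umv (s, k, i : nat) v) * phi (umv (s, k, i : nat) v)).
  case: asboolP => iv; first by rewrite mulr_sumr.
  by rewrite big1 // => i _; rewrite tc_supp ?mul0r ?mulr0 // umvK => -[].
rewrite -sumrB mulr_sumr; apply: eq_bigr => i _.
case: asboolP => iu; last by rewrite tc_supp ?mul0r ?mulr0 ?subr0 // => -[].
have -> : wt a v = wt a (umv (s, k, i : nat) v) + sg s * ((a == k)%:R - (a == k.+1)%:R).
  by rewrite -(@wt_mv s k i) ?umvK // -ltnS.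
ring.
Qed.

Lemma H_H a b : br (Hop a) (Hop b) = 0.
Proof.
case: (leqP a n) => ha; last by rewrite Hop_gt // br0l.
case: (leqP b n) => hb; last by rewrite [Hop b]Hop_gt // br0.
apply: endo_ext => phi; apply/funext => v; rewrite endo_brE !Hop_le //=.
rewrite -[LHS]/(Hf pw l a (Hf pw l b phi) v - Hf pw l b (Hf pw l a phi) v) /Hf; by case: asboolP => _; rewrite ?subrr // mulrCA subrr.
Qed.

Definition Xop := glX eop fop Hop.

Lemma endo_two_inj (z : endo W) : z + z = 0 -> z = 0.
Proof.
move=> h; apply: endo_ext => phi; apply/funext => v.
have := congr1 (fun f : endo W => f phi v) h; rewrite /= => /eqP.
by rewrite fctE -mulr2n mulrn_eq0 /= => /eqP.
Qed.

Lemma Xop_rel k l0 : (k <= n)%N -> (l0 <= n)%N -> glrel n eop fop Hop k l0.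
Proof.
apply: glX_rel.
- exact: endo_two_inj.
- by move=> i j h; rewrite brNl brNr opprK op_comm_far.
- by move=> i j h; rewrite brNl brNr brNl brNr !opprK brNr op_serre ?oppr0.
- by move=> i j h; rewrite op_comm_far.
- by move=> i j h; rewrite op_serre.
- move=> i j; rewrite brNl; case: (eqVneq i j) => [<-|ne] /=; last by rewrite op_comm_ef ?oppr0.
  case: (ltnP i n) => hi; last by rewrite op_ge // br0l oppr0.
  apply: endo_ext => phi; apply/funext => v.
  rewrite /fop !Hop_le ?op_lt //; last exact: ltnW.
  have := op_diag pw_inj sep phi v hi => E.
  by rewrite -[LHS]/(- (_ - _)) E opprD opprK.
- by move=> a k0; rewrite brNr H_op /= opprB !mulNrn opprK addrC.
- by move=> a k0; rewrite H_op.
- exact: H_H.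
Qed.

Definition piW (x : 'M[C]_n.+1) (phi : W) : W := \sum_(i < n.+1) \sum_(j < n.+1) x i j *: Xop i j phi.

Lemma piW_linear x (a : C) (u v : W) : piW x (a *: u + v) = a *: piW x u + piW x v.
Proof.
rewrite /piW scaler_sumr -big_split; apply: eq_bigr => i _.
rewrite scaler_sumr -big_split; apply: eq_bigr => j _ /=.
by rewrite endoD endoZ scalerDr !scalerA mulrC.
Qed.

Lemma piW_linear_l x y (a : C) (v : W) : piW (a *: x + y) v = a *: piW x v + piW y v.
Proof.
rewrite /piW scaler_sumr -big_split; apply: eq_bigr => i _.
rewrite scaler_sumr -big_split; apply: eq_bigr => j _ /=.
by rewrite !mxE scalerDl scalerA.
Qed.

Lemma piW_delta (a b : 'I_n.+1) (v : W) : piW (delta_mx a b) v = Xop a b v.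
Proof.
rewrite /piW (bigD1 a) //= [X in X + _](bigD1 b) //= !mxE !eqxx scale1r !big1 ?addr0 // => i ne.
  by rewrite big1 // => j _; rewrite mxE (negbTE ne) scale0r.
by rewrite mxE (negbTE ne) andbF scale0r.
Qed.

Lemma piW_bracket_delta (a b c d : 'I_n.+1) (v : W) : piW (lbr (delta_mx a b) (delta_mx c d)) v =
  piW (delta_mx a b) (piW (delta_mx c d) v) - piW (delta_mx c d) (piW (delta_mx a b) v).
Proof.
have le (i : 'I_n.+1) : (i <= n)%N by rewrite -ltnS.
have := Xop_rel (le c) (le d) (le a) (le b); rewrite -!/(Xop _ _) => /(congr1 (fun f : endo W => f v)).
rewrite endo_brE endo_subE !endo_mulbE !piW_delta => ->.
rewrite /lbr !mul_delta_mx_cond.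
have E (t : bool) (i j : 'I_n.+1) : piW (delta_mx i j *+ t) v = Xop i j v *+ t.
  case: t; first by rewrite !mulr1n piW_delta.
  by rewrite !mulr0n /piW big1 // => p _; rewrite big1 // => q _; rewrite mxE scale0r.
have -> : delta_mx a d *+ (b == c) - delta_mx c b *+ (d == a) =
    (-1) *: (delta_mx c b *+ (d == a)) + delta_mx a d *+ (b == c) :> 'M[C]_n.+1 by rewrite scaleN1r addrC.
by rewrite piW_linear_l !E scaleN1r addrC -!val_eqE /=.
Qed.
End TableauModule.

(** * Highest weight modules over gl *)

Section GlModules.
Variables (C : numClosedFieldType) (n : nat).
Local Notation M := 'M[C]_n.+1.
Local Notation E := (@delta_mx C n.+1 n.+1).

Definition glmod (U : lmodType C) (pi : M -> U -> U) :=
  [/\ (forall x, linear (pi x)),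
      (forall x y a u, pi (a *: x + y) u = a *: pi x u + pi y u) &
      (forall x y u, pi (lbr x y) u = pi x (pi y u) - pi y (pi x u))].

(** The projection of gl onto sl along the scalar matrices. Composing with it extends an sl-module
    to gl with scalars acting by 0, which makes the diagonal matrix units available. *)
Definition hat (x : M) : M := x - (\tr x / n.+1%:R)%:M.

Lemma hat_sl x : in_sl (hat x).
Proof.
rewrite /in_sl /hat raddfB /= mxtrace_scalar -[_ *+ _]mulr_natr divfK ?subrr //.
by rewrite pnatr_eq0.
Qed.

Lemma hat_id x : in_sl x -> hat x = x.
Proof. by rewrite /hat => ->; rewrite mul0r raddf0 subr0. Qed.

Lemma lbr_hat (x y : M) : lbr (hat x) (hat y) = lbr x y.
Proof.
rewrite /lbr /hat !mulmxBl !mulmxBr.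
set a := (_ / _)%:M; set b := (_ / _)%:M.
have ca z : z *m a = a *m z by rewrite scalar_mxC.
have cb z : z *m b = b *m z by rewrite scalar_mxC.
rewrite !ca !cb; zmod.
Qed.

Lemma lbr_sl (x y : M) : in_sl (lbr x y).
Proof. by rewrite /in_sl /lbr raddfB /= mxtrace_mulC subrr. Qed.

Lemma hat_linear a (x y : M) : hat (a *: x + y) = a *: hat x + hat y.
Proof.
rewrite /hat raddfD /= linearZ /= mulrDl raddfD /= scalerBr opprD addrACA; congr (_ + _).
by rewrite scale_scalar_mx mulrA.
Qed.

Lemma delta_sl a b : a != b -> in_sl (E a b).
Proof.
move=> ab; rewrite /in_sl /mxtrace big1 // => i _; rewrite mxE.
by case: eqP => //= ->; rewrite (negbTE ab).
Qed.

Lemma glmod_hat (U : lmodType C) (pi : M -> U -> U) : is_gmodule pi -> glmod (fun x => pi (hat x)).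
Proof.
move=> [h1 h2 h3]; split=> [x a u v|x y a u|x y u] //.
  by rewrite hat_linear h2 //; exact: hat_sl.
by rewrite hat_id ?lbr_hat -?[lbr x y]lbr_hat ?h3 //; first [exact: hat_sl | exact: lbr_sl].
Qed.

Lemma glmod_gmodule (U : lmodType C) (pi : M -> U -> U) : glmod pi -> is_gmodule pi.
Proof. by case=> h1 h2 h3; split=> *; rewrite ?h1 ?h2 ?h3. Qed.

Section Theory.
Variables (U : lmodType C) (pi : M -> U -> U).
Hypothesis glpi : glmod pi.

Lemma piD x u v : pi x (u + v) = pi x u + pi x v.
Proof. by have [h _ _] := glpi; have := h x 1 u v; rewrite !scale1r. Qed.
Lemma pi0 x : pi x 0 = 0.
Proof. by have := piD x 0 0; rewrite addr0 => /esym/eqP; rewrite -subr_eq0 addrK => /eqP. Qed.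
Lemma piZ x c u : pi x (c *: u) = c *: pi x u.
Proof. by have [h _ _] := glpi; have := h x c u 0; rewrite !addr0 pi0 addr0. Qed.
Lemma pi_sumr x I (r : seq I) (P : pred I) (F : I -> U) :
  pi x (\sum_(i <- r | P i) F i) = \sum_(i <- r | P i) pi x (F i).
Proof. exact: (big_morph (pi x) (piD x) (pi0 x)). Qed.
Lemma piDl x y u : pi (x + y) u = pi x u + pi y u.
Proof. by have [_ h _] := glpi; have := h x y 1 u; rewrite !scale1r. Qed.
Lemma pi0l u : pi 0 u = 0.
Proof. by have := piDl 0 0 u; rewrite addr0 => /esym/eqP; rewrite -subr_eq0 addrK => /eqP. Qed.
Lemma piZl c x u : pi (c *: x) u = c *: pi x u.
Proof. by have [_ h _] := glpi; have := h x 0 c u; rewrite !addr0 pi0l addr0. Qed.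
Lemma pi_suml I (r : seq I) (P : pred I) (F : I -> M) u :
  pi (\sum_(i <- r | P i) F i) u = \sum_(i <- r | P i) pi (F i) u.
Proof. exact: (big_morph (fun x => pi x u) (fun x y => piDl x y u) (pi0l u)). Qed.
Lemma pi_lbr x y u : pi x (pi y u) = pi y (pi x u) + pi (lbr x y) u.
Proof. by have [_ _ h] := glpi; rewrite h addrC subrK. Qed.
Lemma pi_matrix x u : pi x u = \sum_i \sum_j x i j *: pi (E i j) u.
Proof.
rewrite {1}(matrix_sum_delta x) pi_suml; apply: eq_bigr => i _.
by rewrite pi_suml; apply: eq_bigr => j _; rewrite piZl.
Qed.
End Theory.

Variable pw : nat -> nat.
Hypothesis pw_inj : forall i j : 'I_n.+1, pw i = pw j -> i = j.

Definition hwv (U : lmodType C) (pi : M -> U -> U) (chi : 'I_n.+1 -> C) (u0 : U) :=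
  (forall a b : 'I_n.+1, (pw a < pw b)%N -> pi (E a b) u0 = 0) /\
  (forall a, pi (E a a) u0 = chi a *: u0).

(** The component of height [m] of the submodule generated by [u0], heights being measured by ranks
    in the order [pw]. It is used in place of a PBW basis. *)
Inductive low (U : lmodType C) (pi : M -> U -> U) (u0 : U) : nat -> U -> Prop :=
| low_base : low pi u0 0 u0
| low_zero m : low pi u0 m 0
| low_lin m c u v : low pi u0 m u -> low pi u0 m v -> low pi u0 m (c *: u + v)
| low_f (a b : 'I_n.+1) m u : (pw b < pw a)%N -> low pi u0 m u ->
    low pi u0 (m + (pw a - pw b)) (pi (E a b) u).

Definition lowsum (U : lmodType C) (pi : M -> U -> U) (u0 u : U) :=
  exists K (g : nat -> U), (forall m, low pi u0 m (g m)) /\ u = \sum_(m < K) g m.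

(** The grading element: [E a b] has ad-eigenvalue [pw a - pw b], so lowering operators increase the
    eigenvalue and heights count upwards from the generator. *)
Definition h0 : M := \sum_a (pw (a : 'I_n.+1))%:R *: E a a.

Lemma lbr_delta (a b c d : 'I_n.+1) :
  lbr (E a b) (E c d) = E a d *+ (b == c) - E c b *+ (d == a).
Proof. by rewrite /lbr !mul_delta_mx_cond. Qed.

Lemma lbr_suml I (r : seq I) (F : I -> M) (y : M) : lbr (\sum_(i <- r) F i) y = \sum_(i <- r) lbr (F i) y.
Proof. by rewrite /lbr mulmx_suml mulmx_sumr -sumrB. Qed.
Lemma lbrZl c (x y : M) : lbr (c *: x) y = c *: lbr x y.
Proof. by rewrite /lbr -scalemxAl -scalemxAr scalerBr. Qed.

Lemma lbr_diag (d : 'I_n.+1 -> C) a b : lbr (\sum_c d c *: E c c) (E a b) = (d a - d b) *: E a b.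
Proof.
rewrite lbr_suml; under eq_bigr => c _ do rewrite lbrZl lbr_delta scalerBr.
rewrite sumrB (bigD1 a) //= big1 ?addr0; last by move=> c ne; rewrite (negbTE ne) mulr0n scaler0.
rewrite [X in _ - X](bigD1 b) //= big1 ?addr0; last by move=> c ne; rewrite eq_sym (negbTE ne) mulr0n scaler0.
by rewrite !eqxx !mulr1n scalerBl.
Qed.

Lemma lbr_h0 a b : lbr h0 (E a b) = ((pw a)%:R - (pw b)%:R) *: E a b.
Proof. exact: lbr_diag. Qed.

Section Low.
Variables (U : lmodType C) (pi : M -> U -> U) (chi : 'I_n.+1 -> C) (u0 : U).
Hypothesis glpi : glmod pi.
Hypothesis hw : hwv pi chi u0.
Local Notation low := (low pi u0).
Local Notation lowsum := (lowsum pi u0).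

Definition c0 := \sum_(a : 'I_n.+1) (pw a)%:R * chi a.

Lemma low_eig m u : low m u -> pi h0 u = (c0 + m%:R) *: u.
Proof.
elim=> {m u} [|m|m c u v _ hu _ hv|a b m u ab _ hu].
- have [_ hd] := hw; rewrite pi_suml // addr0 scaler_suml; apply: eq_bigr => a _.
  by rewrite piZl // hd scalerA.
- by rewrite pi0 // scaler0.
- by rewrite piD // piZ // hu hv scalerDr !scalerA mulrC.
- rewrite pi_lbr // hu piZ // lbr_h0 piZl // -scalerDl; congr (_ *: _).
  by rewrite natrD natrB ?addrA // ltnW.
Qed.

Lemma low0 m u : low m u -> m = 0%N -> exists c, u = c *: u0.
Proof.
elim=> {m u} [_|m _|m c u v _ hu _ hv m0|a b m u ab _ _]; last by lia.
- by exists 1; rewrite scale1r.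
- by exists 0; rewrite scale0r.
- by have [a ->] := hu m0; have [b ->] := hv m0; exists (c * a + b); rewrite scalerDl scalerA.
Qed.

Lemma lowsum_low m u : low m u -> lowsum u.
Proof.
move=> h; exists m.+1, (fun k => if k == m then u else 0); split.
  by move=> k; case: eqP => [->|_] //; exact: low_zero.
rewrite (bigD1 ord_max) //= eqxx big1 ?addr0 // => i ne.
by rewrite (_ : (i == m :> nat) = false) //; apply/eqP => e; case/eqP: ne; apply: val_inj.
Qed.

Lemma lowsum_pad u K : lowsum u -> exists K', (K <= K')%N /\ exists g : nat -> U,
  (forall m, low m (g m)) /\ (forall K'', (K' <= K'')%N -> u = \sum_(m < K'') g m).
Proof.
move=> [K0 [g [hg ->]]]; exists (maxn K K0); split; first exact: leq_maxl.
exists (fun m => if (m < K0)%N then g m else 0); split.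
  by move=> m; case: ifP => _; [exact: hg|exact: low_zero].
move=> K'' hK; have hK' : (K0 <= K'')%N by apply: leq_trans hK; exact: leq_maxr.
rewrite -(subnKC hK') big_split_ord /= [X in _ + X]big1 ?addr0.
  by apply: eq_bigr => i _; rewrite ltn_ord.
by move=> i _; rewrite ltnNge leq_addr.
Qed.

Lemma lowsum_lin c u v : lowsum u -> lowsum v -> lowsum (c *: u + v).
Proof.
move=> /(lowsum_pad 0)[K1 [_ [g1 [h1 e1]]]] /(lowsum_pad K1)[K2 [K12 [g2 [h2 e2]]]].
exists K2, (fun m => c *: g1 m + g2 m); split; first by move=> m; apply: low_lin.
by rewrite big_split /= -scaler_sumr -e1 // -e2.
Qed.

Lemma lowsum0 : lowsum 0. Proof. by apply: (@lowsum_low 0); exact: low_zero. Qed.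
Lemma lowsumD u v : lowsum u -> lowsum v -> lowsum (u + v).
Proof. by move=> hu hv; rewrite -[u]scale1r; exact: lowsum_lin. Qed.
Lemma lowsumZ c u : lowsum u -> lowsum (c *: u).
Proof. by move=> hu; rewrite -[_ *: _]addr0; apply: lowsum_lin => //; exact: lowsum0. Qed.
Lemma lowsum_sum I (r : seq I) (P : pred I) (F : I -> U) : (forall i, P i -> lowsum (F i)) ->
  lowsum (\sum_(i <- r | P i) F i).
Proof. by move=> h; apply: big_ind => //; [exact: lowsum0|exact: lowsumD]. Qed.

(** Moving [x] past the outermost lowering operator leaves a bracket, which is again a matrix; the
    induction therefore runs over all [x] at once. *)
Lemma low_act m u x : low m u -> lowsum (pi x u).
Proof.
move=> h; elim: h x => {m u} [|m|m c u v _ hu _ hv|a b m u ab hl hu] x.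
- have [hn hd] := hw; rewrite (pi_matrix glpi); apply: lowsum_sum => i _; apply: lowsum_sum => j _.
  apply: lowsumZ; case: (ltngtP (pw i) (pw j)) => ij.
  + by rewrite hn //; exact: lowsum0.
  + by apply: (@lowsum_low (0 + (pw i - pw j))); apply: low_f => //; exact: low_base.
  + by rewrite (pw_inj ij) hd; apply: lowsumZ; apply: (@lowsum_low 0); exact: low_base.
- by rewrite pi0 //; exact: lowsum0.
- by rewrite piD // piZ //; apply: lowsum_lin.
- rewrite pi_lbr //; apply: lowsumD => //.
  have [K [g [hg ->]]] := hu x; rewrite pi_sumr //; apply: lowsum_sum => i _.
  by apply: (@lowsum_low (i + (pw a - pw b))); apply: low_f.
Qed.

Lemma lowsum_act u x : lowsum u -> lowsum (pi x u).
Proof. by move=> [K [g [hg ->]]]; rewrite pi_sumr //; apply: lowsum_sum => i _; exact: low_act. Qed.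

Lemma lowsum_u0 : lowsum u0. Proof. by apply: (@lowsum_low 0); exact: low_base. Qed.

Lemma lowsum_all : simple_gmodule pi -> u0 != 0 -> forall u, lowsum u.
Proof.
move=> [_ hs] u00; have [|h|//] := hs lowsum.
  by split; [exact: lowsum0|exact: lowsum_lin|move=> x v _; exact: lowsum_act].
by move: u00; rewrite (h u0 lowsum_u0) eqxx.
Qed.
End Low.

Lemma eig_indep (U : lmodType C) (h : U -> U) (c : C) (g : nat -> U) K : linear h ->
  (forall m, h (g m) = (c + m%:R) *: g m) -> \sum_(m < K) g m = 0 -> forall m, (m < K)%N -> g m = 0.
Proof.
move=> hl hg; have hD u v : h (u + v) = h u + h v by have := hl 1 u v; rewrite !scale1r.
have h00 : h 0 = 0 by have := hD 0 0; rewrite addr0 => /esym/eqP; rewrite -subr_eq0 addrK => /eqP.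
have hZ a u : h (a *: u) = a *: h u by have := hl a u 0; rewrite !addr0 h00 addr0.
elim: K g hg => [|K IH] g hg hs m; first by rewrite ltn0.
have hsum : h (\sum_(m < K.+1) g m) = \sum_(m < K.+1) h (g m) by exact: (big_morph h hD h00).
have small j : (j < K)%N -> g j = 0.
  move=> jK; have : \sum_(m < K) (m%:R - K%:R : C) *: g m = 0.
    have : h (\sum_(m < K.+1) g m) - (c + K%:R) *: \sum_(m < K.+1) g m = 0.
      by rewrite hs h00 scaler0 subrr.
    rewrite hsum scaler_sumr -sumrB big_ord_recr /= hg subrr addr0 => E1.
    rewrite -[RHS]E1; apply: eq_bigr => i _ /=; rewrite hg -scalerBl; congr (_ *: _); ring.
  move=> hs0; have := IH (fun i => (i%:R - K%:R : C) *: g i) _ hs0 j jK.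
  move=> /(_ _)/eqP; rewrite scaler_eq0 subr_eq0 eqr_nat (_ : (j == K) = false) /=; last by lia.
  by move=> hj; apply/eqP; apply: hj => i; rewrite hZ hg !scalerA mulrC.
rewrite ltnS leq_eqVlt => /orP[/eqP ->|]; last exact: small.
by move: hs; rewrite big_ord_recr /= big1 ?add0r // => i _; apply: small.
Qed.

Section Pair.
Variables (V W : lmodType C) (piV : M -> V -> V) (piW : M -> W -> W).
Variables (chi : 'I_n.+1 -> C) (v0 : V) (w0 : W).
Hypotheses (glV : glmod piV) (glW : glmod piW) (hwV : hwv piV chi v0) (hwW : hwv piW chi w0).

Definition pip (x : M) (p : V * W) : V * W := (piV x p.1, piW x p.2).

Lemma glp : glmod pip.
Proof.
have [a1 a2 a3] := glV; have [b1 b2 b3] := glW.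
split=> [x c u v|x y c u|x y u]; apply: injective_projections => /=.
- exact: a1.
- exact: b1.
- exact: a2.
- exact: b2.
- exact: a3.
- exact: b3.
Qed.

Lemma hwp : hwv pip chi (v0, w0).
Proof.
have [a1 a2] := hwV; have [b1 b2] := hwW.
split=> [a b ab|a]; apply: injective_projections => /=.
- exact: a1.
- exact: b1.
- exact: a2.
- exact: b2.
Qed.

(* The submodule of V x W generated by (v0, w0), read as a relation: it will be the graph of an isomorphism. *)
Definition rel (x : V) (y : W) := lowsum pip (v0, w0) (x, y).

Lemma low_pair m p : low pip (v0, w0) m p -> low piV v0 m p.1 /\ low piW w0 m p.2.
Proof.
elim=> {m p} [|m|m c u v _ [h1 h2] _ [h3 h4]|a b m u ab _ [h1 h2]] /=.
- by split; exact: low_base.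
- by split; exact: low_zero.
- by split; apply: low_lin.
- by split; apply: low_f.
Qed.

Lemma rel0 : rel v0 w0. Proof. exact: lowsum_u0. Qed.
Lemma rel_lin c x y x' y' : rel x y -> rel x' y' -> rel (c *: x + x') (c *: y + y').
Proof. exact: lowsum_lin. Qed.
Lemma rel00 : rel 0 0. Proof. exact: lowsum0. Qed.
Lemma rel_act x u v : rel u v -> rel (piV x u) (piW x v).
Proof. move=> h; have := lowsum_act glp hwp x h; exact. Qed.
Lemma relB x y x' y' : rel x y -> rel x' y' -> rel (x - x') (y - y').
Proof. by move=> h h'; have := rel_lin (-1) h' h; rewrite !scaleN1r ![- _ + _]addrC. Qed.
Lemma relD x y x' y' : rel x y -> rel x' y' -> rel (x + x') (y + y').
Proof. by move=> h h'; have := rel_lin 1 h h'; rewrite !scale1r. Qed.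
Lemma relZ c x y : rel x y -> rel (c *: x) (c *: y).
Proof. by move=> h; have := rel_lin c h rel00; rewrite !addr0. Qed.
Lemma rel_sum I (r : seq I) (P : pred I) F G : (forall i, P i -> rel (F i) (G i)) ->
  rel (\sum_(i <- r | P i) F i) (\sum_(i <- r | P i) G i).
Proof.
move=> h; elim: r => [|i r IH]; first by rewrite !big_nil; exact: rel00.
by rewrite !big_cons; case: ifP => // hi; apply: relD => //; apply: h.
Qed.

Lemma rel_graded x y : rel x y -> exists K (g : nat -> V * W),
  [/\ (forall m, low pip (v0, w0) m (g m)), x = \sum_(m < K) (g m).1 & y = \sum_(m < K) (g m).2].
Proof.
move=> [K [g [hg e]]]; exists K, g; split=> //.
  have := congr1 fst e; rewrite /= => ->; exact: (big_morph fst (fun _ _ => erefl) erefl).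
have := congr1 snd e; rewrite /= => ->; exact: (big_morph snd (fun _ _ => erefl) erefl).
Qed.

Lemma low_rel m p : low pip (v0, w0) m p -> rel p.1 p.2.
Proof. by move=> h; rewrite /rel -surjective_pairing; exact: lowsum_low h. Qed.

Hypothesis simpleV : simple_gmodule piV.
Hypothesis v00 : v0 != 0.
(** The coefficient of [w0], as a functional that vanishes in all positive heights. *)
Variable ev : W -> C.
Hypothesis evD : forall y y', ev (y + y') = ev y + ev y'.
Hypothesis evZ : forall c y, ev (c *: y) = c * ev y.
Hypothesis ev0 : ev w0 = 1.
Hypothesis evlow : forall m y, piW h0 y = (c0 chi + m.+1%:R) *: y -> ev y = 0.

Lemma ev_zero : ev 0 = 0. Proof. by rewrite -(scale0r w0) evZ mul0r. Qed.

Lemma low_sum_zero K (g : nat -> V * W) : (forall m, low pip (v0, w0) m (g m)) ->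
  \sum_(m < K) (g m).1 = 0 -> forall m, (m < K)%N -> (g m).1 = 0.
Proof.
move=> hg; have [h1 _ _] := glV.
apply: (@eig_indep _ (piV h0) (c0 chi) (fun m => (g m).1)) => // m.
by apply: (low_eig glV hwV); case: (low_pair (hg m)).
Qed.

(** The vectors related to 0 form a submodule of the simple [V]. Were it everything, [v0] would be
    related to 0: applying [ev] to the second component makes the coefficient of the generator
    vanish, while the component of height 0 of [v0] is [v0] itself. *)
Lemma rel_inj x : rel x 0 -> x = 0.
Proof.
move: x; have [_ hs] := simpleV; have [||h] := hs (fun x => rel x 0); last 2 first.
- by [].
- have [K [g [hg e1 e2]]] := rel_graded (h v0).
  exfalso; have evs : \sum_(m < K) ev (g m).2 = 0.
    by rewrite -(big_morph ev evD ev_zero) -e2 ev_zero.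
  case: K e1 e2 evs => [|K] e1 e2 evs.
    by move/eqP: v00; apply; rewrite e1 big_ord0.
  have [c hc] := low0 (hg 0%N) erefl.
  have ev_c : c = 0.
    move: evs; rewrite big_ord_recl /= big1 ?addr0.
      by rewrite hc /= evZ ev0 mulr1.
    by move=> i _; apply: (@evlow i); have [_ h2] := low_pair (hg (lift ord0 i)); have := low_eig glW hwW h2.
  have z : \sum_(m < K.+1) (if m == 0%N :> nat then - v0 else (g m).1) = 0.
    rewrite big_ord_recl /= addrC; apply/eqP; rewrite subr_eq0; apply/eqP; rewrite e1 big_ord_recl hc ev_c scale0r add0r.
    by apply: eq_bigr.
  have [l1 _ _] := glV.
  have := @eig_indep _ (piV h0) (c0 chi) (fun m => if m == 0%N then - v0 else (g m).1) K.+1 (l1 h0) _ z 0%N (ltn0Sn _).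
  move=> /(_ _)/eqP; rewrite /= oppr_eq0 (negbTE v00) => hh.
  suff : false by []; apply: hh => m; case: eqP => [->|_].
    by rewrite -scaleN1r (piZ glV) (low_eig glV hwV (low_base piV v0)) !scalerA mulrC.
  by apply: (low_eig glV hwV); case: (low_pair (hg m)).
- split; first exact: rel00.
    by move=> a u v hu hv; have := rel_lin a hu hv; rewrite scaler0 addr0.
  by move=> y v _ hv; have := rel_act y hv; rewrite (pi0 glW).
Qed.

Lemma rel_exists x : exists y, rel x y.
Proof.
have sub : is_submodule piV (fun x => exists y, rel x y).
  split; first by exists 0; exact: rel00.
    by move=> a u v [y hy] [y' hy']; exists (a *: y + y'); exact: rel_lin.
  by move=> y v _ [z hz]; exists (piW y z); exact: rel_act.
have [_ hs] := simpleV; have [h|] := hs _ sub; last exact.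
by move: v00; rewrite (h v0) ?eqxx //; exists w0; exact: rel0.
Qed.
End Pair.
End GlModules.

(** * The highest weight vector of the tableau module *)

Section TableauWeights.
Variables (C : numClosedFieldType) (n : nat).
Local Notation arr := (GTarr C n).
Local Notation M := 'M[C]_n.+1.
Local Notation E := (@delta_mx C n.+1 n.+1).
Implicit Types (v z : arr) (s : bool).
Variables (pw : nat -> nat) (l : nat -> C).
Hypothesis pw_inj : forall i j, (i <= n)%N -> (j <= n)%N -> pw i = pw j -> i = j.
Hypothesis sep : forall k i j, (k < n)%N -> (i <= k)%N -> (j <= k)%N ->
  (pw i < pw k.+1)%N -> (pw k.+1 < pw j)%N -> ~ isZ (l i - l j).
Local Notation inS := (@inS C n pw l).
Local Notation tc := (@tc C n pw l).
Local Notation W := (arr -> C^o).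
Local Notation op := (@op C n pw l).
Local Notation Hop := (@Hop C n pw l).
Local Notation Xop := (@Xop C n pw l).
Local Notation piW := (@piW C n pw l).

Lemma ord_le (a : 'I_n.+1) : (a <= n)%N. Proof. by rewrite -ltnS. Qed.

Lemma glW : glmod piW.
Proof.
split=> [x|x y a u|x y u]; first exact: piW_linear; first exact: piW_linear_l.
have lD (a b : M) (f : W) : piW (a + b) f = piW a f + piW b f by have := piW_linear_l pw l a b 1 f; rewrite !scale1r.
have l0 (f : W) : piW 0 f = 0 by have /eqP := lD 0 0 f; rewrite addr0 -subr_eq0 opprD addrA subrr sub0r oppr_eq0 => /eqP.
have lZ c (a : M) (f : W) : piW (c *: a) f = c *: piW a f by have := piW_linear_l pw l a 0 c f; rewrite l0 !addr0.
have lS I (r : seq I) (F : I -> M) (f : W) : piW (\sum_(i <- r) F i) f = \sum_(i <- r) piW (F i) f.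
  exact: (big_morph (fun a => piW a f) (fun a b => lD a b f) (l0 f)).
have rD (a : M) (f g : W) : piW a (f + g) = piW a f + piW a g by have := piW_linear pw l a 1 f g; rewrite !scale1r.
have r0 (a : M) : piW a 0 = 0 by have /eqP := rD a 0 0; rewrite addr0 -subr_eq0 opprD addrA subrr sub0r oppr_eq0 => /eqP.
have rZ c (a : M) (f : W) : piW a (c *: f) = c *: piW a f by have := piW_linear pw l a c f 0; rewrite r0 !addr0.
have rS (a : M) I (r : seq I) (F : I -> W) : piW a (\sum_(i <- r) F i) = \sum_(i <- r) piW a (F i).
  exact: (big_morph (piW a) (rD a) (r0 a)).
have key (y' : M) : (forall a b, piW (lbr (E a b) y') u = piW (E a b) (piW y' u) - piW y' (piW (E a b) u)) ->
    piW (lbr x y') u = piW x (piW y' u) - piW y' (piW x u).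
  move=> h; rewrite (matrix_sum_delta x) lbr_suml !lS rS -sumrB; apply: eq_bigr => i _.
  rewrite lbr_suml !lS rS -sumrB; apply: eq_bigr => j _.
  by rewrite lbrZl !lZ rZ h scalerBr.
have lbrN (a b : M) : lbr a b = - lbr b a by rewrite /lbr opprB.
have lN (a : M) (f : W) : piW (- a) f = - piW a f by rewrite -scaleN1r lZ scaleN1r.
apply: key => a b; rewrite lbrN lN -[RHS]opprB; congr (- _).
rewrite (matrix_sum_delta y) lbr_suml !lS rS -sumrB; apply: eq_bigr => i _.
rewrite lbr_suml !lS rS -sumrB; apply: eq_bigr => j _.
by rewrite lbrZl !lZ rZ piW_bracket_delta // scalerBr.
Qed.

Definition suppS (phi : W) := forall v, ~ inS v -> phi v = 0.

Lemma op_supp s k phi : suppS (op s k phi).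
Proof.
move=> v nv; rewrite /op; case: ifP => //= _; rewrite /opf big1 // => i _.
by rewrite tc_supp ?mul0r // umvK => -[].
Qed.

Definition esupp (f : endo W) := forall phi, suppS (f phi).

Lemma br_supp f g : esupp f -> esupp g -> esupp (br f g).
Proof. by move=> hf hg phi v nv; rewrite endo_brE -[LHS]/(f (g phi) v - g (f phi) v) hf // hg // subrr. Qed.

Lemma Xop_supp a b : esupp (Xop a b).
Proof.
have e1 k : esupp (@eop C n pw l k).
  by move=> phi v nv; rewrite -[LHS]/(- (op true k phi v)) op_supp ?oppr0.
have f1 k : esupp (@fop C n pw l k) by move=> phi; exact: op_supp.
rewrite /Xop /glX; case: ifP => _; last case: ifP => _.
- by elim: (b - a.+1)%N => //= d IH; apply: br_supp.
- rewrite /lowr; elim: (a - b.+1)%N => //= d IH; rewrite br_conv; exact: br_supp.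
- move=> phi v nv; rewrite /Hop; case: ifP => //= _.
  by rewrite /Hf; case: asboolP.
Qed.

Lemma piW_supp x phi : suppS (piW x phi).
Proof.
move=> v nv; rewrite /piW; have -> : (\sum_i \sum_j x i j *: Xop i j phi) = (fun v : arr => \sum_i \sum_j x i j * Xop i j phi v).
  apply/funext => v'.
  have ap : {morph (fun f : W => f v') : f g / f + g} by [].
  rewrite (big_morph _ ap (erefl : (0 : W) v' = 0)); apply: eq_bigr => i _.
  by rewrite (big_morph _ ap (erefl : (0 : W) v' = 0)).
by rewrite big1 // => i _; rewrite big1 // => j _; rewrite Xop_supp ?mulr0.
Qed.

Lemma piW_diag (d : 'I_n.+1 -> C) phi v : inS v ->
  piW (\sum_c d c *: E c c) phi v = (\sum_c d c * wt c v) * phi v.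
Proof.
move=> iv; rewrite (pi_suml glW).
have ap : {morph (fun f : W => f v) : f g / f + g} by [].
rewrite (big_morph _ ap (erefl : (0 : W) v = 0)) mulr_suml; apply: eq_bigr => c _.
rewrite (piZl glW) piW_delta /Xop /glX ltnn Hop_le ?ord_le //=.
by rewrite -[LHS]/(d c * (if `[< inS v >] then wt c v * phi v else 0)) asboolT // mulrA.
Qed.

Lemma piW_ech k phi : (k < n)%N -> piW (ech C n k) phi = - op true k phi.
Proof.
move=> hk; rewrite /ech /Emx piW_delta !inordK; [|lia|lia].
by rewrite /Xop /glX ltnSn subnn.
Qed.
Lemma piW_fch k phi : (k < n)%N -> piW (fch C n k) phi = op false k phi.
Proof.
move=> hk; rewrite /fch /Emx piW_delta !inordK; [|lia|lia].
by rewrite /Xop /glX ltnNge leqnSn /= ltnSn subnn.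
Qed.

(** Abel summation along the rows: a weighted sum of weights is governed by the column steps
    [v_{k,i} - v_{k+1,i}]. *)
Lemma wt_sum_rows (p : nat -> C) v m : (m <= n)%N ->
  \sum_(a < m.+1) p a * wt a v = \sum_(a < m.+1) p a * (ent v m a + a%:R)
   + \sum_(k < m) \sum_(i < k.+1) (p i - p k.+1) * (ent v k i - ent v k.+1 i).
Proof.
elim: m => [|m IH] hm.
  by rewrite big_ord0 addr0 !big_ord_recl !big_ord0 /wt big_ord_recl !big_ord0 /= !addr0 subr0.
rewrite big_ord_recr IH; last exact: ltnW.
rewrite [X in _ = _ + X]big_ord_recr [X in _ = X + _]big_ord_recr /=.
have -> : wt m.+1 v = \sum_(i < m.+1) ent v m.+1 i + ent v m.+1 m.+1 - \sum_(i < m.+1) ent v m i + m.+1%:R.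
  by rewrite /wt big_ord_recr.
have -> : \sum_(i < m.+1) (p i - p m.+1) * (ent v m i - ent v m.+1 i) =
   \sum_(i < m.+1) p i * (ent v m i + i%:R) - \sum_(i < m.+1) p i * (ent v m.+1 i + i%:R)
   - p m.+1 * (\sum_(i < m.+1) ent v m i - \sum_(i < m.+1) ent v m.+1 i).
  by rewrite -!sumrB mulr_sumr -sumrB; apply: eq_bigr => i _; ring.
ring.
Qed.

Lemma wt_sum (p : nat -> C) v : lattice l v ->
  \sum_(a < n.+1) p a * wt a v = \sum_(a < n.+1) p a * (l a + a%:R)
   + \sum_(k < n) \sum_(i < k.+1) (p i - p k.+1) * (ent v k i - ent v k.+1 i).
Proof.
move=> [_ hn _]; rewrite wt_sum_rows //; congr (_ + _); apply: eq_bigr => a _.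
by rewrite hn ?ord_le.
Qed.
End TableauWeights.

Section TableauHighestWeight.
Variables (C : numClosedFieldType) (n : nat).
Local Notation arr := (GTarr C n).
Local Notation E := (@delta_mx C n.+1 n.+1).
Implicit Types (v z : arr) (s : bool).
Variables (pw : nat -> nat) (l : nat -> C).
Hypothesis pw_inj : forall i j, (i <= n)%N -> (j <= n)%N -> pw i = pw j -> i = j.
Hypothesis sep : forall k i j, (k < n)%N -> (i <= k)%N -> (j <= k)%N ->
  (pw i < pw k.+1)%N -> (pw k.+1 < pw j)%N -> ~ isZ (l i - l j).
Hypothesis dom : forall i j, (i <= n)%N -> (j <= n)%N -> (pw i < pw j)%N ->
  forall z : int, l i - l j = z%:~R -> 0 < z.
Local Notation inS := (@inS C n pw l).
Local Notation tc := (@tc C n pw l).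
Local Notation W := (arr -> C^o).
Local Notation op := (@op C n pw l).
Local Notation piW := (@piW C n pw l).
Local Notation glW := (glW pw_inj sep).

Definition delta (u : arr) : W := fun v => (v == u)%:R.

(** In the extremal tableau [w0arr] every column step [v_{k,i} - v_{k+1,i}] is 1 or 0, the value
    closest to the boundary of its sign condition. Entry [(k,i)] thus gains one unit for each
    position after [k] that precedes [i] in the order. *)
Definition nbef k i : nat := (\sum_(j < n.+1 | (k < j) && (pw j < pw i)) 1)%N.
Definition w0arr : arr := [ffun p : 'I_n.+1 * 'I_n.+1 => if (p.2 <= p.1)%N then l p.2 + (nbef p.1 p.2)%:R else 0].

Lemma ent_w0 k i : (k <= n)%N -> (i <= k)%N -> ent w0arr k i = l i + (nbef k i)%:R.
Proof. by move=> hk hi; rewrite /ent ffunE /= !inordK ?hi //; lia. Qed.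

Lemma nbef_succ k i : (k < n)%N -> nbef k i = ((pw k.+1 < pw i) + nbef k.+1 i)%N.
Proof.
move=> hk; rewrite /nbef; have hk1 : (k.+1 < n.+1)%N by [].
case: (ltnP (pw k.+1) (pw i)) => h.
  rewrite (bigD1 (Ordinal hk1)) /= ?ltnSn //; congr (_ + _)%N; apply: eq_bigl => j.
  by rewrite -val_eqE /=; lia.
by apply: eq_bigl => j; case: (ltngtP k.+1 j) => //= <-; rewrite ltnNge h.
Qed.

Lemma nbef_n i : nbef n i = 0%N.
Proof. by rewrite /nbef big_pred0 // => j; rewrite ltnNge ord_le. Qed.

(** By [sep], no position after [k+1] comes between two integrally related positions. *)
Lemma nbef_isZ k i j : (i <= k.+1)%N -> (j <= k.+1)%N -> isZ (l i - l j) -> nbef k.+1 i = nbef k.+1 j.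
Proof.
move=> hi hj hz; have hz' : isZ (l j - l i) by rewrite -opprB; exact: isZN.
apply: eq_bigl => m; case: (ltnP k.+1 m) => //= hm.
have hmn := ord_le m; have e : (m.-1.+1 = m :> nat) by lia.
have h1 := @sep m.-1 i j; have h2 := @sep m.-1 j i.
rewrite e in h1 h2.
have n1 : pw m <> pw i by move/pw_inj; lia.
have n2 : pw m <> pw j by move/pw_inj; lia.
case: (ltngtP (pw m) (pw i)) => c1 //; case: (ltngtP (pw m) (pw j)) => c2 //; exfalso.
- by apply: h2 => //; lia.
- by apply: h1 => //; lia.
Qed.

Lemma inS_w0 : inS w0arr.
Proof.
split; first split.
- by move=> a b ab; rewrite ffunE /= leqNgt ab.
- by move=> i hi; rewrite ent_w0 // nbef_n addr0.
- by move=> k i hk hi; rewrite ent_w0 // addrAC subrr add0r; exists (nbef k i).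
move=> k i j hk hi hj z; rewrite !ent_w0 //; [|exact: ltnW] => hz.
have [t ht] : isZ (l i - l j).
  exists (z - (nbef k i)%:Z + (nbef k.+1 j)%:Z); rewrite rmorphD rmorphB /= -hz -!pmulrn; ring.
have zE : z = t + (pw k.+1 < pw i)%:Z.
  apply: (@intC_inj C); rewrite -hz rmorphD /= -ht nbef_succ // (nbef_isZ (leqW hi) hj); last by exists t.
  by rewrite natrD -!pmulrn; ring.
rewrite zE /cbit; have hj' : (j <= n)%N by lia.
have hi' : (i <= n)%N by lia.
case: (ltngtP (pw i) (pw j)) => c /=.
- by have := dom hi' hj' c ht; lia.
- have ht' : l j - l i = (- t)%:~R by rewrite rmorphN /= -ht opprB.
  have := dom hj' hi' c ht'; rewrite (_ : (i == j) = false) /=; first by lia.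
  by apply/eqP => e; move: c; rewrite e ltnn.
- have e := pw_inj hi' hj' c; move: ht; rewrite e subrr eqxx /= => ht.
  have -> : t = 0 by apply: (@intC_inj C).
  by case: (_ < _)%N.
Qed.

Lemma w0_diff k i : (k < n)%N -> (i <= k)%N -> ent w0arr k i - ent w0arr k.+1 i = (pw k.+1 < pw i)%:R.
Proof. by move=> hk hi; rewrite !ent_w0 //; [rewrite nbef_succ // natrD; ring|lia..]. Qed.

Lemma inS_diff v k i : inS v -> (k < n)%N -> (i <= k)%N -> exists d : nat,
  ent v k i - ent v k.+1 i = (if (pw k.+1 < pw i)%N then 1 + d%:R else - d%:R).
Proof.
move=> [[_ _ lat] bits] hk hi.
have [z hz] : isZ (ent v k i - ent v k.+1 i).
  have -> : ent v k i - ent v k.+1 i = (ent v k i - l i) - (ent v k.+1 i - l i) by ring.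
  by apply: isZB; apply: lat; lia.
have := bits k i i hk hi (leqW hi) z hz; rewrite /cbit ltnn eqxx /= hz.
case: ifP => _ h.
  exists (absz (z - 1)); have -> : z = 1 + (absz (z - 1))%:Z by lia.
  by rewrite rmorphD /= -pmulrn; congr (_ + _%:R); lia.
exists (absz z); have {1}-> : z = - (absz z)%:Z by lia.
by rewrite rmorphN /= -pmulrn.
Qed.

Definition ht v : C := \sum_(a < n.+1) (pw a)%:R * wt a v - \sum_(a < n.+1) (pw a)%:R * wt a w0arr.

Lemma wt_diff (p : nat -> C) v : lattice l v ->
  \sum_(a < n.+1) p a * wt a v - \sum_(a < n.+1) p a * wt a w0arr =
  \sum_(k < n) \sum_(i < k.+1) (p i - p k.+1) * (ent v k i - ent v k.+1 i - (pw k.+1 < pw i)%:R).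
Proof.
move=> lv; rewrite (wt_sum p lv) (wt_sum p (proj1 inS_w0)) opprD addrACA subrr add0r -sumrB.
apply: eq_bigr => k _; rewrite -sumrB; apply: eq_bigr => i _.
by rewrite w0_diff ?mulrBr // -ltnS.
Qed.

(** Each column step contributes the distance of two ranks times the natural number of [inS_diff];
    the two signs agree. *)
Lemma ht_nat v : inS v -> exists m : nat, ht v = m%:R.
Proof.
move=> iv; rewrite /ht (wt_diff (fun a => (pw a)%:R) (proj1 iv)).
have addP (x y : C) : (exists m : nat, x = m%:R) -> (exists m : nat, y = m%:R) -> exists m : nat, x + y = m%:R.
  by move=> [a ->] [b ->]; exists (a + b)%N; rewrite natrD.
have z0 : exists m : nat, (0 : C) = m%:R by exists 0%N.
pose P := fun x : C => exists m : nat, x = m%:R.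
apply: (big_ind P) => // k _; apply: (big_ind P) => // i _; rewrite /P.
have hi : (i <= k)%N by rewrite -ltnS.
have [d ->] := inS_diff iv (ltn_ord k) hi.
case: ltnP => h.
  exists ((pw i - pw k.+1) * d)%N; rewrite natrM natrB ?(ltnW h) //=; ring.
by exists ((pw k.+1 - pw i) * d)%N; rewrite natrM natrB //=; ring.
Qed.

Lemma hw_chi (phi : W) v : inS v -> piW (h0 C n pw) phi v = (\sum_(a < n.+1) (pw a)%:R * wt a v) * phi v.
Proof. by move=> iv; rewrite /h0 (piW_diag pw_inj sep (fun a : 'I_n.+1 => (pw a)%:R)). Qed.

Lemma piW_Eaa (a : 'I_n.+1) (phi : W) v : inS v -> piW (E a a) phi v = wt a v * phi v.
Proof.
move=> iv; rewrite piW_delta /Xop /glX ltnn Hop_le ?ord_le //=.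
by rewrite /Hf asboolT.
Qed.

(** A raising operator would produce support in negative height, and by [ht_nat] there is no such
    tableau. *)
Lemma hwW : hwv pw piW (fun a : 'I_n.+1 => wt a w0arr) (delta w0arr).
Proof.
have Ed (a : 'I_n.+1) : piW (E a a) (delta w0arr) = wt a w0arr *: delta w0arr.
  apply/funext => v; have [iv|nv] := pselect (inS v).
    rewrite piW_Eaa // -[RHS]/(wt a w0arr * delta w0arr v) /delta.
    by case: eqP => [->//|_]; rewrite !mulr0.
  rewrite (piW_supp (E a a) (delta w0arr) nv) -[RHS]/(wt a w0arr * delta w0arr v) /delta.
  by case: eqP => [e|_]; [case: nv; rewrite e; exact: inS_w0|rewrite mulr0].
split=> // a b ab; apply/funext => v.
have [iv|nv] := pselect (inS v); last by rewrite (piW_supp (E a b) (delta w0arr) nv).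
have h0d : piW (h0 C n pw) (delta w0arr) = c0 pw (fun a : 'I_n.+1 => wt a w0arr) *: delta w0arr.
  rewrite /h0 (pi_suml glW) scaler_suml; apply: eq_bigr => c _.
  by rewrite (piZl glW) Ed scalerA.
have := pi_lbr glW (h0 C n pw) (E a b) (delta w0arr).
rewrite h0d (piZ glW) lbr_h0 (piZl glW) -scalerDl => /(congr1 (fun f : W => f v)).
rewrite hw_chi // -[RHS]/(_ * piW (E a b) (delta w0arr) v) => /eqP.
rewrite -subr_eq0 -mulrBl mulf_eq0 => /orP[|/eqP //].
have [m hm] := ht_nat iv; rewrite /c0 opprD addrA -/(ht v) hm.
rewrite (_ : m%:R - ((pw a)%:R - (pw b)%:R) = (m + (pw b - pw a))%:R :> C); last first.
  by rewrite natrD natrB ?(ltnW ab) //; ring.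
by rewrite pnatr_eq0; lia.
Qed.

Section Raising.
Variable r : nat.
Hypotheses (hr : (r < n)%N) (std : forall i j, (i < j)%N -> (j <= r.+1)%N -> (pw i < pw j)%N).
Variables (v : arr) (j : nat).
Hypotheses (iv : inS v) (hj : (j <= r)%N) (ne : ent v r j <> ent v r.+1 j).
Hypothesis top : forall q, (q < r)%N -> ent v r.-1 q = ent v r q.
Local Notation m := ((true, r, j) : move).

(** For [q > j] the sign conditions give [v_{r,j} > v_{r+1,q}]; for [q < j] they give
    [v_{r+1,q} > v_{r+1,j} >= v_{r,j}]; and [q = j] is excluded by [ne]. *)
Lemma raise_num1 q : (q < r.+2)%N -> ent v r j != ent v r.+1 q.
Proof.
have rowgt a b (z : int) : (a <= r.+1)%N -> (b <= r.+1)%N -> (pw a < pw b)%N ->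
    ent v r.+1 a - ent v r.+1 b = z%:~R -> 0 < z.
  move=> ha hb ab; case: (ltnP r.+1 n) => hn.
    exact: (row_gt pw_inj sep iv hn ha hb ab).
  have e : r.+1 = n by lia.
  rewrite e in ha hb *; have [[_ tp _] _] := iv; rewrite !tp //; exact: dom.
move=> hq; apply/eqP => e; have [qj|qj] := eqVneq q j; first by apply: ne; rewrite e qj.
have b1 := proj2 iv r j q hr hj hq 0.
have [d] := inS_diff iv hr hj.
have stj : (pw j < pw r.+1)%N by apply: std => //; lia.
rewrite ltnNge (ltnW stj) /= => hd.
have qj' : (q < j)%N.
  case: (ltngtP q j) => [//|c|c]; last by rewrite c eqxx in qj.
  by have := b1; rewrite e subrr /cbit (std c hq) => /(_ erefl).
have := @rowgt q j (- d%:Z) _ _ (std qj' _).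
rewrite -e hd rmorphN /= -pmulrn => /(_ _ _ _ erefl) h.
by suff : 0 < - d%:Z by [lia]; apply: h; lia.
Qed.

Lemma raise_ok : [/\ gt_num true r j v != 0, gt_num false r j (mv m v) != 0 & inS (mv m v)].
Proof.
have okm1 : okm n m by apply/andP.
have h1 : gt_num true r j v != 0.
  by apply/prodf_neq0 => q _; rewrite subr_eq0 raise_num1.
have h2 : gt_num false r j (mv m v) != 0.
  apply/prodf_neq0 => q _; have hq := ltn_ord q; rewrite /= in hq *.
  rewrite !ent_mv; try lia; rewrite eqxx eqxx (_ : (r.-1 == r) = false) /=; last by lia.
  rewrite addr0 subr_eq0; apply/eqP => e.
  move: (nat_of_ord q) hq e => {}q hq e.
  have e' : ent v r q = ent v r j + 1 by rewrite -top; [rewrite -e|].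
  have [q' hq' eq'] := cross_up pw_inj sep iv hr hj (ltnW hq) e'.
  by have := raise_num1 hq'; rewrite eq' eqxx.
by split=> //; exact: (inS_mv okm1 iv h1 h2).
Qed.

(** Rows [r-1] and [r] agree in [v], and no longer do after two different entries of row [r] have
    moved. This isolates one wanted term among those of a move operator, in [singular] and in
    [gen_std]. *)
Lemma swap_not_top i : (i <= r)%N -> i <> j ->
  exists2 c, (c < r)%N & ent (mv (false, r, i) (mv m v)) r.-1 c <> ent (mv (false, r, i) (mv m v)) r c.
Proof.
move=> hi neq; exists (minn j i); first by lia.
have ev2 a b : (a <= r)%N -> (b <= r)%N -> ent (mv (false, r, i) (mv m v)) a b = ent v a b +
    (if (a == r) && (b == j) then 1 else 0) + (if (a == r) && (b == i) then -1 else 0).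
  by move=> ha hb; rewrite !ent_mv //; lia.
have hc : (minn j i < r)%N by lia.
rewrite !ev2 ?top ?eqxx //; try lia.
rewrite (_ : (r.-1 == r) = false) /=; last by lia.
rewrite !addr0 -addrA => /eqP; rewrite -subr_eq0 opprD addrA subrr sub0r oppr_eq0.
case: (ltngtP j i) => [ji|ij|e]; last by case: neq.
- by rewrite eqxx (_ : (j == i) = false) ?addr0 ?oner_eq0 //; lia.
- by rewrite eqxx (_ : (i == j) = false) ?add0r ?oppr_eq0 ?oner_eq0 //; lia.
Qed.
End Raising.

Section Singular.
Variable r : nat.
Hypotheses (hr : (r <= n)%N) (std : forall i j, (i < j)%N -> (j <= r)%N -> (pw i < pw j)%N).

(** Induction on the row. If [v] in the support had a column step at row [r'], evaluate the raising
    operator of that row at the tableau with this entry raised: the other sources have a step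
    further down, so by induction they lie outside the support, and the term of [v] cannot be
    cancelled. *)
Lemma singular (phi : W) : suppS pw l phi -> (forall k, (k < r)%N -> op true k phi = 0) ->
  forall v, phi v != 0 -> forall k i, (k <= r)%N -> (i <= k)%N -> ent v k i = ent v r i.
Proof.
elim: r hr std => [|r' IH] hr' st sp hk v hv k i; first by rewrite leqn0 => /eqP -> //; rewrite leqn0 => /eqP ->.
have {}IH : forall v, phi v != 0 -> forall k i, (k <= r')%N -> (i <= k)%N -> ent v k i = ent v r' i.
  apply: IH => //; first exact: ltnW; last by move=> k' hk'; apply: hk; lia.
  by move=> a b ab hb; apply: st => //; lia.
have inv z : phi z != 0 -> inS z by move=> hz; apply: contrapT => nz; move: hz; rewrite sp ?eqxx.
have iv := inv v hv.
have tp z q : phi z != 0 -> (q < r')%N -> ent z r'.-1 q = ent z r' q.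
  by move=> hz hq; apply: IH => //; lia.
suff main j : (j <= r')%N -> ent v r' j = ent v r'.+1 j.
  rewrite leq_eqVlt => /orP[/eqP -> //|kr] ik.
  by rewrite (IH v hv k i) //; apply: main; lia.
move=> hj; apply: contrapT => ne; pose m : move := (true, r', j).
have [h1 h2 iv'] := raise_ok hr' st iv hj ne (fun q => tp v q hv).
have := hk r' (ltnSn _); rewrite op_lt //= => /(congr1 (fun f : W => f (mv m v))).
rewrite -[RHS]/(0 : C) /opf (bigD1 (Ordinal (hj : (j < r'.+1)%N))) //= big1 ?addr0.
  rewrite -/m mvK => /eqP; rewrite mulf_eq0 (negbTE hv) orbF /tc !asboolT //= /fc mulf_eq0 (negbTE h1) /=.
  by rewrite invr_eq0 (negbTE (gt_den_neq0 pw_inj sep iv hr' hj)).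
move=> i' ne'; set v2 := umv _ _.
have hi' : (i' <= r')%N by rewrite -ltnS.
have neq : (i' : nat) <> j by move=> e; case/eqP: ne'; apply: val_inj.
have [->|hv2] := eqVneq (phi v2) 0; first by rewrite mulr0.
have [c hc] := swap_not_top hr' hj (fun q => tp v q hv) hi' neq.
by case; exact: (tp v2 c hv2 hc).
Qed.
End Singular.

Lemma arr_ext v z : lattice l v -> lattice l z ->
  (forall k i, (k <= n)%N -> (i <= k)%N -> ent v k i = ent z k i) -> v = z.
Proof.
move=> [h1 _ _] [h2 _ _] h; apply/ffunP => -[a b].
case: (ltnP a b) => ab; first by rewrite h1 // h2.
by have := h a b (ord_le a) ab; rewrite /ent !inord_val.
Qed.

Lemma ht_mv s k i v : (k < n)%N -> (i <= k)%N ->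
  ht (mv (s, k, i) v) = ht v + sg C s * ((pw k)%:R - (pw k.+1)%:R).
Proof.
move=> hk hi; rewrite /ht addrAC; congr (_ - _).
under eq_bigr => a _ do rewrite wt_mv ?ord_le // mulrDr.
rewrite big_split /=; congr (_ + _).
have hk1 : (k < n.+1)%N by lia.
have pick b : (b < n.+1)%N -> \sum_(a < n.+1) (pw a)%:R * ((a == b :> nat)%:R) = (pw b)%:R :> C.
  move=> hb; rewrite (bigD1 (Ordinal hb)) //= eqxx mulr1 big1 ?addr0 // => a ne.
  by rewrite (_ : (a == b :> nat) = false) ?mulr0 //; apply/eqP => e; case/eqP: ne; apply: val_inj.
rewrite -(pick k) // -(pick k.+1) // -sumrB mulr_sumr; apply: eq_bigr => a _; ring.
Qed.
End TableauHighestWeight.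

(** * Highest weights after projection to traceless matrices *)

Section HatWeights.
Variables (C : numClosedFieldType) (n : nat).
Local Notation M := 'M[C]_n.+1.
Local Notation E := (@delta_mx C n.+1 n.+1).

Definition hatchi (chi : 'I_n.+1 -> C) a := chi a - (\sum_c chi c) / n.+1%:R.

Lemma tr_delta (a : 'I_n.+1) : \tr (E a a) = 1.
Proof.
rewrite /mxtrace (bigD1 a) //= mxE !eqxx big1 ?addr0 // => i ne.
by rewrite mxE (negbTE ne).
Qed.

Lemma hat_Eaa a : hat (E a a) = (-1) *: (\sum_c (1 / n.+1%:R) *: E c c) + E a a.
Proof.
rewrite /hat addrC scaleN1r tr_delta; congr (- _ + _).
rewrite -scaler_sumr; have -> : \sum_c E c c = 1%:M.
  apply/matrixP => i j; rewrite summxE (bigD1 i) //= !mxE eqxx big1 ?addr0 1?eq_sym //.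
  by move=> c ne; rewrite mxE eq_sym (negbTE ne).
by rewrite scale_scalar_mx mulr1.
Qed.

Lemma hwv_hat pw (U : lmodType C) (pi : M -> U -> U) chi u :
  glmod pi -> hwv pw pi chi u -> hwv pw (fun x => pi (hat x)) (hatchi chi) u.
Proof.
move=> gl [h1 h2]; split=> [a b ab|a].
  by rewrite hat_id ?h1 //; apply: delta_sl; apply: contraTneq ab => ->; rewrite ltnn.
rewrite hat_Eaa (piDl gl) (piZl gl) (pi_suml gl) h2.
under eq_bigr => c _ do rewrite (piZl gl) h2 scalerA.
rewrite -scaler_suml scalerA -scalerDl; congr (_ *: _).
by rewrite /hatchi -mulr_sumr; ring.
Qed.
End HatWeights.

(** * Comparison of a simple highest weight module with the tableau module *)

Section Realization.
Variables (C : numClosedFieldType) (n : nat).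
Local Notation arr := (GTarr C n).
Local Notation M := 'M[C]_n.+1.
Local Notation E := (@delta_mx C n.+1 n.+1).
Implicit Types (v z : arr) (s : bool).
Variables (pw : nat -> nat) (l : nat -> C).
Hypothesis pw_inj : forall i j, (i <= n)%N -> (j <= n)%N -> pw i = pw j -> i = j.
Hypothesis sep : forall k i j, (k < n)%N -> (i <= k)%N -> (j <= k)%N ->
  (pw i < pw k.+1)%N -> (pw k.+1 < pw j)%N -> ~ isZ (l i - l j).
Hypothesis dom : forall i j, (i <= n)%N -> (j <= n)%N -> (pw i < pw j)%N ->
  forall z : int, l i - l j = z%:~R -> 0 < z.
Local Notation inS := (@inS C n pw l).
Local Notation tc := (@tc C n pw l).
Local Notation W := (arr -> C^o).
Local Notation op := (@op C n pw l).
Local Notation piW := (@piW C n pw l).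
Local Notation glW := (glW pw_inj sep).
Local Notation w0 := (w0arr n pw l).
Local Notation delta := (@delta C n).

Definition piWh (x : M) : W -> W := piW (hat x).
Definition chiW := hatchi (fun a : 'I_n.+1 => wt a w0).

Lemma glWh : glmod piWh. Proof. exact: glmod_hat (glmod_gmodule glW). Qed.
Lemma hwWh : hwv pw piWh chiW (delta w0).
Proof. exact: hwv_hat glW (hwW pw_inj sep dom). Qed.

Lemma pw_inj_ord (i j : 'I_n.+1) : pw i = pw j -> i = j.
Proof. by move=> /pw_inj e; apply: val_inj; apply: e; exact: ord_le. Qed.

Lemma hat_h0_diag : hat (h0 C n pw) = \sum_c ((pw (c : 'I_n.+1))%:R - (\sum_(a < n.+1) (pw a)%:R) / n.+1%:R) *: E c c.
Proof.
apply/matrixP => i j.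
have sumd (d : 'I_n.+1 -> C) : (\sum_c d c *: E c c) i j = d i *+ (i == j).
  rewrite summxE (bigD1 i) //= !mxE eqxx big1 ?addr0 /= => [|c ne].
    by rewrite eq_sym mulr_natr.
  by rewrite !mxE eq_sym (negbTE ne) mulr0.
rewrite sumd /hat mxE mxE [X in X + _]sumd mxE mulrnBl; congr (_ - _ / _ *+ _).
rewrite /h0 raddf_sum; apply: eq_bigr => c _ /=; rewrite linearZ /=.
rewrite /mxtrace (bigD1 c) //= mxE !eqxx big1 ?addr0 ?mulr1 // => a ne.
by rewrite mxE (negbTE ne).
Qed.

Lemma wt_total v : inS v -> \sum_(a < n.+1) wt a v = \sum_(a < n.+1) wt a w0.
Proof.
move=> iv; apply/eqP; rewrite -subr_eq0.
have := wt_diff pw_inj sep dom (fun _ => 1) (proj1 iv).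
under [in X in X = _]eq_bigr => a _ do rewrite mul1r.
under [in X in _ - X = _]eq_bigr => a _ do rewrite mul1r.
by move=> ->; rewrite big1 // => k _; rewrite big1 // => i _; rewrite subrr mul0r.
Qed.

Lemma h0_piWh (phi : W) v : inS v -> piWh (h0 C n pw) phi v = (c0 pw chiW + ht pw l v) * phi v.
Proof.
have A (f : W) u : inS u -> piWh (h0 C n pw) f u =
    (\sum_(a < n.+1) (pw a)%:R * wt a u - (\sum_(a < n.+1) (pw a)%:R) / n.+1%:R * \sum_(a < n.+1) wt a u) * f u.
  move=> iu; rewrite /piWh hat_h0_diag (piW_diag pw_inj sep (fun c : 'I_n.+1 => (pw c)%:R - _)) //.
  by rewrite mulr_sumr -sumrB; congr (_ * _); apply: eq_bigr => c _; rewrite mulrBl.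
move=> iv; have iw := inS_w0 pw_inj sep dom.
have := low_eig glWh hwWh (low_base pw piWh (delta w0)) => /(congr1 (fun f : W => f w0)).
rewrite A // -[RHS]/(_ * delta w0 w0) /delta eqxx !mulr1 addr0 => e.
by rewrite A // wt_total // -e /ht; congr (_ * _); ring.
Qed.

Lemma op_delta s k u : (k < n)%N ->
  op s k (delta u) = \sum_(i < k.+1) tc (s, k, i : nat) u *: delta (mv (s, k, i : nat) u).
Proof.
move=> hk; apply/funext => v; rewrite op_lt //= /opf.
have ap : {morph (fun f : W => f v) : f g / f + g} by [].
rewrite (big_morph _ ap (erefl : (0 : W) v = 0)); apply: eq_bigr => i _.
rewrite -[RHS]/(tc (s, k, i : nat) u * delta (mv (s, k, i : nat) u) v) /delta.
case: (eqVneq v (mv (s, k, i : nat) u)) => [->|ne]; first by rewrite mvK eqxx.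
by case: eqP => [e|_]; rewrite ?mulr0 //; case/eqP: ne; rewrite -e umvK.
Qed.

Definition finS (phi : W) := exists s : seq (C * arr), (forall p, p \in s -> inS p.2) /\
  phi = \sum_(p <- s) p.1 *: delta p.2.

Lemma finS0 : finS 0. Proof. by exists [::]; rewrite big_nil. Qed.
Lemma finSD f g : finS f -> finS g -> finS (f + g).
Proof.
move=> [s [h ->]] [s' [h' ->]]; exists (s ++ s'); rewrite big_cat; split=> // p.
by rewrite mem_cat => /orP[/h|/h'].
Qed.
Lemma finSZ c f : finS f -> finS (c *: f).
Proof.
move=> [s [h ->]]; exists [seq (c * p.1, p.2) | p <- s]; split.
  by move=> p /mapP[q hq ->]; exact: h q hq.
by rewrite big_map scaler_sumr; apply: eq_bigr => p _; rewrite scalerA.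
Qed.
Lemma finS_sum I (r : seq I) (P : pred I) (F : I -> W) : (forall i, P i -> finS (F i)) ->
  finS (\sum_(i <- r | P i) F i).
Proof. by move=> h; apply: big_ind => //; [exact: finS0|exact: finSD]. Qed.
Lemma finS_delta u : inS u -> finS (delta u).
Proof. by move=> iu; exists [:: (1, u)]; rewrite big_seq1 scale1r; split=> // p; rewrite inE => /eqP ->. Qed.

Definition efin (f : endo W) := forall phi, finS phi -> finS (f phi).

Lemma efin_delta (f : endo W) : (forall u, inS u -> finS (f (delta u))) -> efin f.
Proof.
move=> h phi [s [hs ->]]; rewrite endo_sum big_seq; apply: finS_sum => p hp.
by rewrite endoZ; apply: finSZ; apply: h; exact: hs.
Qed.

Lemma op_fin s k : efin (op s k).
Proof.
case: (ltnP k n) => hk; last by move=> phi _; rewrite op_ge //; exact: finS0.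
apply: efin_delta => u iu; rewrite op_delta //; apply: finS_sum => i _.
have [im|nm] := pselect (inS (mv (s, k, i : nat) u)).
  by apply: finSZ; exact: finS_delta.
by rewrite tc_supp ?scale0r; [exact: finS0|case].
Qed.

Lemma br_fin f g : efin f -> efin g -> efin (br f g).
Proof.
move=> hf hg phi h; rewrite endo_brE -scaleN1r; apply: finSD; last apply: finSZ.
  by apply: hf; apply: hg.
by apply: hg; apply: hf.
Qed.

Lemma Xop_fin a b : efin (@Xop C n pw l a b).
Proof.
have e1 k : efin (@eop C n pw l k).
  move=> phi h; rewrite (_ : @eop C n pw l k phi = (-1) *: op true k phi); last by rewrite scaleN1r.
  by apply: finSZ; apply: op_fin.
have f1 k : efin (@fop C n pw l k) by exact: op_fin.
rewrite /Xop /glX; case: ifP => _; last case: ifP => _.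
- by elim: (b - a.+1)%N => //= d IH; apply: br_fin.
- rewrite /lowr; elim: (a - b.+1)%N => //= d IH; rewrite br_conv; exact: br_fin.
- apply: efin_delta => u iu; rewrite /Hop; case: ifP => _; last exact: finS0.
  rewrite (_ : Endo _ (delta u) = wt a u *: delta u); first by apply: finSZ; exact: finS_delta.
  apply/funext => v; rewrite /= /Hf -[RHS]/(wt a u * delta u v) /delta.
  case: asboolP => iv; case: eqP => [e|_]; rewrite ?mulr0 ?e //.
  by case: iv; rewrite e.
Qed.

Lemma piW_fin x phi : finS phi -> finS (piW x phi).
Proof.
move=> h; rewrite /piW; apply: finS_sum => i _; apply: finS_sum => j _.
by apply: finSZ; apply: Xop_fin.
Qed.

Lemma finS_supp phi : finS phi -> suppS pw l phi.
Proof.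
move=> [s [h ->]] v nv; have ap : {morph (fun f : W => f v) : f g / f + g} by [].
rewrite (big_morph _ ap (erefl : (0 : W) v = 0)) big_seq big1 // => p hp.
rewrite -[LHS]/(p.1 * delta p.2 v) /delta; case: eqP => [e|_]; rewrite ?mulr0 //.
by case: nv; rewrite e; exact: h.
Qed.

Lemma finS_eval (phi : W) : finS phi -> exists s : seq arr, [/\ uniq s, (forall v, v \in s -> inS v) &
  phi = \sum_(v <- s) phi v *: delta v].
Proof.
move=> [s [h e]]; exists (undup [seq p.2 | p <- s]); split; first exact: undup_uniq.
  by move=> v; rewrite mem_undup => /mapP[p hp ->]; exact: h.
apply/funext => v; have ap : {morph (fun f : W => f v) : f g / f + g} by [].
rewrite [RHS](big_morph _ ap (erefl : (0 : W) v = 0)).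
have Ev u : (phi u *: delta u) v = phi u * (v == u)%:R by [].
under eq_bigr => u _ do rewrite Ev.
have [hv|hv] := boolP (v \in undup [seq p.2 | p <- s]).
  rewrite (bigD1_seq v) ?undup_uniq //= eqxx mulr1 big1 ?addr0 // => u ne.
  by rewrite eq_sym (negbTE ne) mulr0.
rewrite big_seq big1 => [|u hu]; last first.
  case: eqP => [eu|_]; last by rewrite mulr0.
  by rewrite -eu (negbTE hv) in hu.
rewrite e (big_morph _ ap (erefl : (0 : W) v = 0)) big_seq big1 // => p hp.
rewrite -[LHS]/(p.1 * (v == p.2)%:R); case: eqP => [ep|_]; rewrite ?mulr0 //.
by move: hv; rewrite mem_undup ep (map_f snd hp).
Qed.

Lemma low_fin m phi : low pw piWh (delta w0) m phi -> finS phi.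
Proof.
elim=> {m phi} [|m|m c f g _ hf _ hg|a b m f _ _ hf].
- by apply: finS_delta; exact: inS_w0 pw_inj sep dom.
- exact: finS0.
- by apply: finSD => //; exact: finSZ.
- exact: piW_fin.
Qed.

Section WithModule.
Variables (V : lmodType C) (piV : M -> V -> V) (v0 : V).
Hypotheses (glV : glmod piV) (simpleV : simple_gmodule piV) (v00 : v0 != 0).
Hypothesis hwV : hwv pw piV chiW v0.

Local Notation rel := (rel pw piV piWh v0 (delta w0)).

Lemma tab_inj x : rel x 0 -> x = 0.
Proof.
apply: (rel_inj pw_inj_ord glV glWh hwV hwWh simpleV v00 (ev := fun f : W => f w0)) => //.
  by rewrite /delta eqxx.
move=> m y /(congr1 (fun f : W => f w0)); rewrite h0_piWh; last exact: inS_w0 pw_inj sep dom.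
rewrite -[RHS]/((c0 pw chiW + m.+1%:R) * y w0) /ht subrr addr0 => /eqP.
rewrite -subr_eq0 -mulrBl opprD addrA subrr sub0r mulNr oppr_eq0 mulf_eq0 pnatr_eq0 /=.
by move/eqP.
Qed.

Lemma tab_exists x : exists y, rel x y.
Proof. exact: (rel_exists pw_inj_ord glV glWh hwV hwWh simpleV v00). Qed.

Lemma rel_fin x y : rel x y -> finS y.
Proof.
move=> /rel_graded[K [g [hg _ ->]]]; apply: finS_sum => m _.
by have [_ h] := low_pair (hg m); exact: low_fin h.
Qed.

Hypothesis gen : forall v, inS v -> exists x, rel x (delta v).
Hypothesis inj2 : forall phi, rel 0 phi -> phi = 0.

(** Together with [tab_exists] and [tab_inj], the hypotheses [gen] and [inj2] make the relation a
    bijection between [V] and the finite combinations of tableaux, so the tableaux pull back to a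
    basis of [V]. *)
Lemma strongly_tame_of_basis : strongly_tame_GT piV.
Proof.
have /choice[T0 hT0] : forall v, exists x, inS v -> rel x (delta v).
  move=> v; have [iv|nv] := pselect (inS v); first by have [x hx] := gen iv; exists x.
  by exists 0 => iv; case: nv.
pose T v := if `[< inS v >] then T0 v else 0.
have hT v : inS v -> rel (T v) (delta v) by move=> iv; rewrite /T asboolT //; exact: hT0.
have T_out v : ~ inS v -> T v = 0 by move=> nv; rewrite /T asboolF.
have relC x y y' : rel x y -> y = y' -> rel x y' by move=> h <-.
have uniq_x x x' y : rel x y -> rel x' y -> x = x'.
  by move=> h h'; apply/eqP; rewrite -subr_eq0; apply/eqP/tab_inj; rewrite -(subrr y); exact: relB.
have T_sum s k v : inS v -> (k < n)%N ->
   rel (\sum_(i < k.+1) tc (s, k, i : nat) v *: T (mv (s, k, i : nat) v)) (op s k (delta v)).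
  move=> iv hk; rewrite op_delta //; apply: rel_sum => i _.
  have [im|nm] := pselect (inS (mv (s, k, i : nat) v)); first by apply: relZ; exact: hT.
  by rewrite tc_supp ?scale0r; [exact: rel00|case].
(* The formulas to be proved carry the untruncated coefficient. It may be nonzero for a target
   outside S, where [T] is 0, and denominators do not vanish on S. *)
have tcT s k v (i : 'I_k.+1) : inS v -> (k < n)%N -> tc (s, k, i : nat) v *: T (mv (s, k, i : nat) v) =
    (if gt_den v k i != 0 then fc (s, k, i : nat) v *: T (mv (s, k, i : nat) v) else 0).
  move=> iv hk; rewrite (gt_den_neq0 pw_inj sep iv hk) ?ord_le // -?ltnS //.
  have [im|nm] := pselect (inS (mv (s, k, i : nat) v)); first by rewrite /tc !asboolT.
  by rewrite T_out // !scaler0.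
exists inS, T; split.
- by move=> v [[h _ _] _].
- exact: T_out.
- move=> s c us hs e v hv.
  have h : rel (\sum_(v <- s) c v *: T v) (\sum_(v <- s) c v *: delta v).
    by rewrite big_seq [X in rel _ X]big_seq; apply: rel_sum => u hu; apply: relZ; apply: hT; exact: hs.
  rewrite e in h; have /(congr1 (fun f : W => f v)) := inj2 h.
  have ap : {morph (fun f : W => f v) : f g / f + g} by [].
  rewrite (big_morph _ ap (erefl : (0 : W) v = 0)) (bigD1_seq v) //= big1 ?addr0.
    by rewrite -[X in X = _]/(c v * delta v v) /delta eqxx mulr1.
  by move=> u ne; rewrite -[LHS]/(c u * (v == u)%:R) eq_sym (negbTE ne) mulr0.
- move=> x; have [y hy] := tab_exists x; have [s [us hs e]] := finS_eval (rel_fin hy).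
  exists s, y; split=> //; apply: uniq_x hy _; rewrite {2}e.
  by rewrite big_seq [X in rel _ X]big_seq; apply: rel_sum => u hu; apply: relZ; apply: hT; exact: hs.
move=> v iv k; have hk := ltn_ord k.
have sle : in_sl (ech C n k) by apply: delta_sl; rewrite -val_eqE /= !inordK; lia.
have slf : in_sl (fch C n k) by apply: delta_sl; rewrite -val_eqE /= !inordK; lia.
have act x : rel (piV x (T v)) (piWh x (delta v)) by apply: (rel_act pw_inj_ord glV glWh hwV hwWh); exact: hT.
split.
- apply: uniq_x (act _) _; rewrite /piWh hat_id // piW_ech // -scaleN1r -[X in rel _ X]scaleN1r.
  apply: relZ; have := T_sum true k v iv hk.
  by rewrite (eq_bigr _ (fun i _ => tcT true k v i iv hk)).
- apply: uniq_x (act _) _; rewrite /piWh hat_id // piW_fch //.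
  have := T_sum false k v iv hk.
  by rewrite (eq_bigr _ (fun i _ => tcT false k v i iv hk)).
- have slh : in_sl (hch C n k).
    by rewrite /in_sl /hch /Emx raddfB /= !tr_delta subrr.
  apply: uniq_x (act _) _; rewrite /piWh hat_id //.
  have -> : piW (hch C n k) (delta v) = (wt k v - wt k.+1 v) *: delta v.
    rewrite /hch /Emx -scaleN1r addrC (piW_linear_l pw l) scaleN1r addrC.
    apply/funext => u; rewrite -[LHS]/(piW _ (delta v) u - piW _ (delta v) u) -[RHS]/(_ * delta v u).
    have [iu|nu] := pselect (inS u).
      rewrite !piW_Eaa // !inordK; try lia.
      by rewrite /delta; case: eqP => [->|_]; rewrite ?mulr0 ?subrr // !mulr1.
    rewrite !(piW_supp _ _ nu) subrr /delta; case: eqP => [e|_]; rewrite ?mulr0 //.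
    by case: nu; rewrite e.
  have -> : wt k v - wt k.+1 v = 2%:R * \sum_(i < k.+1) ent v k i - \sum_(i < k) ent v k.-1 i
                - \sum_(i < k.+2) ent v k.+1 i - 1.
    by rewrite /wt /= -[k.+1%:R]natr1; ring.
  by apply: relZ; exact: hT.
Qed.
End WithModule.
End Realization.

(** * The basis theorem in the nonintegral case *)

Section StandardOrder.
Variables (C : numClosedFieldType) (n : nat).
Local Notation arr := (GTarr C n).
Local Notation M := 'M[C]_n.+1.
Implicit Types (v z : arr) (s : bool).
Variables (pw : nat -> nat) (l : nat -> C).
Hypothesis pw_inj : forall i j, (i <= n)%N -> (j <= n)%N -> pw i = pw j -> i = j.
Hypothesis sep : forall k i j, (k < n)%N -> (i <= k)%N -> (j <= k)%N ->
  (pw i < pw k.+1)%N -> (pw k.+1 < pw j)%N -> ~ isZ (l i - l j).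
Hypothesis dom : forall i j, (i <= n)%N -> (j <= n)%N -> (pw i < pw j)%N ->
  forall z : int, l i - l j = z%:~R -> 0 < z.
Local Notation inS := (@inS C n pw l).
Local Notation tc := (@tc C n pw l).
Local Notation W := (arr -> C^o).
Local Notation op := (@op C n pw l).
Local Notation piW := (@piW C n pw l).
Local Notation piWh := (@piWh C n pw l).
Local Notation chiW := (@chiW C n pw l).
Local Notation w0 := (w0arr n pw l).
Local Notation delta := (@delta C n).
Local Notation ht := (@ht C n pw l).
Local Notation glWh := (glWh pw_inj sep).
Local Notation hwWh := (hwWh pw_inj sep dom).
Local Notation low_fin := (low_fin pw_inj sep dom).
Local Notation h0_piWh := (h0_piWh pw_inj sep dom).
Local Notation pw_inj_ord := (@pw_inj_ord n pw pw_inj).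

Variables (V : lmodType C) (piV : M -> V -> V) (v0 : V).
Hypotheses (glV : glmod piV) (simpleV : simple_gmodule piV) (v00 : v0 != 0).
Hypothesis hwV : hwv pw piV chiW v0.
Local Notation rel := (rel pw piV piWh v0 (delta w0)).
Local Notation lowp := (low pw (pip piV piWh) (v0, delta w0)).

Lemma ap_morph v : {morph (fun f : W => f v) : f g / f + g}. Proof. by []. Qed.
Lemma sum_app I (r : seq I) (P : pred I) (F : I -> W) v :
  (\sum_(i <- r | P i) F i) v = \sum_(i <- r | P i) F i v.
Proof. exact: (big_morph _ (ap_morph v) (erefl : (0 : W) v = 0)). Qed.

Lemma low_ht m (phi : W) v : low pw piWh (delta w0) m phi -> phi v != 0 -> inS v /\ ht v = m%:R.
Proof.
move=> hl hv; have iv : inS v.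
  by apply: contrapT => nv; move: hv; rewrite (finS_supp (low_fin hl)) ?eqxx.
split=> //; have := low_eig glWh hwWh hl => /(congr1 (fun f : W => f v)).
rewrite h0_piWh // -[RHS]/(_ * phi v) => /(mulIf hv) /addrI //.
Qed.

Lemma ht_w0 : ht w0 = 0. Proof. by rewrite /ht subrr. Qed.

Hypothesis std : forall i j, (i < j)%N -> (j <= n)%N -> (pw i < pw j)%N.

Lemma top_w0 v : inS v -> (forall k i, (k <= n)%N -> (i <= k)%N -> ent v k i = ent v n i) -> v = w0.
Proof.
move=> [lv _] h; apply: (arr_ext lv (proj1 (inS_w0 pw_inj sep dom))) => k i hk hi.
have hn : (i <= n)%N by lia.
rewrite h // ent_w0 //; have [_ -> //] := lv.
rewrite /nbef big_pred0 ?addr0 // => j; apply/negbTE; rewrite negb_and -!leqNgt.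
case: (leqP j k) => //= kj; apply: ltnW; apply: std; last exact: ord_le.
exact: leq_ltn_trans hi kj.
Qed.

(** Strong induction on the height: the raising operators send [psi] to vectors that are related to
    0 and have smaller height, hence vanish. So [psi] is singular and supported at [w0], which has
    height 0, and there the pair is a multiple of the generator with first component 0. *)
Lemma low_kernel m psi : lowp m (0, psi) -> psi = 0.
Proof.
have [m'] := ubnP m; elim: m' m psi => // m' IH m psi mm' hl.
have [_ hl2] := low_pair hl; apply: contrapT => nz.
have sl k : (k < n)%N -> in_sl (ech C n k).
  by move=> hk; apply: delta_sl; rewrite -val_eqE /= !inordK; lia.
have kill k : (k < n)%N -> op true k psi = 0.
  move=> hk; suff e0 : piWh (ech C n k) psi = 0.
    by apply/eqP; rewrite -oppr_eq0 -piW_ech // -(hat_id (sl k hk)); apply/eqP.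
  have rl : rel 0 (piWh (ech C n k) psi).
    by have := rel_act pw_inj_ord glV glWh hwV hwWh (ech C n k) (low_rel hl); rewrite /= (pi0 glV).
  have [K [g [hg e1 e2]]] := rel_graded rl.
  have g1 j : (j < K)%N -> (g j).1 = 0.
    by move=> jK; apply: (low_sum_zero glV hwV hg (esym e1)).
  apply/funext => v; rewrite -[RHS]/(0 : C).
  apply: contrapT => /eqP nzv.
  have iv : inS v by apply: contrapT => nv; move: nzv; rewrite /piWh piW_supp ?eqxx.
  have hv : ht v = m%:R - ((pw k.+1)%:R - (pw k)%:R).
    have := pi_lbr glWh (h0 C n pw) (ech C n k) psi.
    rewrite (low_eig glWh hwWh hl2) (piZ glWh) /ech /Emx lbr_h0 (piZl glWh) -scalerDl.
    move=> /(congr1 (fun f : W => f v)); rewrite h0_piWh // -[RHS]/(_ * _ v) => /(mulIf nzv).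
    rewrite -addrA => /addrI ->; rewrite !inordK; try lia.
    by rewrite opprB.
  have lt : (pw k < pw k.+1)%N by exact: std.
  move: nzv; rewrite e2 sum_app big1 ?eqxx // => j _.
  have [jm|mj] := ltnP j m.
    rewrite (IH j (g j).2) //; first by lia.
    by rewrite -(g1 j) // -surjective_pairing.
  (* A component of height at least [m] cannot meet [v], whose height is [m] minus a positive
     number. *)
  apply: contrapT => /eqP nzj; have [_ hgj] := low_pair (hg j).
  have [_] := low_ht hgj nzj; rewrite hv => /eqP.
  rewrite subr_eq -natrB ?(ltnW lt) // -natrD eqr_nat; lia.
have supp := finS_supp (low_fin hl2).
have isw0 v : psi v != 0 -> v = w0.
  move=> hv; have [iv _] := low_ht hl2 hv; apply: top_w0 => // k i hk hi.
  exact: (singular pw_inj sep dom (leqnn n) std supp kill hv).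
have [v hv] : exists v, psi v != 0.
  apply: contrapT => h; apply: nz; apply/funext => v; apply: contrapT => /eqP hv; apply: h.
  by exists v.
have [_] := low_ht hl2 hv; rewrite (isw0 v hv) ht_w0 => /esym/eqP; rewrite pnatr_eq0 => /eqP m0.
have [c] := low0 hl m0 => e; have := congr1 fst e; have := congr1 snd e => /= e2 /esym/eqP.
by rewrite scaler_eq0 (negbTE v00) orbF => /eqP c0; apply: nz; rewrite e2 c0 scale0r.
Qed.

Lemma inj2_std phi : rel 0 phi -> phi = 0.
Proof.
move=> /rel_graded[K [g [hg e1 ->]]]; apply: big1 => i _.
apply: (@low_kernel i); rewrite -(low_sum_zero glV hwV hg (esym e1) (ltn_ord i)).
by rewrite -surjective_pairing.
Qed.

(** Induction on the height and, inside it, on the lowest row above which a column step occurs.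
    Raising the entry below that step gives a tableau [u] of smaller height, already reached.
    Applying [f_r] to [u] returns the wanted tableau with nonzero coefficient, and the other terms
    have a step further down by [swap_not_top]. *)
Lemma gen_std v : inS v -> exists x, rel x (delta v).
Proof.
move=> iv; have [h hh] := ht_nat pw_inj sep dom iv.
have [h'] := ubnP h; elim: h' h v iv hh => // h' IHh h v iv hh hlt.
suff nontop r : (r <= n)%N -> forall z, inS z -> ht z = h%:R ->
    (exists k i, [/\ (k <= r)%N, (i <= k)%N & ent z k i <> ent z r i]) -> exists x, rel x (delta z).
  have [e|ne] := pselect (forall k i, (k <= n)%N -> (i <= k)%N -> ent v k i = ent v n i).
    by exists v0; rewrite (top_w0 iv e); exact: rel0.
  apply: (nontop n) => //; apply: contrapT => ne'; apply: ne => k i hk hi.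
  by apply: contrapT => ne; apply: ne'; exists k, i.
elim: r => [|r IHr] hr z iz hz [k [i [hk hi ne]]].
  by move: hk hi ne; rewrite leqn0 => /eqP ->; rewrite leqn0 => /eqP ->.
have [nt|tp] := pselect (exists k i, [/\ (k <= r)%N, (i <= k)%N & ent z k i <> ent z r i]).
  by apply: IHr => //; exact: ltnW.
have {}tp a b : (a <= r)%N -> (b <= a)%N -> ent z a b = ent z r b.
  by move=> ha hb; apply: contrapT => ne'; apply: tp; exists a, b.
have kr : (k <= r)%N by move: hk ne; rewrite leq_eqVlt => /orP[/eqP ->|//]; case.
have hj : (i <= r)%N by lia.
have ne' : ent z r i <> ent z r.+1 i by rewrite -(tp k).
have std' : forall a b, (a < b)%N -> (b <= r.+1)%N -> (pw a < pw b)%N by move=> a b ab hb; apply: std => //; lia.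
have tp' q : (q < r)%N -> ent z r.-1 q = ent z r q by move=> hq; apply: tp; lia.
have [h1 h2 iu] := raise_ok pw_inj sep dom hr std' iz hj ne' tp'.
set m : move := (true, r, i) in h2 iu; set u := mv m z in h2 iu.
have hltr : (pw r < pw r.+1)%N by apply: std.
have hu : ht u = h%:R - ((pw r.+1)%:R - (pw r)%:R).
  by rewrite /u /m ht_mv // hz /= mul1r opprB.
have [h2n hh2] := ht_nat pw_inj sep dom iu.
have h2lt : (h2n < h)%N.
  move/eqP: hu; rewrite hh2 eq_sym subr_eq -natrB ?(ltnW hltr) // -natrD eqr_nat; lia.
have [xu hxu] : exists x, rel x (delta u) by apply: (IHh h2n u) => //; lia.
have okm1 : okm n (false, r, i) by apply/andP.
have back : mv (false, r, i) u = z by rewrite /u /m; exact: shiftK.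
have tcn : tc (false, r, i) u != 0.
  rewrite /tc !asboolT ?back //= /fc mulf_neq0 // invr_eq0.
  exact: (gt_den_neq0 pw_inj sep iu hr hj).
have rf : rel (piV (fch C n r) xu) (op false r (delta u)).
  rewrite -piW_fch //; have sl : in_sl (fch C n r) by apply: delta_sl; rewrite -val_eqE /= !inordK; lia.
  by rewrite -{2}(hat_id sl); exact: (rel_act pw_inj_ord glV glWh hwV hwWh).
have others (i' : 'I_r.+1) : i' != i :> nat -> exists x, rel x (tc (false, r, i' : nat) u *: delta (mv (false, r, i' : nat) u)).
  move=> ni; have [iz2|nz2] := pselect (inS (mv (false, r, i' : nat) u)); last first.
    by exists 0; rewrite tc_supp ?scale0r; [exact: rel00|case].
  have hi' : (i' <= r)%N by rewrite -ltnS.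
  have [|c hc cne] := swap_not_top hr hj tp' hi'; first exact/eqP.
  have [x hx] : exists x, rel x (delta (mv (false, r, i' : nat) u)).
    apply: IHr => //; first exact: ltnW.
      by rewrite ht_mv // hu /= ; ring.
    exists r.-1, c; split=> //; lia.
  by exists (tc (false, r, i' : nat) u *: x); exact: relZ.
have [y hy] : exists y, rel y (\sum_(i' < r.+1 | i' != Ordinal (hj : (i < r.+1)%N))
     tc (false, r, i' : nat) u *: delta (mv (false, r, i' : nat) u)).
  apply: (big_ind (fun f => exists y, rel y f)).
  - by exists 0; exact: rel00.
  - by move=> f g [a ha] [b hb]; exists (a + b); exact: relD.
  - by move=> i' ni; apply: others; rewrite -val_eqE in ni.
exists ((tc (false, r, i) u)^-1 *: (piV (fch C n r) xu - y)).
have -> : delta z = (tc (false, r, i) u)^-1 *: (op false r (delta u) -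
    \sum_(i' < r.+1 | i' != Ordinal (hj : (i < r.+1)%N)) tc (false, r, i' : nat) u *: delta (mv (false, r, i' : nat) u)).
  rewrite op_delta // (bigD1 (Ordinal (hj : (i < r.+1)%N))) //= addrK back scalerA mulVf ?scale1r //.
by apply: relZ; apply: relB.
Qed.
End StandardOrder.

(** * Tableaux of given height and PBW exponents *)

Section Codes.
Variables (C : numClosedFieldType) (n : nat).
Local Notation arr := (GTarr C n).
Local Notation I := 'I_n.+1.

Lemma sum_sym_pairs N (F : nat -> nat -> nat) : (forall a b, F a b = F b a) -> (forall a, F a a = 0%N) ->
  (\sum_(a < N) \sum_(b < N) F a b = (\sum_(k < N.-1) \sum_(i < k.+1) F i k.+1).*2)%N.
Proof.
move=> sF F0; case: N => [|N]; first by rewrite !big_ord0.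
elim: N => [|N IH]; first by rewrite !big_ord_recl !big_ord0 /= F0.
rewrite big_ord_recr /= [X in (_ + X)%N]big_ord_recr /= F0 addn0.
under eq_bigr => a _ do rewrite big_ord_recr /=.
rewrite big_split /= IH [in RHS]big_ord_recr /= doubleD -addnA; congr (_ + _)%N.
by rewrite -addnn; congr (_ + _)%N; apply: eq_bigr => a _; rewrite sF.
Qed.

Definition dist (a b : nat) := ((a - b) + (b - a))%N.

(* A code lists, for the positive roots eps_a - eps_b, the exponents of a PBW monomial (stored
   symmetrically in a and b), and its weight is twice the height of this monomial. *)
Definition cwt (D : nat -> nat -> nat) := (\sum_(a < n.+1) \sum_(b < n.+1) dist a b * D a b)%N.

Section Pos.
Variables (w : 'S_n.+1) (pw : nat -> nat) (l : nat -> C).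
Hypothesis pwE : forall i, (i <= n)%N -> pw i = w (inord i).
Hypothesis nint : forall i j, (i <= n)%N -> (j <= n)%N -> i <> j -> ~ isZ (l i - l j).

Lemma perm_pw_inj i j : (i <= n)%N -> (j <= n)%N -> pw i = pw j -> i = j.
Proof.
move=> hi hj; rewrite !pwE // => /ord_inj/perm_inj/(congr1 val) /=.
by rewrite !inordK.
Qed.
Local Notation pw_inj := perm_pw_inj.

Lemma nint_sep k i j : (k < n)%N -> (i <= k)%N -> (j <= k)%N ->
  (pw i < pw k.+1)%N -> (pw k.+1 < pw j)%N -> ~ isZ (l i - l j).
Proof.
by move=> hk hi hj h1 h2; apply: nint; [lia|lia|move=> e; move: h1; rewrite e; lia].
Qed.
Local Notation sep := nint_sep.

Lemma nint_dom i j : (i <= n)%N -> (j <= n)%N -> (pw i < pw j)%N ->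
  forall z : int, l i - l j = z%:~R -> 0 < z.
Proof.
move=> hi hj h z e; exfalso; apply: (nint hi hj); last by exists z.
by move=> eij; move: h; rewrite eij ltnn.
Qed.
Local Notation dom := nint_dom.
Local Notation inS := (@inS C n pw l).
Local Notation ht := (@ht C n pw l).

(** The column step with the exponent of the root joining the ranks of [i] and [k+1], in the form
    given by [inS_diff]. Exponents are indexed by ranks and not by positions, so one code describes
    a tableau for every order. *)
Definition stp (D : nat -> nat -> nat) k i : C :=
  if (pw k.+1 < pw i)%N then 1 + (D (pw i) (pw k.+1))%:R else - (D (pw i) (pw k.+1))%:R.

Definition tab D : arr := [ffun p : I * I =>
  if (p.2 <= p.1)%N then l p.2 + \sum_(k < n | (p.1 <= k)%N) stp D k p.2 else 0].

Lemma ent_tab D k i : (k <= n)%N -> (i <= k)%N ->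
  ent (tab D) k i = l i + \sum_(k' < n | (k <= k')%N) stp D k' i.
Proof. by move=> hk hi; rewrite /ent ffunE /= !inordK ?hi //; lia. Qed.

Lemma tab_step D k i : (k < n)%N -> (i <= k)%N -> ent (tab D) k i - ent (tab D) k.+1 i = stp D k i.
Proof.
move=> hk hi; rewrite !ent_tab; try lia.
rewrite (bigD1 (Ordinal hk)) //= (eq_bigl (fun k' : 'I_n => (k < k')%N)); first by ring.
by move=> k'; rewrite -val_eqE /=; lia.
Qed.

Lemma stp_isZ D k i : isZ (stp D k i).
Proof.
rewrite /stp; case: ifP => _.
  by exists (1 + (D (pw i) (pw k.+1))%:Z); rewrite rmorphD.
by exists (- (D (pw i) (pw k.+1))%:Z); rewrite rmorphN.
Qed.

Lemma lattice_tab D : lattice l (tab D).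
Proof.
split.
- by move=> a b ab; rewrite ffunE /= leqNgt ab.
- by move=> i hi; rewrite ent_tab // big_pred0 ?addr0 // => k; rewrite leqNgt ltn_ord.
- move=> k i hk hi; rewrite ent_tab // addrAC subrr add0r.
  by apply: (big_ind (@isZ C)); [exact: isZ0|exact: isZD|move=> k' _; exact: stp_isZ].
Qed.

(** Without integral differences only the sign conditions with [i = j] remain, and these constrain
    each column step separately. *)
Lemma inS_tab D : inS (tab D).
Proof.
split; first exact: lattice_tab.
move=> k i j hk hi hj z hz.
have [e|ne] := pselect (i = j); last first.
  case: (nint _ _ ne); [lia|lia|].
  have [_ _ h] := lattice_tab D.
  have -> : l i - l j = (ent (tab D) k i - ent (tab D) k.+1 j) - (ent (tab D) k i - l i) + (ent (tab D) k.+1 j - l j) by ring.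
  apply: isZD; [apply: isZB|]; [by exists z|apply: h; lia|apply: h; lia].
rewrite -e in hz; move: hz; rewrite tab_step // /stp /cbit -e eqxx ltnn /=.
case: ifP => _.
  by move=> h; have : z = 1 + (D (pw i) (pw k.+1))%:Z; [apply: (@intC_inj C); rewrite -h rmorphD|lia].
by move=> h; have : z = - (D (pw i) (pw k.+1))%:Z; [apply: (@intC_inj C); rewrite -h rmorphN|lia].
Qed.

Lemma cwt_pos D : (forall a b, D a b = D b a) -> (forall a, D a a = 0%N) ->
  cwt D = (\sum_(k < n) \sum_(i < k.+1) dist (pw i) (pw k.+1) * D (pw i) (pw k.+1)).*2%N.
Proof.
move=> sD D0; rewrite -(@sum_sym_pairs n.+1 (fun i j => dist (pw i) (pw j) * D (pw i) (pw j))%N).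
- rewrite /cwt (reindex_inj (@perm_inj _ w)); apply: eq_bigr => a _.
  rewrite (reindex_inj (@perm_inj _ w)); apply: eq_bigr => b _.
  by rewrite !pwE ?ord_le // !inord_val.
- by move=> a b; rewrite sD /dist addnC.
- by move=> a; rewrite D0 muln0.
Qed.

Lemma ht_tab D m : (forall a b, D a b = D b a) -> (forall a, D a a = 0%N) ->
  ht (tab D) = m%:R <-> cwt D = m.*2.
Proof.
move=> sD D0; rewrite (cwt_pos sD D0).
have -> : ht (tab D) = (\sum_(k < n) \sum_(i < k.+1) dist (pw i) (pw k.+1) * D (pw i) (pw k.+1))%N%:R.
  rewrite /ht (wt_diff pw_inj sep dom (fun a => (pw a)%:R) (lattice_tab D)) natr_sum; apply: eq_bigr => k _.
  rewrite natr_sum; apply: eq_bigr => i _; have hi : (i <= k)%N by rewrite -ltnS.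
  rewrite tab_step // /stp /dist; case: ltnP => h /=.
    rewrite (_ : (pw i - pw k.+1 + (pw k.+1 - pw i))%N = (pw i - pw k.+1)%N); last by lia.
    by rewrite natrM natrB ?(ltnW h) //; ring.
  rewrite (_ : (pw i - pw k.+1 + (pw k.+1 - pw i))%N = (pw k.+1 - pw i)%N); last by lia.
  by rewrite natrM natrB //; ring.
split=> [/eqP|/double_inj ->] //; by rewrite eqr_nat => /eqP ->.
Qed.

Lemma rows_ext (v z : arr) : lattice l v -> lattice l z ->
  (forall k i, (k < n)%N -> (i <= k)%N -> ent v k i - ent v k.+1 i = ent z k i - ent z k.+1 i) -> v = z.
Proof.
move=> lv lz h; apply: (arr_ext lv lz) => k i hk hi.
have [[_ tv _] [_ tz _]] := (lv, lz).
have [j hj] : exists j, (j = n - k)%N by exists (n - k)%N.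
elim: j k hk hi hj => [|j IH] k hk hi hj.
  have -> : k = n by lia.
  by rewrite tv ?tz //; lia.
have hk' : (k < n)%N by lia.
by rewrite -(subrK (ent v k.+1 i) (ent v k i)) h // (IH k.+1) ?subrK //; lia.
Qed.

(** Off the diagonal each exponent is counted twice with distance at least 1, so the bound [m] on
    exponents loses nothing and codes form a finite type. *)
Definition is_code m (d : {ffun I * I -> 'I_m.+1}) :=
  [&& [forall a : I, forall b : I, d (a, b) == d (b, a)], [forall a : I, d (a, a) == ord0] &
      (\sum_(a < n.+1) \sum_(b < n.+1) dist a b * d (a, b) == m.*2)%N].
Definition code m := {d : {ffun I * I -> 'I_m.+1} | is_code d}.

Definition cfun m (d : code m) (a b : nat) : nat := sval d (inord a, inord b).

Lemma cfunC m (d : code m) a b : cfun d a b = cfun d b a.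
Proof.
by rewrite /cfun; have /and3P[/forallP/(_ (inord a))/forallP/(_ (inord b))/eqP -> _ _] := svalP d.
Qed.
Lemma cfun0 m (d : code m) a : cfun d a a = 0%N.
Proof. by rewrite /cfun; have /and3P[_ /forallP/(_ (inord a))/eqP -> _] := svalP d. Qed.
Lemma cfun_wt m (d : code m) : cwt (cfun d) = m.*2.
Proof.
have /and3P[_ _ /eqP <-] := svalP d; apply: eq_bigr => a _; apply: eq_bigr => b _.
by rewrite /cfun !inord_val.
Qed.

Lemma tab_ht m (d : code m) : ht (tab (cfun d)) = m%:R.
Proof. apply/ht_tab; [exact: cfunC|exact: cfun0|exact: cfun_wt]. Qed.

Lemma tab_cfun_inj m (d d' : code m) : tab (cfun d) = tab (cfun d') -> d = d'.
Proof.
move=> e; apply/val_inj/ffunP => -[a b]; apply: ord_inj.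
suff main x y : (x < y)%N -> (y <= n)%N -> cfun d (pw x) (pw y) = cfun d' (pw x) (pw y).
  pose x : I := (w^-1)%g a; pose y : I := (w^-1)%g b.
  have := main x y; have := main y x; rewrite [cfun d (pw y) _]cfunC [cfun d' (pw y) _]cfunC.
  rewrite !pwE ?ord_le // /cfun !inord_val /x /y !permKV => h1 h2.
  case: (ltngtP ((w^-1)%g a) ((w^-1)%g b)) => h; [by apply: h2; rewrite ?ord_le|by apply: h1; rewrite ?ord_le|].
  have -> : a = b by apply: (@perm_inj _ (w^-1)%g); exact: ord_inj.
  by have := cfun0 d b; have := cfun0 d' b; rewrite /cfun !inord_val => -> ->.
case: y => // y; rewrite ltnS => xy yn.
have := congr1 (fun v => ent v y x - ent v y.+1 x) e; rewrite /= !tab_step // /stp.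
case: ifP => _.
  by move/addrI/eqP; rewrite eqr_nat => /eqP.
by move/oppr_inj/eqP; rewrite eqr_nat => /eqP.
Qed.

Lemma tab_cfun_surj m (v : arr) : inS v -> ht v = m%:R -> exists d : code m, v = tab (cfun d).
Proof.
move=> iv hv.
have /choice[dk hdk] : forall k, exists f : nat -> nat, forall i, (k < n)%N -> (i <= k)%N ->
    ent v k i - ent v k.+1 i = (if (pw k.+1 < pw i)%N then 1 + (f i)%:R else - (f i)%:R).
  move=> k; suff /choice[f hf] : forall i, exists t : nat, (k < n)%N -> (i <= k)%N ->
    ent v k i - ent v k.+1 i = (if (pw k.+1 < pw i)%N then 1 + t%:R else - t%:R) by exists f.
  move=> i; case: (ltnP k n) => hk; last by exists 0%N.
  case: (leqP i k) => hi; last by exists 0%N.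
  by have [t ht] := inS_diff iv hk hi; exists t.
(* For positions [x < y] the exponent is read off the step between rows [y-1] and [y] in column [x];
   [D] then re-indexes by ranks. *)
pose P x y := if (x < y)%N then dk y.-1 x else if (y < x)%N then dk x.-1 y else 0%N.
pose D a b := P ((w^-1)%g (inord a)) ((w^-1)%g (inord b)).
have sD a b : D a b = D b a by rewrite /D /P; case: ltngtP.
have D0 a : D a a = 0%N by rewrite /D /P ltnn.
have vE : v = tab D.
  apply: (rows_ext (proj1 iv) (lattice_tab D)) => k i hk hi.
  rewrite tab_step // hdk // /stp /D !pwE; try lia.
  rewrite !inord_val !permK !inordK; try lia.
  by rewrite /P ltnS hi.
have cD : cwt D = m.*2 by apply/ht_tab => //; rewrite -vE.
have bD a b : (a <= n)%N -> (b <= n)%N -> (D a b <= m)%N.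
  move=> ha hb; have [->|ab] := eqVneq a b; first by rewrite D0.
  have : ((dist a b * D a b).*2 <= cwt D)%N.
    rewrite /cwt (bigD1 (inord a)) //= (bigD1 (inord b)) //= inordK // inordK //.
    rewrite [X in (_ <= _ + X)%N](bigD1 (inord b)) ?inord_eq //=; last by rewrite eq_sym.
    rewrite inordK // [X in (_ <= _ + (X + _))%N](bigD1 (inord a)) //= inordK // [D b a]sD.
    by rewrite /dist; lia.
  by rewrite cD leq_double; apply: leq_trans; rewrite leq_pmull // /dist; lia.
have dP : is_code [ffun p : I * I => inord (D p.1 p.2) : 'I_m.+1].
  apply/and3P; split.
  - by apply/forallP => a; apply/forallP => b; rewrite !ffunE /= sD.
  - by apply/forallP => a; rewrite !ffunE /= D0; apply/eqP/val_inj; rewrite /= inordK.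
  - apply/eqP; rewrite -cD; apply: eq_bigr => a _; apply: eq_bigr => b _.
    by rewrite ffunE /= inordK // ltnS bD ?ord_le.
exists (exist (@is_code m) _ dP); rewrite {1}vE; apply: (rows_ext (lattice_tab _) (lattice_tab _)) => k i hk hi.
have pn j : (j <= n)%N -> (pw j <= n)%N by move=> hj; rewrite pwE // ord_le.
have e : cfun (exist (@is_code m) _ dP : code m) (pw i) (pw k.+1) = D (pw i) (pw k.+1).
  rewrite /cfun /= ffunE /= !inordK ?ltnS ?pn ?bD ?pn //; lia.
by rewrite !tab_step // /stp e.
Qed.
End Pos.
End Codes.

(** * Homogeneous components of the correspondence *)

Section Homogeneous.
Variables (C : numClosedFieldType) (n : nat) (pw : nat -> nat).
Local Notation M := 'M[C]_n.+1.
Variables (V W : lmodType C) (piV : M -> V -> V) (piW : M -> W -> W).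
Variables (chi : 'I_n.+1 -> C) (v0 : V) (w0 : W).
Hypotheses (glV : glmod piV) (hwV : hwv pw piV chi v0).

(** The components of a related pair in the various heights are related separately. An eigenvector
    [x] is its own component of height [m]; only the second member of the pair has to be replaced by
    its component. *)
Lemma low_of_eig m x y : rel pw piV piW v0 w0 x y -> piV (h0 C n pw) x = (c0 pw chi + m%:R) *: x ->
  exists y', low pw (pip piV piW) (v0, w0) m (x, y').
Proof.
move=> /rel_graded[K [g [hg ex _]]] hx.
pose f k := (if (k < K)%N then (g k).1 else 0) - (if k == m then x else 0).
have [lV _ _] := glV.
have := @eig_indep C _ (piV (h0 C n pw)) (c0 pw chi) f (K + m).+1 (lV _) _ _ m.
rewrite /f eqxx => /(_ _ _ _)/eqP; rewrite subr_eq0 => H.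
suff /eqP e : (if (m < K)%N then (g m).1 else 0) == x.
  move: e; case: ifP => mK e; last by exists 0; rewrite -e; exact: low_zero.
  by exists (g m).2; rewrite -e -surjective_pairing.
apply: H; last by lia.
- move=> k; rewrite -scaleN1r (piD glV) (piZ glV) scalerDr; congr (_ + _).
    by case: ifP => _; [apply: (low_eig glV hwV); case: (low_pair (hg k))|rewrite (pi0 glV) scaler0].
  rewrite [RHS]scalerA mulrC -scalerA; congr (_ *: _).
  by case: eqP => [->|_]; rewrite ?hx // (pi0 glV) scaler0.
- rewrite sumrB; apply/eqP; rewrite subr_eq0; apply/eqP.
  have hm : (m < (K + m).+1)%N by lia.
  rewrite [RHS](bigD1 (Ordinal hm)) //= eqxx [X in _ = _ + X]big1 ?addr0; last first.
    by move=> i; rewrite -val_eqE /= => /negbTE ->.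
  rewrite ex -addnS big_split_ord /= [X in _ + X]big1 ?addr0 => [|i _]; last by rewrite ifN // -leqNgt leq_addr.
  by apply: eq_bigr => i _; rewrite ltn_ord.
Qed.
End Homogeneous.

(** * Transfer from the standard order to an arbitrary order *)

Section Transfer.
Variables (C : numClosedFieldType) (n : nat).
Local Notation arr := (GTarr C n).
Local Notation M := 'M[C]_n.+1.
Local Notation W := (arr -> C^o).
Variables (V : lmodType C) (v0 : V).
Hypothesis v00 : v0 != 0.
Local Notation idn := (fun i : nat => i).

Variables (l1 : nat -> C) (pi1 : M -> V -> V).
Hypothesis nint1 : forall i j, (i <= n)%N -> (j <= n)%N -> i <> j -> ~ isZ (l1 i - l1 j).
Hypotheses (gl1 : glmod pi1) (simple1 : simple_gmodule pi1).
Hypothesis hw1 : hwv idn pi1 (chiW idn l1) v0.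

Variables (w : 'S_n.+1) (pw : nat -> nat) (l : nat -> C) (piV : M -> V -> V).
Hypothesis pwE : forall i, (i <= n)%N -> pw i = w (inord i).
Hypothesis nint : forall i j, (i <= n)%N -> (j <= n)%N -> i <> j -> ~ isZ (l i - l j).
Hypotheses (glV : glmod piV) (simpleV : simple_gmodule piV).
Hypothesis hwV : hwv pw piV (chiW pw l) v0.
(** Both structures on [V] have the same grading operator, so a vector has the same height for the
    standard order and for [pw]. *)
Hypothesis h0E : forall u, piV (h0 C n pw) u = pi1 (h0 C n idn) u.

Lemma idnE i : (i <= n)%N -> idn i = (1%g : 'S_n.+1) (inord i).
Proof. by move=> hi; rewrite perm1 inordK. Qed.

Let pw_inj := perm_pw_inj pwE.
Let sep := @nint_sep C n pw l nint.
Let dom := @nint_dom C n pw l nint.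
Let pw_inj1 := perm_pw_inj idnE.
Let sep1 := @nint_sep C n idn l1 nint1.
Let dom1 := @nint_dom C n idn l1 nint1.
Local Notation glWh1 := (glWh pw_inj1 sep1).
Local Notation hwWh1 := (hwWh pw_inj1 sep1 dom1).
Local Notation rel1 := (rel idn pi1 (piWh idn l1) v0 (delta (w0arr n idn l1))).
Local Notation glWh := (glWh pw_inj sep).
Local Notation hwWh := (hwWh pw_inj sep dom).
Local Notation rel := (rel pw piV (piWh pw l) v0 (delta (w0arr n pw l))).
Local Notation lowp := (low pw (pip piV (piWh pw l)) (v0, delta (w0arr n pw l))).

Lemma c0_eq : c0 pw (@chiW C n pw l) = c0 idn (@chiW C n idn l1).
Proof.
have := low_eig glV hwV (low_base pw piV v0); rewrite h0E.
rewrite (low_eig gl1 hw1 (low_base idn pi1 v0)) !addr0 => /eqP.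
by rewrite -subr_eq0 -scalerBl scaler_eq0 (negbTE v00) orbF subr_eq0 => /eqP.
Qed.

Section Degree.
Variable m : nat.
Local Notation cd := (code n m).
Local Notation tab1 := (fun d : cd => tab n idn l1 (cfun d)).
Local Notation tabw := (fun d : cd => tab n pw l (cfun d)).

(** The standard order supplies independent vectors of [V], one for each tableau of height [m].
    Being eigenvectors of the common grading operator, they are related to vectors of height [m] in
    the tableau module for [pw]. *)
Lemma code_vectors : exists (x : cd -> V) (y : cd -> W),
  [/\ (forall d, lowp m (x d, y d)) & (forall c : cd -> C, \sum_d c d *: x d = 0 -> forall d, c d = 0)].
Proof.
have /choice[x hx] : forall d : cd, exists x, rel1 x (delta (tab1 d)).
  by move=> d; apply: (gen_std pw_inj1 sep1 dom1 gl1 v00 hw1) => //; exact: (inS_tab _ nint1).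
have /choice[y hy] : forall d : cd, exists y, lowp m (x d, y).
  move=> d; have [z hz] := tab_exists pw_inj sep dom glV simpleV v00 hwV (x d).
  apply: (low_of_eig glV hwV hz); rewrite h0E c0_eq; apply/eqP; rewrite -subr_eq0; apply/eqP.
  apply: (tab_inj pw_inj1 sep1 dom1 gl1 simple1 v00 hw1).
  have h := rel_act (@pw_inj_ord n idn pw_inj1) gl1 glWh1 hw1 hwWh1 (h0 C n idn) (hx d).
  have := relB h (relZ (c0 idn (chiW idn l1) + m%:R) (hx d)).
  have -> // : piWh idn l1 (h0 C n idn) (delta (tab1 d)) = (c0 idn (@chiW C n idn l1) + m%:R) *: delta (tab1 d).
    apply/funext => v; have [iv|nv] := pselect (inS idn l1 v).
      rewrite (h0_piWh pw_inj1 sep1 dom1) // -[RHS]/(_ * delta (tab1 d) v) /delta.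
      by case: eqP => [->|_]; rewrite ?mulr0 // (tab_ht idnE nint1).
    rewrite /piWh piW_supp // -[RHS]/(_ * delta (tab1 d) v) /delta; case: eqP => [e|_]; rewrite ?mulr0 //.
    by case: nv; rewrite e; exact: (inS_tab _ nint1).
  by move=> /(_ n); rewrite subrr.
exists x, y; split=> // c hc d.
have h : rel1 (\sum_d c d *: x d) (\sum_d c d *: delta (tab1 d)) by apply: rel_sum => i _; exact: relZ.
rewrite hc in h; have /(congr1 (fun f : W => f (tab1 d))) := inj2_std pw_inj1 sep1 dom1 gl1 v00 hw1 (fun i j h _ => h) h.
rewrite sum_app (bigD1 d) //= big1 ?addr0.
  by rewrite -[X in X = _]/(c d * delta (tab1 d) (tab1 d)) /delta eqxx mulr1.
move=> d' ne; rewrite -[LHS]/(c d' * delta (tab1 d') (tab1 d)) /delta; case: eqP => [e|_]; rewrite ?mulr0 //.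
by case/eqP: ne; apply: (tab_cfun_inj idnE); exact: (esym e).
Qed.

(* Both V and the tableau module have as many independent vectors of height m as there are codes,
   so the square matrix relating them is invertible. *)
Lemma code_matrix : exists (x : cd -> V) (y : cd -> W) (Y : 'M[C]_#|{: cd}|),
  [/\ forall d, lowp m (x d, y d), forall c : cd -> C, \sum_d c d *: x d = 0 -> forall d, c d = 0,
      Y \in unitmx & forall i j, Y i j = y (enum_val i) (tabw (enum_val j))].
Proof.
have [x [y [hl hi]]] := code_vectors.
exists x, y, (\matrix_(i, j) y (enum_val i) (tabw (enum_val j))); split=> //; last by move=> i j; rewrite mxE.
(* A row killed by the matrix gives a combination of the [y d] that vanishes, because their support
   consists of tableaux of height [m]. The same combination of the [x d] is related to 0, hence is
   0. *)
rewrite -row_free_unit; apply/inj_row_free => r hr; set Y := \matrix_(i, j) _ in hr.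
pose c (d : cd) := r 0 (enum_rank d).
have hrel : rel (\sum_d c d *: x d) (\sum_d c d *: y d).
  by apply: rel_sum => d _; apply: relZ; exact: (low_rel (hl d)).
have hy0 : \sum_d c d *: y d = 0.
  apply/funext => v; rewrite sum_app -[RHS]/(0 : C).
  have [[d0 ->]|nv] := pselect (exists d0 : cd, v = tabw d0).
    have /matrixP/(_ 0 (enum_rank d0)) := hr; rewrite !mxE => e; rewrite -[RHS]e.
    rewrite (reindex_onto (@enum_val _ {: cd}) enum_rank) /=; last by move=> d _; rewrite enum_rankK.
    apply: eq_big => [j|j _]; first by rewrite enum_valK eqxx.
    by rewrite mxE enum_rankK /c enum_valK.
  apply: big1 => d _; rewrite -[LHS]/(c d * y d v).
  have [->|nz] := eqVneq (y d v) 0; first by rewrite mulr0.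
  have [_ /low_ht] := low_pair (hl d) => /(_ pw_inj sep dom v nz)[iv hv].
  by case: nv; exact: (tab_cfun_surj pwE nint).
have c0 : \sum_d c d *: x d = 0.
  by apply: (tab_inj pw_inj sep dom glV simpleV v00 hwV); rewrite -hy0.
by apply/rowP => j; rewrite mxE; have := hi c c0 (enum_val j); rewrite /c enum_valK.
Qed.

Lemma reindex_code (R : nmodType) (F : cd -> R) : \sum_d F d = \sum_(j < #|{: cd}|) F (enum_val j).
Proof.
rewrite (reindex_onto (@enum_val _ {: cd}) enum_rank) /=; last by move=> d _; rewrite enum_rankK.
by apply: eq_bigl => j; rewrite enum_valK eqxx.
Qed.
End Degree.

Lemma low_code m (z : V) (phi : W) : lowp m (z, phi) ->
  forall v, phi v != 0 -> exists d : code n m, v = tab n pw l (cfun d).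
Proof.
move=> h v nz; have [_ /low_ht] := low_pair h => /(_ pw_inj sep dom v nz)[iv hv].
exact: (tab_cfun_surj pwE nint).
Qed.

(** The row of the inverse of [Y] that belongs to the code of [v] combines the [y d] into a single
    tableau. *)
Lemma gen_nint v : inS pw l v -> exists x, rel x (delta v).
Proof.
move=> iv; have [m hm] := ht_nat pw_inj sep dom iv.
have [d0 vE] := tab_cfun_surj pwE nint iv hm.
have [x [y [Y [hl hi uY YE]]]] := code_matrix m.
pose r i := invmx Y (enum_rank d0) i.
exists (\sum_i r i *: x (enum_val i)).
have -> : delta v = \sum_i r i *: y (enum_val i).
  have val d : (\sum_i r i *: y (enum_val i)) (tab n pw l (cfun d)) = (d == d0)%:R.
    rewrite sum_app; have /matrixP/(_ (enum_rank d0) (enum_rank d)) := mulVmx uY.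
    rewrite !mxE (inj_eq enum_rank_inj) eq_sym => <-; apply: eq_bigr => i _.
    by rewrite YE enum_rankK.
  apply/funext => z; have [[d ->]|nz] := pselect (exists d : code n m, z = tab n pw l (cfun d)).
    rewrite val vE /delta; case: (eqVneq d d0) => [->|ne]; first by rewrite eqxx.
    by case: eqP => // e; case/eqP: ne; apply: (tab_cfun_inj pwE e).
  rewrite sum_app big1 /delta; first by case: eqP => // e; case: nz; exists d0; rewrite e.
  move=> i _; rewrite -[LHS]/(r i * y (enum_val i) z).
  have [->|h] := eqVneq (y (enum_val i) z) 0; first by rewrite mulr0.
  by case: nz; exact: (low_code (hl _) h).
by apply: rel_sum => i _; apply: relZ; exact: (low_rel (hl _)).
Qed.

(** As [Y] is invertible, [phi] is a combination of the [y d]; the same combination of the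
    independent [x d] is related to 0. *)
Lemma low_inj2 m phi : lowp m (0, phi) -> phi = 0.
Proof.
move=> hphi; have [x [y [Y [hl hi uY YE]]]] := code_matrix m.
pose p : 'rV_#|{: code n m}| := \row_j phi (tab n pw l (cfun (enum_val j))).
pose r := p *m invmx Y.
have phiE : phi = \sum_i r 0 i *: y (enum_val i).
  apply/funext => z; have [[d ->]|nz] := pselect (exists d : code n m, z = tab n pw l (cfun d)).
    have : (r *m Y) 0 (enum_rank d) = p 0 (enum_rank d) by rewrite mulmxKV.
    rewrite !mxE enum_rankK => <-; rewrite sum_app; apply: eq_bigr => i _.
    by rewrite YE enum_rankK.
  have -> : phi z = 0.
    by have [//|h] := eqVneq (phi z) 0; case: nz; exact: (low_code hphi h).
  rewrite sum_app big1 // => i _; rewrite -[LHS]/(r 0 i * y (enum_val i) z).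
  have [->|h] := eqVneq (y (enum_val i) z) 0; first by rewrite mulr0.
  by case: nz; exact: (low_code (hl _) h).
have hr : rel (\sum_i r 0 i *: x (enum_val i)) 0.
  rewrite -(subr0 (\sum_i _)) -(subrr phi) {1}phiE; apply: relB; last exact: (low_rel hphi).
  by apply: rel_sum => i _; apply: relZ; exact: (low_rel (hl _)).
have := tab_inj pw_inj sep dom glV simpleV v00 hwV hr => e.
rewrite phiE big1 // => i _; have := hi (fun d => r 0 (enum_rank d)) _ (enum_val i).
rewrite /= enum_valK => ->; first by rewrite scale0r.
by rewrite reindex_code -[RHS]e; apply: eq_bigr => j _; rewrite enum_valK.
Qed.

Lemma strongly_tame_nint : strongly_tame_GT piV.
Proof.
apply: (strongly_tame_of_basis pw_inj sep dom glV simpleV v00 hwV); first exact: gen_nint.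
move=> phi /rel_graded[K [g [hg e1 ->]]]; apply: big1 => i _.
apply: (@low_inj2 i); rewrite -(low_sum_zero glV hwV hg (esym e1) (ltn_ord i)).
by rewrite -surjective_pairing.
Qed.
End Transfer.

(** * Lifts of Weyl group elements *)

Section Monomial.
Variables (C : numClosedFieldType) (n : nat).
Local Notation M := 'M[C]_n.+1.
Local Notation E := (@delta_mx C n.+1 n.+1).

(* conjugation by the monomial matrix that sends the basis vector i to d_i times the basis vector w i *)
Definition monomial (w : 'S_n.+1) (u : M -> M) := exists d : 'I_n.+1 -> C,
  (forall i, d i != 0) /\ forall x i j, u x (w i) (w j) = d i / d j * x i j.

Lemma monomial_id : monomial 1 id.
Proof. by exists (fun _ => 1); split=> [i|x i j]; rewrite ?oner_eq0 // !perm1 divr1 mul1r. Qed.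

Lemma monomial_comp w w' u u' : monomial w u -> monomial w' u' -> monomial (w * w') (u' \o u).
Proof.
move=> [d [d0 h]] [d' [d0' h']]; exists (fun i => d' (w i) * d i); split.
  by move=> i; rewrite mulf_neq0.
by move=> x i j; rewrite !permM /= h' h invfM; ring.
Qed.

Lemma expad_conj (x y : M) : x *m x = 0 -> expad x y = (1%:M + x) *m y *m (1%:M - x).
Proof.
move=> x2; rewrite /expad; have h2 : (2%:R : C) != 0 by rewrite pnatr_eq0.
have -> : lbr x (lbr x y) = 2%:R *: (- (x *m y *m x)).
  rewrite /lbr mulmxBr mulmxBl !mulmxA x2 mul0mx -[y *m x *m x]mulmxA x2 mulmx0.
  by rewrite scaler_nat mulr2n sub0r subr0.
rewrite scalerA mulVf // scale1r /lbr mulmxDl mul1mx mulmxBr mulmx1 mulmxDl.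
by zmod.
Qed.

Section Reflection.
Variables (i j : 'I_n.+1).
Hypothesis ij : i != j.
Local Notation e := (E i j).
Local Notation f := (E j i).

(** The product [(1 + c f)(1 - c e)(1 + c f)] for [c = 1] or [c = -1]: a signed transposition. The
    two values of [c] give the two sides of the conjugation by [r_aut]. *)
Definition refl_mx (c : C) : M := 1%:M - c *: e + c *: f - E i i - E j j.

Lemma mulE (a b c d : 'I_n.+1) : E a b *m E c d = E a d *+ (b == c).
Proof. exact: mul_delta_mx_cond. Qed.

Lemma refl_mxE c : c ^+ 2 = 1 -> (1%:M + c *: f) *m (1%:M - c *: e) *m (1%:M + c *: f) = refl_mx c.
Proof.
move=> c2; have ji : j != i by rewrite eq_sym.
have -> : (1%:M + c *: f) *m (1%:M - c *: e) = 1%:M - c *: e + c *: f - E j j.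
  rewrite mulmxBr mulmx1 -scalemxAr mulmxDl mul1mx -scalemxAl mulE eqxx mulr1n scalerDr scalerA -expr2 c2 scale1r.
  by zmod.
rewrite mulmxDr mulmx1 /refl_mx; set A := 1%:M - _ + _ - _.
have Af : A *m f = - c *: E i i.
  rewrite /A mulmxBl mulmxDl mulmxBl mul1mx -!scalemxAl !mulE !eqxx (negbTE ij) mulr0n scaler0 addr0 !mulr1n.
  by rewrite addrAC subrr sub0r scaleNr.
rewrite -scalemxAr Af scalerA mulrN -expr2 c2 scaleN1r /A.
by zmod.
Qed.

Lemma refl_entry c r s : refl_mx c r s = (if s == i then c else if s == j then - c else 1) *+ (r == tperm i j s).
Proof.
have ji : j != i by rewrite eq_sym.
rewrite /refl_mx !mxE.
have [->|si] := eqVneq s i.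
  rewrite tpermL (negbTE ij) !andbF ?andbT.
  by case: (eqVneq r i) => [->|_]; [rewrite (negbTE ij)|case: eqP => _] => /=; ring.
have [->|sj] := eqVneq s j.
  rewrite tpermR !andbF ?andbT.
  by case: (eqVneq r i) => [->|_]; [rewrite (negbTE ij)|case: eqP => _] => /=; ring.
rewrite tpermD 1?eq_sym // !andbF /= !mulr0 !subr0 addr0 //.
Qed.
End Reflection.

Lemma monomial_r (i : 'I_n) : monomial (tperm (inord i) (inord i.+1)) (r_aut i).
Proof.
set a : 'I_n.+1 := inord i; set b : 'I_n.+1 := inord i.+1.
have ab : a != b by rewrite /a /b -val_eqE /= !inordK ?ltnS //; [lia|exact: ltnW].
have ba : b != a by rewrite eq_sym.
have f2 : E b a *m E b a = 0 by rewrite mulE (negbTE ab).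
have e2 : (- E a b) *m (- E a b) = 0 by rewrite mulmxN mulNmx opprK mulE (negbTE ba).
pose d (s : 'I_n.+1) : C := if s == a then 1 else if s == b then -1 else 1.
have dd s : d s * d s = 1 by rewrite /d; case: eqP => _; [|case: eqP => _]; ring.
exists d; split.
  by move=> s; apply/eqP => e; have := dd s; rewrite e mul0r => /eqP; rewrite eq_sym oner_eq0.
have dV s : (d s)^-1 = d s.
  have d0 : d s != 0 by apply/eqP => e; have := dd s; rewrite e mul0r => /eqP; rewrite eq_sym oner_eq0.
  by apply: (mulfI d0); rewrite divff // dd.
move=> x p q.
have -> : r_aut i x = refl_mx a b 1 *m x *m refl_mx a b (-1).
  rewrite /r_aut /ech /fch /Emx -/a -/b !expad_conj //.
  rewrite -[refl_mx a b 1]refl_mxE ?expr1n // -[refl_mx a b (-1)]refl_mxE ?sqrrN ?expr1n //.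
  by rewrite !scaleN1r !scale1r !opprK !mulmxA.
rewrite mxE (bigD1 q) //= big1 ?addr0 => [|s ne]; last first.
  by rewrite [X in _ * X]refl_entry // tpermK (negbTE ne) mulr0n mulr0.
rewrite [X in _ * X]refl_entry // tpermK eqxx mulr1n.
rewrite mxE (bigD1 p) //= big1 ?addr0 => [|s ne]; last first.
  by rewrite refl_entry // (inj_eq perm_inj) [p == s]eq_sym (negbTE ne) mulr0n mul0r.
rewrite refl_entry // eqxx mulr1n -/(d p) dV mulrAC; congr (_ * _ * _).
rewrite /d; case: (eqVneq q a) => [->|qa]; first by rewrite tpermL (negbTE ba) eqxx opprK.
case: (eqVneq q b) => [->|qb]; first by rewrite tpermR eqxx.
have e : tperm a b q = q by rewrite tpermD 1?eq_sym.
by rewrite e (negbTE qa) (negbTE qb).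
Qed.

Lemma Wbar_comp (u v : M -> M) : Wbar u -> Wbar v -> Wbar (u \o v).
Proof.
elim=> {u} [//|i u _ IH|u _ IH] hv.
- exact: (Wbar_r i (IH hv)).
- exact: (Wbar_sigma (IH hv)).
Qed.

Definition has_lift (w : 'S_n.+1) := exists u, @Wbar C n u /\ monomial w u.

Lemma has_lift1 : has_lift 1.
Proof. by exists id; split; [exact: Wbar_id|exact: monomial_id]. Qed.
Lemma has_liftM w w' : has_lift w -> has_lift w' -> has_lift (w * w').
Proof.
move=> [u [h1 h2]] [u' [h1' h2']]; exists (u' \o u); split; first exact: Wbar_comp.
exact: monomial_comp.
Qed.

Lemma has_lift_adj (i : nat) : (i < n)%N -> has_lift (tperm (inord i) (inord i.+1)).
Proof.
move=> hi; exists (r_aut i); split; last exact: (monomial_r (Ordinal hi)).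
exact: (Wbar_r (Ordinal hi) (@Wbar_id C n)).
Qed.

Lemma has_lift_tperm (a d : nat) : (a + d <= n)%N -> has_lift (tperm (inord a) (inord (a + d))).
Proof.
elim: d => [|d IH] h; first by rewrite addn0 tperm1; exact: has_lift1.
have hd := IH _; have adj := @has_lift_adj (a + d) _.
have [->|d0] := eqVneq d 0%N; first by rewrite addn1; apply: has_lift_adj; lia.
have -> : tperm (inord a) (inord (a + d.+1)) =
    (tperm (inord (a + d)) (inord (a + d).+1) * tperm (inord a) (inord (a + d)) * tperm (inord (a + d)) (inord (a + d).+1) : 'S_n.+1)%g.
  rewrite -{1}(tpermV (inord (a + d)) (inord (a + d).+1)) -mulgA -[RHS]/(_ ^ _)%g tpermJ tpermL tpermD -?addnS //.
  - by rewrite -val_eqE /= !inordK; lia.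
  - by rewrite -val_eqE /= !inordK; lia.
by apply: has_liftM; [apply: has_liftM|]; [apply: adj; lia|apply: hd; lia|apply: adj; lia].
Qed.

Lemma has_lift_all w : has_lift w.
Proof.
have [ts -> _] := prod_tpermP w; elim: ts => [|[a b] ts IH]; first by rewrite big_nil; exact: has_lift1.
rewrite big_cons; apply: has_liftM => //=.
wlog ab : a b / (a <= b)%N.
  by move=> h; case: (leqP a b) => [/h//|/ltnW/h]; rewrite tpermC.
have := @has_lift_tperm a (b - a); rewrite subnKC // !inord_val; apply; exact: ord_le.
Qed.

Section Transport.
Variables (w : 'S_n.+1) (u : M -> M).
Hypothesis mon : monomial w u.

Lemma monomial_linear c (x y : M) : u (c *: x + y) = c *: u x + u y.
Proof.
have [d [d0 h]] := mon; apply/matrixP => i j.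
by rewrite -(permKV w i) -(permKV w j) !mxE !h !mxE; ring.
Qed.

Lemma monomial_tr (x : M) : \tr (u x) = \tr x.
Proof.
have [d [d0 h]] := mon; rewrite /mxtrace (reindex_inj (@perm_inj _ w)); apply: eq_bigr => i _.
by rewrite h divff ?mul1r.
Qed.

Lemma monomial_mul (x y : M) : u (x *m y) = u x *m u y.
Proof.
have [d [d0 h]] := mon; apply/matrixP => i j.
rewrite -(permKV w i) -(permKV w j) h !mxE [RHS](reindex_inj (@perm_inj _ w)) mulr_sumr; apply: eq_bigr => k _.
by rewrite !h; field; rewrite !d0.
Qed.

Lemma monomial_lbr (x y : M) : u (lbr x y) = lbr (u x) (u y).
Proof. by rewrite /lbr addrC -scaleN1r monomial_linear scaleN1r addrC !monomial_mul. Qed.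

Lemma monomial_delta a b : exists c, [/\ c != 0, u (E a b) = c *: E (w a) (w b) & a = b -> c = 1].
Proof.
have [d [d0 h]] := mon; exists (d a / d b); split; first by rewrite mulf_neq0 ?invr_eq0.
  apply/matrixP => i j; rewrite -(permKV w i) -(permKV w j) h !mxE !(inj_eq perm_inj).
  by case: eqP => [->|_]; case: eqP => [->|_] //=; rewrite !mulr0.
by move=> ->; rewrite divff.
Qed.

Lemma monomial_surj (y : M) : exists x, u x = y.
Proof.
have [d [d0 h]] := mon; exists (\matrix_(i, j) (y (w i) (w j) * d j / d i)).
apply/matrixP => i j; rewrite -(permKV w i) -(permKV w j) h !mxE.
by field; rewrite !d0.
Qed.

Lemma monomial_same_base : same_base u w.
Proof.
move=> i; have [c [c0 e _]] := monomial_delta (inord i) (inord i.+1).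
by exists c; split.
Qed.

Variables (V : lmodType C) (rho : M -> V -> V).
Hypothesis gl : glmod rho.

Lemma glmod_monomial : glmod (fun x => rho (u x)).
Proof.
have [h1 h2 h3] := gl; split=> [x|x y c v|x y v]; first exact: h1.
  by rewrite monomial_linear h2.
by rewrite monomial_lbr h3.
Qed.

Lemma simple_monomial : simple_gmodule rho -> simple_gmodule (fun x => rho (u x)).
Proof.
move=> [h1 h2]; split=> // W [s1 s2 s3]; apply: h2; split=> // x v sx hv.
by have [y hy] := monomial_surj x; rewrite -hy; apply: s3 => //; rewrite /in_sl -monomial_tr hy.
Qed.

Lemma hwv_monomial (pw : nat -> nat) chi v : (forall a : 'I_n.+1, pw a = w a :> nat) -> hwv (fun i => i) rho chi v ->
  hwv pw (fun x => rho (u x)) (fun a => chi (w a)) v.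
Proof.
move=> pwE [h1 h2]; split=> [a b|a].
  rewrite !pwE => ab; have [c [_ -> _]] := monomial_delta a b.
  by rewrite (piZl gl) h1 // scaler0.
by have [c [_ -> ->]] := monomial_delta a a; rewrite // scale1r.
Qed.

Lemma h0_monomial (pw : nat -> nat) : (forall a : 'I_n.+1, pw a = w a :> nat) -> u (h0 C n pw) = h0 C n (fun i => i).
Proof.
move=> pwE; have u0 : u 0 = 0.
  by have := monomial_linear 1 0 0; rewrite !scale1r addr0 => /esym/eqP; rewrite -subr_eq0 addrK => /eqP.
have uD x y : u (x + y) = u x + u y by have := monomial_linear 1 x y; rewrite !scale1r.
rewrite /h0 (big_morph u uD u0) [RHS](reindex_inj (@perm_inj _ w)); apply: eq_bigr => a _.
have [c [_ e c1]] := monomial_delta a a.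
have := monomial_linear (pw a)%:R (E a a) 0; rewrite u0 !addr0 => ->.
by rewrite e c1 // scale1r pwE.
Qed.
End Transport.
End Monomial.

(** * Integral weights: elements of the annihilator *)

Section MatrixPowers.
Variables (C : numClosedFieldType) (n : nat).
Local Notation M := 'M[C]_n.+1.
Local Notation E := (@delta_mx C n.+1 n.+1).
Local Notation I := 'I_n.+1.

(* entry (a, b) of the j-th power of the matrix (E_ab) with coefficients in U(gl) *)
Fixpoint Gop (U : lmodType C) (pi : M -> U -> U) j (a b : I) (u : U) : U :=
  if j is j'.+1 then \sum_c pi (E a c) (Gop pi j' c b u) else if a == b then u else 0.

Definition Xw (U : lmodType C) (pi : M -> U -> U) (a b : I) (js : seq nat) (u : U) : U :=
  foldr (fun j acc => Gop pi j a b acc) u js.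

Section One.
Variables (U : lmodType C) (pi : M -> U -> U).
Hypothesis gl : glmod pi.

Lemma piBl x y u : pi (x - y) u = pi x u - pi y u.
Proof. by rewrite -[- y]scaleN1r (piDl gl) (piZl gl) scaleN1r. Qed.
Lemma piB x u v : pi x (u - v) = pi x u - pi x v.
Proof. by rewrite -[- v]scaleN1r (piD gl) (piZ gl) scaleN1r. Qed.

(** The matrix [(E_ab)] is equivariant for the adjoint action, hence so are its powers. In the
    induction the inner boundary terms, at [c = y] and [c = x], cancel. *)
Lemma Gop_comm j x y a b u : pi (E x y) (Gop pi j a b u) =
  Gop pi j a b (pi (E x y) u) + (if y == a then Gop pi j x b u else 0) - (if x == b then Gop pi j a y u else 0).
Proof.
elim: j a b x y u => [|j IH] a b x y u /=.
  by rewrite [y == a]eq_sym; case: (a == b); case: (a == y); case: (x == b); rewrite ?(pi0 gl) ?addrK ?addr0 ?subr0 ?subrr ?addr0.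
rewrite (pi_sumr gl).
transitivity (\sum_c (pi (E a c) (Gop pi j c b (pi (E x y) u)) + (if c == y then pi (E a y) (Gop pi j x b u) else 0) -
   (if x == b then pi (E a c) (Gop pi j c y u) else 0) + ((if y == a then pi (E x c) (Gop pi j c b u) else 0) -
   (if c == x then pi (E a y) (Gop pi j x b u) else 0))) ).
  apply: eq_bigr => c _; rewrite (pi_lbr gl) IH lbr_delta piB (piD gl) piBl.
  have pif (t : bool) z v : pi z (if t then v else 0) = if t then pi z v else 0.
    by case: t; rewrite ?(pi0 gl).
  rewrite !pif; congr (_ + _ - _ + _).
    by rewrite eq_sym; case: eqP => [->|].
  congr (_ - _).
    by case: (y == a); rewrite ?mulr1n ?mulr0n ?(pi0l gl).
  by case: eqP => [->|]; rewrite ?mulr1n ?mulr0n ?(pi0l gl).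
rewrite big_split /= sumrB big_split /= [X in _ + X]sumrB -!big_mkcond /= !big_pred1_eq.
have sif (t : bool) (F : I -> U) : \sum_(c | t) F c = if t then \sum_c F c else 0.
  by case: t => //; rewrite big_pred0.
rewrite (sif (x == b)) (sif (y == a)).
zmod.
Qed.

Lemma Gop_linear j a b c u v : Gop pi j a b (c *: u + v) = c *: Gop pi j a b u + Gop pi j a b v.
Proof.
elim: j a => [|j IH] a /=; first by case: eqP; rewrite ?scaler0 ?addr0.
rewrite scaler_sumr -big_split; apply: eq_bigr => d _ /=.
by rewrite IH (piD gl) (piZ gl).
Qed.

Lemma Xw_linear a b js c u v : Xw pi a b js (c *: u + v) = c *: Xw pi a b js u + Xw pi a b js v.
Proof. by elim: js => //= j js ->; rewrite Gop_linear. Qed.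

Lemma Xw_comm a b js x y u : y != a -> x != b -> pi (E x y) (Xw pi a b js u) = Xw pi a b js (pi (E x y) u).
Proof.
move=> ya xb; elim: js => //= j js IH.
by rewrite Gop_comm (negbTE ya) (negbTE xb) addr0 subr0 IH.
Qed.

Lemma Xw_wt a b js x c u : pi (E x x) u = c *: u ->
  pi (E x x) (Xw pi a b js u) = (c + (size js)%:R * ((x == a)%:R - (x == b)%:R)) *: Xw pi a b js u.
Proof.
move=> hu; elim: js => [|j js IH] /=; first by rewrite mul0r addr0.
have GZ z v : Gop pi j a b (z *: v) = z *: Gop pi j a b v.
  have G0 : Gop pi j a b 0 = 0.
    by have := Gop_linear j a b 1 0 0; rewrite !scale1r addr0 => /esym/eqP; rewrite -subr_eq0 addrK => /eqP.
  by have := Gop_linear j a b z v 0; rewrite G0 !addr0.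
rewrite Gop_comm IH GZ -natr1 mulrDl addrA mul1r [RHS]scalerDl scalerBl -addrA; congr (_ + (_ - _)).
  by case: eqP => [->|_]; rewrite ?scale1r ?scale0r.
by case: eqP => [->|_]; rewrite ?scale1r ?scale0r.
Qed.
End One.

Lemma rel_Gop pw (U V : lmodType C) (piU : M -> U -> U) (piV : M -> V -> V) u0 v0 :
  (forall x u v, rel pw piU piV u0 v0 u v -> rel pw piU piV u0 v0 (piU x u) (piV x v)) ->
  forall j a b u v, rel pw piU piV u0 v0 u v -> rel pw piU piV u0 v0 (Gop piU j a b u) (Gop piV j a b v).
Proof.
move=> act j; elim: j => [|j IH] a b u v h /=; first by case: ifP => // _; exact: rel00.
by apply: rel_sum => c _; apply: act; exact: IH.
Qed.

Lemma rel_Xw pw (U V : lmodType C) (piU : M -> U -> U) (piV : M -> V -> V) u0 v0 :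
  (forall x u v, rel pw piU piV u0 v0 u v -> rel pw piU piV u0 v0 (piU x u) (piV x v)) ->
  forall a b js u v, rel pw piU piV u0 v0 u v -> rel pw piU piV u0 v0 (Xw piU a b js u) (Xw piV a b js v).
Proof. by move=> act a b js u v h; elim: js => //= j js IH; exact: rel_Gop. Qed.
End MatrixPowers.

Lemma dependent_family (F : fieldType) (P T : finType) (A : Type) (f : P -> A -> F) (t : T -> A) :
  (#|T| < #|P|)%N -> (forall p v, f p v != 0 -> exists x, v = t x) ->
  exists c : P -> F, (exists p, c p != 0) /\ forall v, \sum_p c p * f p v = 0.
Proof.
move=> lt hs; pose Y : 'M[F]_(#|P|, #|T|) := \matrix_(i, j) f (enum_val i) (t (enum_val j)).
have kn0 : kermx Y != 0.
  by rewrite kermx_eq0 -row_leq_rank -ltnNge; apply: leq_ltn_trans lt; exact: rank_leq_col.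
have [r [hr rn0]] : exists r : 'rV_#|P|, r *m Y = 0 /\ r != 0.
  have [r hr rn0] := rowV0Pn kn0; exists r; split=> //.
  by apply/sub_kermxP.
exists (fun p => r 0 (enum_rank p)); split.
  have /rV0Pn[j hj] := rn0; exists (enum_val j); by rewrite enum_valK.
move=> v; have [[x ->]|nx] := pselect (exists x, v = t x); last first.
  apply: big1 => p _; have [->|h] := eqVneq (f p v) 0; first by rewrite mulr0.
  by case: nx; exact: hs h.
have /matrixP/(_ 0 (enum_rank x)) := hr; rewrite !mxE => e; rewrite -[RHS]e.
rewrite (reindex_onto (@enum_val _ P) enum_rank) /=; last by move=> d _; rewrite enum_rankK.
apply: eq_big => [j|j _]; first by rewrite enum_valK eqxx.
by rewrite mxE enum_rankK enum_valK.
Qed.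

(** * A polynomial relation on the highest weight vector of the tableau module *)

Section Dependence.
Variables (C : numClosedFieldType) (n : nat).
Hypothesis hn : (0 < n)%N.
Local Notation arr := (GTarr C n).
Local Notation E := (@delta_mx C n.+1 n.+1).
Local Notation W := (arr -> C^o).

(* With the last-but-one position first, the entries (n, n-1) of the powers of (E_ab) commute with all
   lowering operators. *)
Definition pwA (i : nat) : nat := if (i < n.-1)%N then i.+1 else if i == n.-1 then 0%N else i.

Lemma pwA_inj i j : (i <= n)%N -> (j <= n)%N -> pwA i = pwA j -> i = j.
Proof. by rewrite /pwA; do !case: ifP; lia. Qed.

Variable l : nat -> C.
Lemma pwA_sep k i j : (k < n)%N -> (i <= k)%N -> (j <= k)%N ->
  (pwA i < pwA k.+1)%N -> (pwA k.+1 < pwA j)%N -> ~ isZ (l i - l j).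
Proof. by rewrite /pwA; do !case: ifP; lia. Qed.

Hypothesis dom : forall i j, (i <= n)%N -> (j <= n)%N -> (pwA i < pwA j)%N ->
  forall z : int, l i - l j = z%:~R -> 0 < z.

Local Notation inS := (@inS C n pwA l).
Local Notation piWh := (@piWh C n pwA l).
Local Notation piW := (@piW C n pwA l).
Local Notation w0 := (w0arr n pwA l).
Local Notation delta := (@delta C n).
Local Notation glWh := (glWh pwA_inj pwA_sep).
Local Notation hwWh := (hwWh pwA_inj pwA_sep dom).
Local Notation top := (ord_max : 'I_n.+1).
Local Notation sub := (inord n.-1 : 'I_n.+1).
Local Notation Xw := (Xw piWh top sub).

Lemma Xw_fin js : finS pwA l (Xw js (delta w0)).
Proof.
have fin0 := finS_delta (inS_w0 pwA_inj pwA_sep dom).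
elim: js => //= j js; move: (Xw js _) => phi; elim: j {1}top => [|j IH] a h /=.
  by case: ifP => // _; exact: finS0.
by apply: finS_sum => c _; apply: piW_fin; exact: IH.
Qed.

Lemma Xw_inS js v : Xw js (delta w0) v != 0 -> inS v.
Proof.
by move=> h; apply: contrapT => nv; move: h; rewrite (finS_supp (Xw_fin js)) ?eqxx.
Qed.

Lemma Xw_kill js k : (k < n.-2)%N -> @op C n pwA l true k (Xw js (delta w0)) = 0.
Proof.
move=> hk; have hkn : (k < n)%N by lia.
have sl : in_sl (ech C n k) by apply: delta_sl; rewrite -val_eqE /= !inordK; lia.
apply/eqP; rewrite -oppr_eq0 -(piW_ech pwA l (Xw js _)) // -(hat_id sl); apply/eqP.
rewrite -[LHS]/(piWh (ech C n k) _) /ech /Emx (Xw_comm glWh).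
- have [h _] := hwWh; rewrite h.
    have := Xw_linear glWh top sub js 1 0 0; rewrite !scale1r addr0 => /esym/eqP.
    by rewrite -subr_eq0 addrK => /eqP.
  by rewrite !inordK /pwA; [do !case: ifP|..]; lia.
- by rewrite -val_eqE /= !inordK; lia.
- by rewrite -val_eqE /= !inordK; lia.
Qed.

Lemma piWh_Eaa (a : 'I_n.+1) (phi : W) v : inS v ->
  piWh (E a a) phi v = (wt a v - (\sum_(c < n.+1) wt c w0) / n.+1%:R) * phi v.
Proof.
move=> iv; rewrite /piWh hat_Eaa (piW_linear_l pwA l) scaleN1r.
rewrite -[LHS]/(- (piW _ phi v) + piW (E a a) phi v) piW_Eaa //.
rewrite (piW_diag pwA_inj pwA_sep (fun c : 'I_n.+1 => 1 / n.+1%:R)) // -mulr_sumr.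
by rewrite (wt_total pwA_inj pwA_sep dom iv); ring.
Qed.

Lemma Xw_weight js v (a : 'I_n.+1) : Xw js (delta w0) v != 0 ->
  wt a v = wt a w0 + (size js)%:R * ((a == top)%:R - (a == sub)%:R).
Proof.
move=> nz; have iv := Xw_inS nz; have [_ hd] := hwWh.
have iw := inS_w0 pwA_inj pwA_sep dom.
have e0 : chiW pwA l a = wt a w0 - (\sum_(c < n.+1) wt c w0) / n.+1%:R by [].
have := congr1 (fun f : W => f v) (Xw_wt glWh top sub js (hd a)); rewrite /= piWh_Eaa // => e.
have e1 : _ * Xw js (delta w0) v = _ * Xw js (delta w0) v := e.
move: e1 => /(mulIf nz); rewrite e0 => /eqP.
by rewrite -subr_eq0 => /eqP e2; apply/eqP; rewrite -subr_eq0; apply/eqP; rewrite -e2; ring.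
Qed.

Definition rowsum k (v : arr) := \sum_(i < k.+1) ent v k i.

Lemma wt_rowsum k v : wt k v = rowsum k v - (if k is k'.+1 then rowsum k' v else 0) + k%:R.
Proof. by rewrite /wt /rowsum; case: k => [|k] /=; rewrite ?big_ord0. Qed.

Lemma Xw_rowsum js v k : Xw js (delta w0) v != 0 -> (k < n)%N ->
  rowsum k v = rowsum k w0 - (size js)%:R * (k == n.-1)%:R.
Proof.
move=> nz hk; have hw a : (a < n)%N -> wt a v = wt a w0 - (size js)%:R * (a == n.-1)%:R.
  move=> ha; have := Xw_weight (inord a) nz; rewrite -!val_eqE /= !inordK; try lia.
  by move=> ->; rewrite (_ : (a == n) = false) ?sub0r ?mulrN //; lia.
elim: k hk => [|k IH] hk; have := hw _ hk; rewrite !wt_rowsum; first by rewrite !subr0 !addr0.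
rewrite IH; last exact: ltnW.
rewrite (_ : (k == n.-1) = false) ?mulr0 ?subr0; last by lia.
move=> /(congr1 (fun x => x - k.+1%:R + rowsum k w0)) e.
rewrite -[LHS](_ : rowsum k.+1 v - rowsum k w0 + k.+1%:R - k.+1%:R + rowsum k w0 = _); first by rewrite e; ring.
by ring.
Qed.

(** The monomial produces a vector singular for gl on the positions up to [n-2], so columns are
    constant through row [n-2]. The row sums are known from the weight and determine the entries one
    after the other. *)
Lemma Xw_rows js v k i : Xw js (delta w0) v != 0 -> (k < n.-1)%N -> (i <= k)%N -> ent v k i = ent w0 k i.
Proof.
move=> nz hk hi.
have std : forall i j, (i < j)%N -> (j <= n.-2)%N -> (pwA i < pwA j)%N.
  by rewrite /pwA => a b ab hb; do !case: ifP; lia.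
have hr : (n.-2 <= n)%N by lia.
have sing js' z a b : Xw js' (delta w0) z != 0 -> (a < n.-1)%N -> (b <= a)%N -> ent z a b = ent z n.-2 b.
  move=> hz ha hb; apply: (singular pwA_inj pwA_sep dom hr std (finS_supp (Xw_fin js')) (@Xw_kill js') hz) => //.
  lia.
have nz0 : Xw [::] (delta w0) w0 != 0 by rewrite /= /delta eqxx oner_eq0.
rewrite (sing js v) // (sing [::] w0) //.
have {hi} : (i < n.-1)%N by lia.
elim/ltn_ind: i => i IH hi; rewrite -(sing js v i) // -(sing [::] w0 i) //.
have hin : (i < n)%N by lia.
have := Xw_rowsum nz hin; rewrite (_ : (i == n.-1) = false) ?mulr0 ?subr0; last by lia.
rewrite /rowsum !big_ord_recr /= => e; apply: (addrI (\sum_(i0 < i) ent v i i0)).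
rewrite e; congr (_ + _); apply: eq_bigr => q _; have hq := ltn_ord q.
have qi : (q <= i)%N by exact: ltnW.
have qn : (q < n.-1)%N by lia.
by rewrite (sing js v i) // (sing [::] w0 i) // IH.
Qed.

Definition arrD (d : nat -> nat) : arr :=
  [ffun p : 'I_n.+1 * 'I_n.+1 => w0 p - (if (p.1 == n.-1 :> nat) && (p.2 <= p.1)%N then (d p.2)%:R else 0)].

(** Only row [n-1] is free. Its total lowering is the number of factors, by the weight, and the sign
    condition [v_{n-1,i} > v_{n,j}] bounds [d i] by an integral difference [l i - l j]. *)
Lemma Xw_support js v : Xw js (delta w0) v != 0 -> exists d : nat -> nat,
  [/\ (\sum_(i < n) d i = size js)%N,
      (forall i j (D : nat), (i < n)%N -> (j <= n)%N -> (pwA i < pwA j)%N -> l i - l j = D%:R -> (d i < D)%N) &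
      v = arrD d].
Proof.
move=> nz; have iv := Xw_inS nz; have iw := inS_w0 pwA_inj pwA_sep dom.
have n1 : (n.-1 < n)%N by lia.
have n1E : n.-1.+1 = n by lia.
have lw i : (i < n)%N -> ent w0 n.-1 i = l i.
  move=> hi; rewrite ent_w0; try lia.
  rewrite /nbef big_pred0 ?addr0 // => j; apply/negbTE; rewrite negb_and -!leqNgt.
  have hj := ltn_ord j; move: (nat_of_ord j) hj => {}j hj.
  by rewrite /pwA; do !case: ifP; lia.
have [[tz tv _] bits] := iv.
have /choice[d hd] : forall i, exists d : nat, (i < n)%N -> ent v n.-1 i = l i - d%:R.
  move=> i; case: (ltnP i n) => hi; last by exists 0%N.
  have hi' : (i <= n.-1)%N by lia.
  have [d hd] := inS_diff iv n1 hi'; exists d => _; move: hd; rewrite n1E tv; last by lia.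
  rewrite (_ : (pwA n < pwA i)%N = false); last by rewrite /pwA; do !case: ifP; lia.
  by move=> e; rewrite -[LHS](subrK (l i)) e addrC.
exists d; split.
- have := Xw_rowsum nz n1; rewrite eqxx mulr1 /rowsum n1E.
  under eq_bigr => i _ do rewrite hd //.
  under [X in _ = X - _ -> _]eq_bigr => i _ do rewrite lw //.
  rewrite sumrB => /addrI/oppr_inj/eqP; rewrite -natr_sum eqr_nat => /eqP //.
- move=> i j D hi hj ij e; have hi' : (i <= n.-1)%N by lia.
  have hj' : (j <= n.-1.+1)%N by lia.
  have := bits n.-1 i j n1 hi' hj' (D%:Z - (d i)%:Z); rewrite /cbit ij /= n1E tv // hd // => h.
  suff : 0 < D%:Z - (d i)%:Z by lia.
  by apply: h; rewrite rmorphB /= -!pmulrn -e; ring.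
apply/ffunP => -[a b]; rewrite ffunE /=.
case: (ltnP a b) => ab.
  by rewrite andbF subr0 tz // ffunE /= leqNgt ab.
rewrite andbT; have ha := ord_le a.
have Eab (z : arr) : z (a, b) = ent z a b by rewrite /ent !inord_val.
rewrite !Eab; case: eqP => an; first by rewrite an hd ?lw //; lia.
rewrite subr0; have [an'|an'] := eqVneq (a : nat) n.
  rewrite an' in ab *; have [[_ tw _] _] := iw; rewrite tv ?tw //.
by apply: (Xw_rows nz) => //; lia.
Qed.


(** The entry of the zeroth power is off-diagonal and vanishes, so the exponent [p j] is attached to
    the power [j + 1]. *)
Definition expo K (p : {ffun 'I_n -> 'I_K}) : seq nat := flatten [seq nseq (p j) (j : nat).+1 | j <- enum 'I_n].

Lemma size_expo K (p : {ffun 'I_n -> 'I_K}) : (size (expo p) <= n * K)%N.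
Proof.
rewrite size_flatten /shape -map_comp sumnE big_map big_enum /=.
apply: leq_trans (_ : (\sum_(j < n) K <= _)%N).
  by apply: leq_sum => j _; rewrite size_nseq ltnW.
by rewrite sum_nat_const card_ord.
Qed.

Lemma Xw_dependent i j (D : nat) : (i < n)%N -> (j <= n)%N -> (pwA i < pwA j)%N -> l i - l j = D%:R ->
  exists K (c : {ffun 'I_n -> 'I_K} -> C),
    (exists p, c p != 0) /\ \sum_p c p *: Xw (expo p) (delta w0) = 0.
Proof.
(* K^n monomials, supported on at most D (nK + 1)^(n-1) arrays *)
move=> hi hj ij hD; have [n' nE] : exists n', n = n'.+1 by exists n.-1; lia.
(* Since [nK + 1 <= (n + 1)K], this value makes [D (nK + 1)^(n-1)] smaller than [K^n]. *)
pose K := (D * n.+1 ^ n.-1).+1; exists K.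
have [i0 ei] : exists i0 : 'I_n, i0 = i :> nat by exists (Ordinal hi).
pose dec (x : 'I_D * {ffun 'I_n.-1 -> 'I_(n * K).+1}) : arr :=
  arrD (fun b => if (b < n)%N =P true is ReflectT hb
                 then if unlift i0 (Ordinal hb) is Some b' then x.2 b' : nat else x.1 else 0%N).
have [||c [cn0 hc]] := @dependent_family C _ _ _ (fun p : {ffun 'I_n -> 'I_K} => Xw (expo p) (delta w0)) dec.
- rewrite card_prod !card_ffun !card_ord.
  apply: leq_ltn_trans (_ : D * (n.+1 ^ n.-1 * K ^ n.-1) < _)%N.
    rewrite leq_mul2l -expnMn; apply/orP; right.
    case: n.-1 => // m; by rewrite leq_exp2r // mulSn -[(n * K).+1]add1n leq_add2r.
  have -> : (K ^ n = K ^ n.-1 * K)%N by rewrite nE -expnSr.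
  by rewrite mulnA mulnC ltn_mul2l expn_gt0 /= ltnSn.
- move=> p v hv; have [d [ds db ->]] := Xw_support hv.
  have dK b : (b < n)%N -> (d b < (n * K).+1)%N.
    move=> hb; rewrite ltnS; apply: leq_trans (size_expo p); rewrite -ds.
    by rewrite (bigD1 (Ordinal hb)) //= leq_addr.
  exists (Ordinal (db i j D hi hj ij hD), [ffun b' => inord (d (lift i0 b'))]).
  rewrite /dec; apply/ffunP => -[a b]; rewrite !ffunE /=; congr (_ - _); case: ifP => // /andP[/eqP ea hb].
  congr (_%:R); case: eqP => [hbn|]; last by lia.
  case: unliftP => [b' /(congr1 val) /= e|/(congr1 val) /= e]; last by rewrite e ei.
  by rewrite ffunE inordK ?dK -?e.
exists c; split=> //; apply/funext => v; rewrite sum_app -[RHS]/(0 : C) -[RHS](hc v).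
by apply: eq_bigr.
Qed.
End Dependence.

(** * Noncommutative words representing the annihilating elements, and their symbols *)

Section WordPolynomials.
Variables (C : numClosedFieldType) (n : nat).
Local Notation M := 'M[C]_n.+1.
Local Notation I := 'I_n.+1.
Local Notation poly := (seq (C * seq M)).

Definition pmul (P Q : poly) : poly := [seq (x.1 * y.1, x.2 ++ y.2) | x <- P, y <- Q].

(** A representative in the tensor algebra of an entry of the [j]-th power, with [xs a c] in place
    of [E_{a,c}]. All its words have length [j], so evaluating it gives its symbol. *)
Fixpoint Gword (xs : I -> I -> M) j (a b : I) : poly :=
  if j is j'.+1 then flatten [seq [seq (cw.1, xs a c :: cw.2) | cw <- Gword xs j' c b] | c <- enum I]
  else if a == b then [:: (1, [::])] else [::].

Definition Xword xs (a b : I) (js : seq nat) : poly :=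
  foldr (fun j P => pmul (Gword xs j a b) P) [:: (1, [::])] js.

Lemma Gword_size xs j a b cw : cw \in Gword xs j a b -> size cw.2 = j.
Proof.
elim: j a cw => [|j IH] a cw /=; first by case: ifP => // _; rewrite inE => /eqP ->.
by move=> /flatten_mapP[c _ /mapP[cw' h ->]] /=; rewrite (IH _ _ h).
Qed.

Lemma Gword_sl xs j a b cw x : (forall c d, in_sl (xs c d)) -> cw \in Gword xs j a b -> x \in cw.2 -> in_sl x.
Proof.
move=> hx; elim: j a cw => [|j IH] a cw /=; first by case: ifP => // _; rewrite inE => /eqP ->.
move=> /flatten_mapP[c _ /mapP[cw' h ->]] /=; rewrite inE => /orP[/eqP ->|] //; exact: IH h.
Qed.

Lemma Xword_size xs js a b cw : cw \in Xword xs a b js -> size cw.2 = sumn js.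
Proof.
elim: js cw => [|j js IH] cw /=; first by rewrite inE => /eqP ->.
move=> /allpairsP[[x y] [/= hx hy ->]] /=.
by rewrite size_cat (Gword_size hx) (IH _ hy).
Qed.

Lemma Xword_sl xs js a b cw x : (forall c d, in_sl (xs c d)) -> cw \in Xword xs a b js -> x \in cw.2 -> in_sl x.
Proof.
move=> hs; elim: js cw => [|j js IH] cw /=; first by rewrite inE => /eqP ->.
move=> /allpairsP[[y z] [/= hy hz ->]] /=; rewrite mem_cat => /orP[|]; first exact: Gword_sl hy.
exact: IH hz.
Qed.

Section Action.
Variables (V : lmodType C) (rho : M -> V -> V).
Hypothesis rho_lin : forall x, linear (rho x).

Lemma fold_rho_lin (s : seq M) : linear (fun v => foldr (fun x acc => rho x acc) v s).
Proof. by elim: s => [|x s IH] c u v //=; rewrite IH rho_lin. Qed.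

Lemma fold_rhoZ (s : seq M) c v :
  foldr (fun x acc => rho x acc) (c *: v) s = c *: foldr (fun x acc => rho x acc) v s.
Proof.
have f0 : foldr (fun x acc => rho x acc) 0 s = 0.
  by have := fold_rho_lin s 1 0 0; rewrite !scale1r addr0 => /esym/eqP; rewrite -subr_eq0 addrK => /eqP.
by have := fold_rho_lin s c v 0; rewrite f0 !addr0.
Qed.

Lemma fold_rho_sum (s : seq M) J (r : seq J) (F : J -> V) :
  foldr (fun x acc => rho x acc) (\sum_(i <- r) F i) s = \sum_(i <- r) foldr (fun x acc => rho x acc) (F i) s.
Proof.
have f0 : foldr (fun x acc => rho x acc) 0 s = 0 by have := fold_rhoZ s 0 0; rewrite !scale0r.
elim: r => [|i r IH]; rewrite ?big_nil // !big_cons -IH.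
by have := fold_rho_lin s 1 (F i) (\sum_(i <- r) F i); rewrite !scale1r.
Qed.

Lemma act_poly_mul P Q v : act_poly rho (pmul P Q) v = act_poly rho P (act_poly rho Q v).
Proof.
rewrite /act_poly /pmul big_allpairs_dep /=; apply: eq_bigr => x _.
rewrite fold_rho_sum scaler_sumr; apply: eq_bigr => y _.
by rewrite fold_rhoZ scalerA foldr_cat.
Qed.

Lemma act_Gword (pi : M -> V -> V) xs j a b v : (forall c d u, pi (delta_mx c d) u = rho (xs c d) u) ->
  act_poly rho (Gword xs j a b) v = Gop pi j a b v.
Proof.
move=> hp; elim: j a => [|j IH] a; rewrite /act_poly /=.
  by case: ifP => _; rewrite ?big_nil // big_seq1 scale1r.
rewrite big_flatten /= big_map big_enum /=; apply: eq_bigr => c _.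
rewrite big_map /= -IH hp -[rho _ _]/(foldr (fun x acc => rho x acc) _ [:: xs a c]) fold_rho_sum.
by apply: eq_bigr => cw _; rewrite fold_rhoZ.
Qed.

Lemma act_Xword (pi : M -> V -> V) xs js a b v : (forall c d u, pi (delta_mx c d) u = rho (xs c d) u) ->
  act_poly rho (Xword xs a b js) v = Xw pi a b js v.
Proof.
move=> hp; elim: js => [|j js IH] /=; first by rewrite /act_poly big_seq1 scale1r.
by rewrite act_poly_mul IH (act_Gword _ _ _ _ hp).
Qed.
End Action.

Section Evaluation.
Variable y : M.

Lemma poly_eval_mul P Q : poly_eval y (pmul P Q) = poly_eval y P * poly_eval y Q.
Proof.
rewrite /poly_eval /pmul big_allpairs_dep /= mulr_suml; apply: eq_bigr => x _.
rewrite mulr_sumr; apply: eq_bigr => z _.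
by rewrite big_cat /=; ring.
Qed.

Lemma eval_Xword xs a b js : poly_eval y (Xword xs a b js) = \prod_(j <- js) poly_eval y (Gword xs j a b).
Proof.
elim: js => [|j js IH] /=; first by rewrite big_nil /poly_eval big_seq1 big_nil mulr1.
by rewrite poly_eval_mul IH big_cons.
Qed.

Lemma eval_Gword_succ xs j a b : poly_eval y (Gword xs j.+1 a b) =
  \sum_c killing y (xs a c) * poly_eval y (Gword xs j c b).
Proof.
rewrite /poly_eval /= big_flatten /= big_map big_enum /=; apply: eq_bigr => c _.
by rewrite big_map mulr_sumr; apply: eq_bigr => cw _ /=; rewrite big_cons; ring.
Qed.
End Evaluation.

Section Symbol.
Variables (w : 'S_n.+1) (u : M -> M) (d : I -> C).
Hypotheses (d0 : forall i, d i != 0) (hd : forall x i j, u x (w i) (w j) = d i / d j * x i j).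
Local Notation xs := (fun a c : I => hat (u (delta_mx a c))).

Lemma killing_hat (y x : M) : in_sl y -> killing y (hat x) = killing y x.
Proof.
move=> sy; rewrite /killing /hat mulmxBr raddfB /= mul_mx_scalar linearZ /=.
by rewrite (sy : \tr y = 0) mulr0 subr0.
Qed.

Lemma tr_mul_delta (y : M) p q : \tr (y *m delta_mx p q) = y q p.
Proof.
rewrite /mxtrace (bigD1 q) //= big1 ?addr0 => [|i ne].
  rewrite mxE (bigD1 p) //= big1 ?addr0 => [|i ne]; first by rewrite mxE !eqxx mulr1.
  by rewrite mxE (negbTE ne) mulr0.
by rewrite mxE big1 // => k _; rewrite mxE (negbTE ne) andbF mulr0.
Qed.

Lemma killing_word (y : M) a c : in_sl y ->
  killing y (hat (u (delta_mx a c))) = (2 * n.+1)%:R * (d a / d c) * y (w c) (w a).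
Proof.
move=> sy; rewrite killing_hat //.
have -> : u (delta_mx a c) = (d a / d c) *: delta_mx (w a) (w c).
  apply/matrixP => i j; rewrite -(permKV w i) -(permKV w j) hd !mxE !(inj_eq perm_inj).
  by case: eqP => [->|_]; case: eqP => [->|_] //=; rewrite !mulr0.
by rewrite /killing -scalemxAr linearZ /= tr_mul_delta mulrA.
Qed.

(** The Killing form pairs [y] with [E_{a,c}] to a multiple of the transposed entry, so the indices
    get exchanged; the diagonal factors of the lift telescope to [d a / d b]. *)
Lemma eval_Gword (y : M) j a b : in_sl y ->
  poly_eval y (Gword xs j a b) = (2 * n.+1)%:R ^+ j * (d a / d b) * (y ^+ j) (w b) (w a).
Proof.
move=> sy; elim: j a => [|j IH] a.
  rewrite /= expr0 mul1r expr0 mxE (inj_eq perm_inj) eq_sym /poly_eval.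
  case: eqP => [->|_]; last by rewrite big_nil mulr0.
  by rewrite big_seq1 big_nil divff // !mulr1.
have eS : y ^+ j.+1 = y ^+ j *m y by rewrite exprSr.
rewrite eval_Gword_succ eS mxE mulr_sumr.
rewrite [RHS](reindex_inj (@perm_inj _ w)); apply: eq_bigr => c _.
by rewrite IH killing_word // exprS; field; rewrite !d0.
Qed.
End Symbol.
End WordPolynomials.

Lemma tr_eprin (C : numClosedFieldType) n : \tr (eprin C n) = 0.
Proof.
rewrite /eprin raddf_sum big1 //= => i _; apply: delta_sl.
by have hi := ltn_ord i; rewrite -val_eqE /= !inordK; lia.
Qed.

Lemma Oprin_sl (C : numClosedFieldType) n (y : 'M[C]_n.+1) : Oprin y -> in_sl y.
Proof. by move=> [g [ug ->]]; rewrite /in_sl mxtrace_mulC mulmxA mulVmx // mul1mx tr_eprin. Qed.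

(** * Principal nilpotents with prescribed corner entries of their powers *)

Section PrincipalOrbit.
Variables (C : numClosedFieldType) (n : nat).
Hypothesis hn : (0 < n)%N.
Local Notation M := 'M[C]_n.+1.
Local Notation I := 'I_n.+1.
Local Notation top := (ord_max : I).

Variable t : nat -> C.
Hypothesis tn : t n != 0.

(* The conjugate y of the principal nilpotent by q satisfies (y^j)_{0,n} = t_j. *)
Definition qmx : M := \matrix_(i, j) if j == top then (if i == ord0 then 0 else t i) else (i == j)%:R.

Lemma qmx_unit : qmx \in unitmx.
Proof.
rewrite -row_free_unit; apply/inj_row_free => r hr.
have top0 : top != ord0 by rewrite -val_eqE /= -lt0n.
have small j : j != top -> r 0 j = 0.
  move=> nj; have /matrixP/(_ 0 j) := hr; rewrite !mxE (bigD1 j) //= big1 ?addr0 => [|i ne].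
    by rewrite mxE (negbTE nj) eqxx mulr1.
  by rewrite mxE (negbTE nj) (negbTE ne) mulr0.
apply/rowP => j; rewrite [RHS]mxE; have [->|nj] := eqVneq j top; last exact: small.
have /matrixP/(_ 0 top) := hr; rewrite !mxE (bigD1 top) //= big1 ?addr0 => [|i ne].
  by rewrite mxE eqxx (negbTE top0) /= => /eqP; rewrite mulf_eq0 (negbTE tn) orbF => /eqP.
by rewrite small ?mul0r.
Qed.

Definition yprin : M := invmx qmx *m eprin C n *m qmx.

Lemma Oprin_yprin : Oprin yprin.
Proof. by exists (invmx qmx); rewrite unitmx_inv qmx_unit invmxK. Qed.

Lemma delta_eprin j : (j < n)%N ->
  (delta_mx 0 (inord j) : 'rV[C]_n.+1) *m eprin C n = delta_mx 0 (inord j.+1).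
Proof.
move=> hj; rewrite /eprin mulmx_sumr (bigD1 (Ordinal hj)) //= big1 ?addr0 => [|i ne].
  by rewrite /ech /Emx mul_delta_mx.
rewrite /ech /Emx mul_delta_mx_0 // -val_eqE /= !inordK; try by have := ltn_ord i; lia.
by apply: contraNneq ne => e; apply/eqP/val_inj.
Qed.

(** The basis row 0 is fixed by [qmx], hence by its inverse. The [j]-th power of the principal
    nilpotent moves it to the basis row [j], and [qmx] turns that into its own row [j], which ends
    in [t j]. *)
Lemma yprin_pow j : (0 < j)%N -> (j <= n)%N -> (yprin ^+ j) ord0 top = t j.
Proof.
move=> j0 hj; have row0 (A : M) : A ord0 top = ((delta_mx 0 ord0 : 'rV[C]_n.+1) *m A) 0 top.
  by rewrite -rowE mxE.
have e0q : (delta_mx 0 ord0 : 'rV[C]_n.+1) *m qmx = delta_mx 0 ord0.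
  rewrite -rowE; apply/rowP => i; rewrite !mxE eqxx /=.
  have [->|ni] := eqVneq i top; last by rewrite eq_sym.
  by rewrite (_ : (top == ord0) = false) // -val_eqE /=; case: n hn.
have main k : (k <= n)%N -> (delta_mx 0 ord0 : 'rV[C]_n.+1) *m yprin ^+ k = delta_mx 0 (inord k) *m qmx.
  elim: k => [|k IH] hk.
    by rewrite expr0 mulmx1 -[LHS]e0q; congr (delta_mx _ _ *m _); apply: val_inj; rewrite /= inordK.
  have eS : yprin ^+ k.+1 = yprin ^+ k *m yprin by rewrite exprSr.
  rewrite eS mulmxA IH; last exact: ltnW.
  by rewrite /yprin !mulmxA mulmxK ?qmx_unit // delta_eprin.
rewrite row0 main // -rowE mxE mxE eqxx -val_eqE /= inordK // (_ : (j == 0%N) = false) //.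
by lia.
Qed.
End PrincipalOrbit.

(** * Kronecker substitution *)

Lemma digits_inj N K (p q : nat -> nat) : (forall j, (j < N)%N -> (p j < K)%N) -> (forall j, (j < N)%N -> (q j < K)%N) ->
  (\sum_(j < N) p j * K ^ j = \sum_(j < N) q j * K ^ j)%N -> forall j, (j < N)%N -> p j = q j.
Proof.
elim: N p q => // N IH p q hp hq; rewrite !big_ord_recl !expn0 !muln1 /=.
have st (f : nat -> nat) : (\sum_(i < N) f (bump 0 i) * K ^ bump 0 i = (\sum_(i < N) f i.+1 * K ^ i) * K)%N.
  by rewrite big_distrl; apply: eq_bigr => i _; rewrite /= /bump /= add1n expnSr mulnA.
rewrite !st => e; have K0 : (0 < K)%N by have := hp 0%N isT; lia.
have e0 : p 0%N = q 0%N.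
  by have := congr1 (modn^~ K) e; rewrite /= !(addnC _ (_ * K)%N) !modnMDl !modn_small ?hp ?hq.
case=> [|j] hj; first by [].
apply: (IH (fun j => p j.+1) (fun j => q j.+1)) => //; try by move=> i hi; first [exact: hp | exact: hq].
by apply/eqP; rewrite -(eqn_pmul2r K0); apply/eqP; apply: (@addnI (p 0%N)); rewrite e e0.
Qed.

(** Substituting [s^(K^j)] for the [j]-th variable sends distinct exponent vectors below [K] to
    distinct powers of [s]. The resulting nonzero polynomial cannot vanish at as many positive
    integers as its size. *)
Lemma kronecker_nonzero (F : numFieldType) n K (c : {ffun 'I_n -> 'I_K} -> F) (A : pred {ffun 'I_n -> 'I_K}) p0 :
  A p0 -> c p0 != 0 -> exists2 s : F, s != 0 & \sum_(p | A p) c p * s ^+ (\sum_(j < n) p j * K ^ j)%N != 0.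
Proof.
move=> A0 c0; pose e (p : {ffun 'I_n -> 'I_K}) := (\sum_(j < n) p j * K ^ j)%N.
have einj : injective e.
  move=> p q epq; apply/ffunP => j; apply: val_inj => /=.
  pose f (p : {ffun 'I_n -> 'I_K}) i := if insub i is Some i' then p i' : nat else 0%N.
  have fE p' (i : 'I_n) : f p' i = p' i by rewrite /f valK.
  have eE p' : e p' = (\sum_(j < n) f p' j * K ^ j)%N by apply: eq_bigr => i _; rewrite fE.
  rewrite -!fE; apply: (@digits_inj n K (f p) (f q)) => //; last by rewrite -!eE.
    by move=> i hi; rewrite -[i]/(nat_of_ord (Ordinal hi)) fE.
  by move=> i hi; rewrite -[i]/(nat_of_ord (Ordinal hi)) fE.
pose Q : {poly F} := \sum_(p | A p) c p *: 'X^(e p).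
have Q0 : Q != 0.
  apply/eqP => /(congr1 (fun q : {poly F} => q`_(e p0))); rewrite coef0 coef_sum (bigD1 p0) //= big1 ?addr0.
    by rewrite coefZ coefXn eqxx mulr1 => /eqP; rewrite (negbTE c0).
  by move=> p /andP[_ ne]; rewrite coefZ coefXn (inj_eq einj) eq_sym (negbTE ne) mulr0.
apply: contrapT => h.
pose rs := [seq (i.+1)%:R : F | i <- iota 0 (size Q)].
have := max_poly_roots Q0 (rs := rs); rewrite size_map size_iota ltnn => /(_ _ _) hh.
suff : false by []; apply: hh.
  apply/allP => x /mapP[i _ ->]; apply: contrapT => nr; apply: h; exists (i.+1%:R); first by rewrite pnatr_eq0.
  apply/negP => /eqP z; apply: nr; rewrite /root horner_sum -[X in _ == X]z; apply/eqP.
  by apply: eq_bigr => p _; rewrite hornerZ hornerXn.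
rewrite map_inj_uniq ?iota_uniq // => i j /eqP; rewrite eqr_nat eqSS => /eqP //.
Qed.

(** * The highest weight of the tableau module for a permuted order *)

Section Weights.
Variables (C : numClosedFieldType) (n : nat) (w : 'S_n.+1) (pw : nat -> nat) (l : nat -> C).
Hypothesis pwE : forall i, (i <= n)%N -> pw i = w (inord i).

Lemma perm_count a : (a <= n)%N -> (\sum_(j < n.+1 | pw j < pw a) 1 = pw a)%N.
Proof.
move=> ha; rewrite (eq_bigl (fun j : 'I_n.+1 => (w j < pw a)%N)); last first.
  by move=> j; rewrite (pwE (ord_le j)) inord_val.
have hp : (pw a <= n.+1)%N by rewrite pwE //; exact: ltnW.
transitivity (\sum_(j < n.+1 | (j < pw a)%N) 1)%N; first by rewrite [RHS](reindex_inj (@perm_inj _ w)).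
by rewrite -(big_ord_widen _ (fun _ => 1%N) hp) sum1_card card_ord.
Qed.

(** A count of inversions: the later positions that precede [a], minus the earlier ones that follow
    it, plus [a], is the number of all positions preceding [a], which is [pw a]. *)
Lemma wt_w0 (a : nat) : (a <= n)%N -> wt a (w0arr n pw l) = l a + (pw a)%:R.
Proof.
move=> ha; have hl i : (i < a)%N -> ent (w0arr n pw l) a i - ent (w0arr n pw l) a.-1 i = - (pw a < pw i)%N%:R.
  move=> hi; rewrite !ent_w0; try lia.
  have h : (a.-1 < n)%N by lia.
  have e : a.-1.+1 = a by lia.
  by rewrite (nbef_succ pw i h) e natrD; ring.
have e1 : \sum_(i < a.+1) ent (w0arr n pw l) a i - \sum_(i < a) ent (w0arr n pw l) a.-1 i =
    l a + (nbef n pw a a)%:R - (\sum_(i < a) (pw a < pw i))%N%:R.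
  rewrite big_ord_recr /= ent_w0 // addrAC -sumrB addrC; congr (_ + _).
  by rewrite natr_sum -sumrN; apply: eq_bigr => i _; rewrite hl.
have e2 : ((\sum_(i < a) (pw a < pw i)) + (\sum_(i < a) (pw i < pw a)) = a)%N.
  rewrite -big_split /= (eq_bigr (fun _ => 1%N)) ?sum1_card ?card_ord // => i _.
  have hi := ltn_ord i; case: (ltngtP (pw a) (pw i)) => // e.
  by have := perm_pw_inj pwE ha _ e; lia.
have e3 : (nbef n pw a a + \sum_(i < a) (pw i < pw a) = pw a)%N.
  rewrite -[RHS](perm_count ha) (bigID (fun j : 'I_n.+1 => (a < j)%N)) /= /nbef.
  congr (_ + _)%N; first by apply: eq_bigl => j; rewrite andbC.
  have ha' : (a <= n.+1)%N by lia.
  rewrite (big_ord_widen _ (fun i => (pw i < pw a) : nat) ha') [RHS]big_mkcond [LHS]big_mkcond /=; apply: eq_bigr => j _.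
  case: (ltngtP a j) => aj; rewrite ?andbF ?andbT //=; last by rewrite -aj ltnn.
move: (congr1 (fun x : nat => x%:R : C) e2) (congr1 (fun x : nat => x%:R : C) e3); rewrite /= !natrD /wt e1.
by move=> E2 E3; rewrite -[in RHS]E3 -[X in _ + X = _]E2; ring.
Qed.

Lemma chiW_perm (a : 'I_n.+1) : chiW pw l a = hatchi (fun a : 'I_n.+1 => l a + (pw a)%:R) a.
Proof.
rewrite /chiW; congr (hatchi _ a); apply/funext => b; exact: wt_w0 (ord_le b).
Qed.
End Weights.

(** Twisting by a lift of [w] permutes the shifted weight [L] by [w], and the tableau parameters are
    permuted in the same way, so the two highest weights agree. *)
Lemma hw_perm (C : numClosedFieldType) n (w : 'S_n.+1) (pw : nat -> nat) (L : nat -> C) u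
    (V : lmodType C) (R : 'M[C]_n.+1 -> V -> V) (v : V) :
  (forall i, (i <= n)%N -> pw i = w (inord i)) -> monomial w u -> glmod R ->
  hwv (fun i => i) R (hatchi (fun a : 'I_n.+1 => L a + a%:R)) v ->
  hwv pw (fun x => R (u x)) (chiW pw (fun k => L (pw k))) v.
Proof.
move=> pwE mon gl hw; have pE (a : 'I_n.+1) : pw a = w a :> nat by rewrite pwE ?ord_le // inord_val.
have [h1 h2] := hwv_monomial mon gl pE hw; split=> // a.
rewrite h2 (chiW_perm _ pwE); congr (_ *: _).
have e b : L (w b) + (w b)%:R = L (pw b) + (pw b)%:R by rewrite -pE.
rewrite /hatchi e; congr (_ - _ / _); rewrite (reindex_inj (@perm_inj _ w)).
by apply: eq_bigr => b _; rewrite e.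
Qed.

(** * Integral differences contradict the associated variety *)

Section Nonintegral.
Variables (C : numClosedFieldType) (n : nat).
Hypothesis hn : (0 < n)%N.
Local Notation M := 'M[C]_n.+1.
Local Notation E := (@delta_mx C n.+1 n.+1).
Local Notation I := 'I_n.+1.
Local Notation top := (ord_max : I).
Local Notation sub := (inord n.-1 : I).
Local Notation pwA := (pwA n).

Lemma pwA_le i : (i <= n)%N -> (pwA i <= n)%N.
Proof. by rewrite /pwA; do !case: ifP; lia. Qed.

Lemma wA_inj : injective (fun i : I => inord (pwA i) : I).
Proof.
move=> i j /(congr1 val) /=; rewrite !inordK ?ltnS ?pwA_le ?ord_le // => e.
by apply: val_inj; apply: (@pwA_inj n hn i j (ord_le i) (ord_le j)).
Qed.
Definition wA : 'S_n.+1 := perm wA_inj.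

Lemma pwA_perm i : (i <= n)%N -> pwA i = wA (inord i).
Proof. by move=> hi; rewrite permE /= inordK // inordK // ltnS pwA_le. Qed.

Lemma wA_sub : wA sub = ord0.
Proof.
apply: val_inj; rewrite permE /=; have h : (n.-1 < n.+1)%N by lia.
by rewrite (inordK h) /pwA ltnn eqxx inordK.
Qed.
Lemma wA_top : wA top = top.
Proof.
apply: val_inj; rewrite permE /= inordK /pwA; first by do !case: ifP; lia.
by do !case: ifP; lia.
Qed.

Lemma expo_prod (R : comNzRingType) K (p : {ffun 'I_n -> 'I_K}) (F : nat -> R) :
  \prod_(j <- expo p) F j = \prod_(j < n) F j.+1 ^+ p j.
Proof.
rewrite /expo big_flatten /= big_map big_enum /=; apply: eq_bigr => j _.
by rewrite big_nseq iter_mulr_1.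
Qed.

Variables (V : lmodType C) (rho : M -> V -> V) (v : V) (L : nat -> C).
Hypotheses (Hmod : is_gmodule rho) (Hsimple : simple_gmodule rho) (v00 : v != 0).
Hypothesis hw : hwv (fun i => i) (fun x => rho (hat x)) (hatchi (fun a : I => L a + a%:R)) v.
Hypothesis domL : forall i j, (i < j)%N -> (j <= n)%N -> forall z : int, L i - L j = z%:~R -> 0 < z.
Hypothesis assoc : forall y, Oprin y -> assoc_var rho y.

Let l k := L (pwA k).

Lemma l_dom i j : (i <= n)%N -> (j <= n)%N -> (pwA i < pwA j)%N -> forall z : int, l i - l j = z%:~R -> 0 < z.
Proof. by move=> hi hj ij; apply: domL => //; exact: pwA_le. Qed.

Lemma simple_hat : simple_gmodule (fun x => rho (hat x)).
Proof.
have [h1 h2] := Hsimple; split=> // W [s1 s2 s3]; apply: h2; split=> // x u sx hu.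
by rewrite -(hat_id sx); exact: s3.
Qed.

Variables (u : M -> M) (mon : monomial wA u).
Local Notation R := (fun x => rho (hat x)).
Local Notation piV := (fun x => rho (hat (u x))).

Let glR : glmod R := glmod_hat Hmod.
Let glV : glmod piV := glmod_monomial mon glR.
Let simpleV : simple_gmodule piV := simple_monomial mon simple_hat.
Let pwA_inj_ord (i j : I) : pwA i = pwA j -> i = j := @pw_inj_ord n pwA (@pwA_inj n hn) i j.

Lemma hw_wA : hwv pwA piV (chiW pwA l) v.
Proof. exact: (hw_perm pwA_perm mon glR hw). Qed.

Lemma annihilator K (c : {ffun 'I_n -> 'I_K} -> C) :
  \sum_p c p *: Xw (piWh pwA l) top sub (expo p) (delta (w0arr n pwA l)) = 0 ->
  forall x, \sum_p c p *: Xw piV top sub (expo p) x = 0.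
Proof.
move=> hc; pose Pop x := \sum_p c p *: Xw piV top sub (expo p) x.
have pinj := @pwA_inj n hn; have sep := @pwA_sep C n hn l.
have act x y z := rel_act pwA_inj_ord glV (glWh pinj sep) hw_wA (hwWh pinj sep l_dom) x (u := y) (v := z).
have P0 : Pop v = 0.
  apply: (tab_inj pinj sep l_dom glV simpleV v00 hw_wA); rewrite -hc; apply: rel_sum => p _; apply: relZ.
  by apply: rel_Xw => //; exact: rel0.
have Plin a x y : Pop (a *: x + y) = a *: Pop x + Pop y.
  rewrite /Pop scaler_sumr -big_split; apply: eq_bigr => p _ /=.
  by rewrite (Xw_linear glV) scalerDr !scalerA mulrC.
have P00 : Pop 0 = 0.
  by have := Plin 1 0 0; rewrite !scale1r addr0 => /esym/eqP; rewrite -subr_eq0 addrK => /eqP.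
have PD x y : Pop (x + y) = Pop x + Pop y by have := Plin 1 x y; rewrite !scale1r.
have low0 m x : low pwA piV v m x -> Pop x = 0.
  elim=> {m x} [|m|m a x y _ hx _ hy|a b m x ab _ hx] //.
    by rewrite Plin hx hy scaler0 addr0.
  (* A lowering operator [E a b] has neither [b] last nor [a] first in the order, and only such
     matrix units could fail to commute with the entries at [(top, sub)]. *)
  have bt : b != top by apply: contraTneq ab => ->; have := pwA_le (ord_le a); rewrite /pwA /=; do !case: ifP; lia.
  have as' : a != sub.
    by apply: contraTneq ab => ->; rewrite /pwA inordK; [do !case: ifP; lia|lia].
  transitivity (piV (E a b) (Pop x)); last by rewrite hx (pi0 glV).
  rewrite /Pop (pi_sumr glV); apply: eq_bigr => p _.
  by rewrite (piZ glV) (Xw_comm glV).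
move=> x; have [K' [g [hg ->]]] := lowsum_all pwA_inj_ord glV hw_wA simpleV v00 x.
by rewrite -/(Pop _) (big_morph Pop PD P00) big1 // => i _; exact: low0 (hg i).
Qed.

Lemma nonintegral_lt i j : (i < j)%N -> (j <= n)%N -> ~ isZ (L i - L j).
Proof.
move=> ij hj [z hz]; have z0 := domL ij hj hz.
have pinj := @pwA_inj n hn; have sep := @pwA_sep C n hn l.
have posn b : (b <= n)%N -> exists2 b', (b' <= n)%N & pwA b' = b.
  move=> hb; exists ((wA^-1)%g (inord b)); first exact: ord_le.
  by rewrite pwA_perm ?ord_le // inord_val permKV inordK.
have [i' hi' ei] := posn i (ltnW (leq_trans ij hj)); have [j' hj' ej] := posn j hj.
have hin : (i' < n)%N.
  rewrite ltn_neqAle hi' andbT; apply/eqP => e; move: ei; rewrite e /pwA; do !case: ifP; lia.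
have ij' : (pwA i' < pwA j')%N by rewrite ei ej.
have lD : l i' - l j' = (absz z)%:R by rewrite /l ei ej hz -[in LHS](gtz0_abs z0) -pmulrn.
have [K [c [[p0 cp0] hc]]] := Xw_dependent hn l_dom hin hj' ij' lD.
have ann := annihilator hc.
have [d [d0 hd]] := mon; pose xs a b := hat (u (E a b)).
(* Monomials with coefficient 0 are dropped, so that the maximal degree chosen below bounds every
   word of [P]. *)
pose P := flatten [seq [seq (c p * x.1, x.2) | x <- Xword xs top sub (expo p)] | p <- enum {ffun 'I_n -> 'I_K} & c p != 0].
have [rl _ _] := Hmod.
have killP x : act_poly rho P x = 0.
  rewrite -[RHS](ann x) /act_poly big_flatten /= big_map big_filter big_enum_cond /= [RHS](bigID (fun p => c p != 0)) /=.
  rewrite [X in _ = _ + X]big1 ?addr0 => [|p]; last by rewrite negbK => /eqP ->; rewrite scale0r.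
  apply: eq_bigr => p _; rewrite big_map -(@act_Xword C n V rho rl piV xs (expo p) top sub x (fun _ _ _ => erefl)) /act_poly scaler_sumr.
  by apply: eq_bigr => y _; rewrite scalerA.
pose deg (p : {ffun 'I_n -> 'I_K}) := sumn (expo p).
(* Every word of the monomial [p] has length [deg p], so the symbol of [P] consists of the monomials
   of maximal degree, and at least one of them is present. *)
have [p1 cp1 max1] := @arg_maxnP _ p0 (fun p => c p != 0) deg cp0.
pose D := deg p1.
have [s s0 hs] := @kronecker_nonzero C n K c (fun p => (c p != 0) && (deg p == D)) p1 (introT andP (conj cp1 (eqxx _))) cp1.
pose be := d top / d sub; have be0 : be != 0 by rewrite mulf_neq0 ?invr_eq0.
have N0 : ((2 * n.+1)%:R : C) != 0 by rewrite pnatr_eq0.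
(* Chosen so that the symbol of the [j]-th generator at [y] is exactly [s^(K^(j-1))]: the
   denominator cancels the normalization of the Killing form and the diagonal factor of the lift. *)
pose t j := s ^+ (K ^ j.-1)%N / ((2 * n.+1)%:R ^+ j * be).
have tn : t n != 0 by rewrite mulf_neq0 ?expf_neq0 // invr_eq0 mulf_neq0 ?expf_neq0.
pose y := yprin n t; have Oy : Oprin y := Oprin_yprin hn tn.
have sy := Oprin_sl Oy.
have evG m : (0 < m)%N -> (m <= n)%N -> poly_eval y (Gword xs m top sub) = s ^+ (K ^ m.-1)%N.
  move=> m0 mn; rewrite (eval_Gword d0 hd) // wA_sub wA_top (yprin_pow hn tn) // /t -/be.
  by field; rewrite be0 expf_neq0.
have evX p : poly_eval y (Xword xs top sub (expo p)) = s ^+ (\sum_(j < n) p j * K ^ j)%N.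
  rewrite eval_Xword expo_prod -prodrXr; apply: eq_bigr => m _.
  by rewrite evG ?ltn_ord //= -exprM mulnC.
have inP cw : cw \in P -> exists p a w', [/\ c p != 0, (a, w') \in Xword xs top sub (expo p) & cw = (c p * a, w')].
  move=> /flatten_mapP[p]; rewrite mem_filter => /andP[cp _] /mapP[[a w'] h ->].
  by exists p, a, w'.
have [_ /(_ P D)] := assoc Oy; move=> /(_ _ _ killP) ass; move/negP: hs; apply.
rewrite -[X in _ == X]ass.
- rewrite /sym_eval big_flatten /= big_map big_filter_cond /= big_enum_cond /= big_mkcondr /=.
  apply/eqP; rewrite [RHS](eq_bigl (fun p => c p != 0)) => [|p]; last by rewrite andbT.
  apply: eq_bigr => p _; rewrite big_map.
  case: ifP => [/eqP dp|dp].
    rewrite -evX /poly_eval mulr_sumr big_seq [RHS]big_seq_cond; apply: eq_big => [x|x hx] /=; last by rewrite mulrA.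
    by case hx: (x \in _) => //=; rewrite (Xword_size hx) -/(deg p) dp eqxx.
  rewrite big_seq_cond big_pred0 // => x /=; apply/negbTE/negP => /andP[hx].
  by rewrite (Xword_size hx) -/(deg p) dp.
- move=> cw /inP[p [a [w' [_ hw' ->]]]] x /=; apply: (Xword_sl _ hw') => *; exact: hat_sl.
- move=> cw /inP[p [a [w' [cp hw' ->]]]] /=; have := Xword_size hw' => /= ->; exact: max1 cp.
Qed.

Lemma nonintegral i j : (i <= n)%N -> (j <= n)%N -> i <> j -> ~ isZ (L i - L j).
Proof.
move=> hi hj ne hz; case: (ltngtP i j) => // ij; first exact: (nonintegral_lt ij hj hz).
by apply: (nonintegral_lt ij hi); rewrite -opprB; exact: isZN.
Qed.
End Nonintegral.

(** * Admissible weights *)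

Section HighestWeight.
Variables (C : numClosedFieldType) (n : nat).
Local Notation M := 'M[C]_n.+1.
Local Notation E := (@delta_mx C n.+1 n.+1).
Local Notation I := 'I_n.+1.
Variables (V : lmodType C) (rho : M -> V -> V) (lam : 'I_n -> C) (v : V).
Hypotheses (Hmod : is_gmodule rho) (hv : hw_vector rho lam v).
Local Notation R := (fun x => rho (hat x)).
Let glR : glmod R := glmod_hat Hmod.

Lemma ech_sl k : (k < n)%N -> in_sl (ech C n k).
Proof. by move=> hk; apply: delta_sl; rewrite -val_eqE /= !inordK; lia. Qed.

Lemma fch_sl k : (k < n)%N -> in_sl (fch C n k).
Proof. by move=> hk; apply: delta_sl; rewrite -val_eqE /= !inordK; lia. Qed.

Lemma hch_sl k : (k < n)%N -> in_sl (hch C n k).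
Proof. by move=> hk; rewrite /in_sl /hch /Emx raddfB /= !tr_delta subrr. Qed.

Lemma raising_kills a d : (a + d.+1 <= n)%N -> R (Emx C n a (a + d.+1)) v = 0.
Proof.
elim: d => [|d IH] h.
  have hk : (a < n)%N by lia.
  by rewrite addn1 -/(ech C n a) (hat_id (ech_sl hk)); have [_ /(_ (Ordinal hk))[]] := hv.
have -> : Emx C n a (a + d.+2) = lbr (Emx C n a (a + d.+1)) (Emx C n (a + d.+1) (a + d.+2)).
  rewrite /Emx lbr_delta eqxx mulr1n (_ : (_ == _) = false) ?mulr0n ?subr0 //.
  by rewrite -val_eqE /= !inordK; lia.
have hk : (a + d.+1 < n)%N by lia.
have e : R (Emx C n (a + d.+1) (a + d.+2)) v = 0.
  rewrite [(a + d.+2)%N]addnS -/(ech C n (a + d.+1)) (hat_id (ech_sl hk)).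
  by have [_ /(_ (Ordinal hk))[]] := hv.
have [_ _ h3] := glR; rewrite h3 e IH; last by lia.
by rewrite !(pi0 glR) subrr.
Qed.

Lemma eps_coord_succ (nu : 'I_n -> C) k (hk : (k < n)%N) :
  eps_coord nu (inord k) = nu (Ordinal hk) + eps_coord nu (inord k.+1).
Proof.
rewrite /eps_coord !inordK; [|lia|lia]; rewrite (bigD1 (Ordinal hk)) //=; congr (_ + _).
by apply: eq_bigl => l; rewrite -val_eqE /=; lia.
Qed.

Lemma eps_coord_last (nu : 'I_n -> C) : eps_coord nu (inord n) = 0.
Proof. by rewrite /eps_coord big_pred0 // => l; rewrite inordK // leqNgt ltn_ord. Qed.

Lemma diag_rel m : (m <= n)%N -> R (Emx C n (n - m) (n - m)) v =
  R (Emx C n n n) v + eps_coord lam (inord (n - m)) *: v.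
Proof.
elim: m => [|m IH] hm; first by rewrite subn0 eps_coord_last scale0r addr0.
have hk : (n - m.+1 < n)%N by lia.
have e : (n - m.+1).+1 = (n - m)%N by lia.
rewrite (eps_coord_succ _ hk) scalerDl addrCA e -IH; last exact: ltnW.
have [_ /(_ (Ordinal hk))[_ /= <-]] := hv; rewrite -(hat_id (hch_sl hk)).
by rewrite /hch (piBl glR) e subrK.
Qed.

(** The coroots determine only differences of the diagonal eigenvalues. The identity matrix acts by
    0 through [hat], which fixes the common constant as minus the mean. *)
Lemma hw_hat : hwv (fun i => i) R (hatchi (eps_coord lam)) v.
Proof.
have diag (a : I) : R (E a a) v = R (Emx C n n n) v + eps_coord lam a *: v.
  have := @diag_rel (n - a) (leq_subr _ _); rewrite subKn ?ord_le //.
  by rewrite {1}/Emx !inord_val.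
split=> [a b ab|a].
  have := @raising_kills a (b - a).-1; rewrite (_ : (a + (b - a).-1.+1)%N = b); last by lia.
  by rewrite /Emx !inord_val; apply; exact: ord_le.
have z : R (\sum_(c : I) E c c) v = 0.
  rewrite (_ : \sum_(c : I) E c c = 1%:M); last first.
    apply/matrixP => i j; rewrite summxE (bigD1 i) //= !mxE eqxx big1 ?addr0 1?eq_sym //.
    by move=> c ne; rewrite mxE eq_sym (negbTE ne).
  rewrite (_ : hat 1%:M = hat 0) ?(pi0l glR) // /hat mxtrace0 mul0r mxtrace1 divff ?pnatr_eq0 //.
  by rewrite raddf0 !subrr.
rewrite (pi_suml glR) in z.
have {}z : n.+1%:R *: R (Emx C n n n) v + (\sum_c eps_coord lam c) *: v = 0.
  rewrite -[RHS]z (eq_bigr _ (fun c _ => diag c)) big_split /= -scaler_suml sumr_const card_ord.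
  by rewrite scaler_nat.
have N0 : n.+1%:R != 0 :> C by rewrite pnatr_eq0.
rewrite diag /hatchi scalerBl addrC; congr (_ + _).
apply: (scalerI N0); rewrite scalerN scalerA mulrCA divff // mulr1.
by apply/eqP; rewrite -addr_eq0; apply/eqP.
Qed.
End HighestWeight.

(** * Integral differences of an admissible weight are positive *)

Section Admissible.
Variables (C : numClosedFieldType) (n p q : nat).
Hypotheses (Hq : (0 < q)%N) (Hpq : coprime p q) (Hp : (n.+1 <= p)%N).
Local Notation I := 'I_n.+1.

Lemma telescope_ord (G : nat -> C) a b : (a <= b)%N -> (b <= n)%N ->
  \sum_(l < n | (a <= l)%N && (l < b)%N) (G l - G l.+1) = G a - G b.
Proof.
elim: b => [|b IH] ab hb.
  by rewrite big_pred0 => [|l]; [move: ab; rewrite leqn0 => /eqP ->; rewrite subrr|rewrite andbF].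
move: ab; rewrite leq_eqVlt => /orP[/eqP ->|ab].
  by rewrite big_pred0 ?subrr // => l; lia.
rewrite (bigD1 (Ordinal hb)) /=; last by rewrite ltnSn andbT.
rewrite (eq_bigl (fun l : 'I_n => (a <= l)%N && (l < b)%N)); last by move=> l; rewrite -val_eqE /=; lia.
by rewrite IH //; [ring|lia].
Qed.

Lemma eps_coord_diff (nu : 'I_n -> C) (x y : I) : (x <= y)%N ->
  eps_coord nu x - eps_coord nu y = \sum_(l < n | (x <= l)%N && (l < y)%N) nu l.
Proof.
move=> xy; rewrite /eps_coord (bigID (fun l : 'I_n => (l < y)%N)) /= addrC.
rewrite (eq_bigl (fun l : 'I_n => (y <= l)%N)); last by move=> l; lia.
by rewrite addrC addrK.
Qed.

Variable lam : 'I_n -> C.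
Hypothesis Hlam : Pr_adm p q lam.

(** Up to sign the difference is [A - (p/q) m] with [0 < A < p] and [m] the value of [eta] on a
    positive root. Integrality forces [q] to divide [m] by coprimality. Then [condC] leaves [m = 0],
    with difference [A], or [m = q] for a root whose sign [w] reverses, with difference [p - A]. *)
Lemma admissible_dom i j : (i < j)%N -> (j <= n)%N -> forall z : int,
  (eps_coord lam (inord i) - i%:R) - (eps_coord lam (inord j) - j%:R) = z%:~R -> 0 < z.
Proof.
move=> ij hj z hz; have [mu [w [eta [hmu hC lamE]]]] := Hlam.
pose nu l := ((mu l)%:R - (p%:R / q%:R) * (eta l)%:~R) + 1 : C.
pose x := (w^-1)%g (inord i : I); pose y := (w^-1)%g (inord j : I).
have hz' : eps_coord nu x - eps_coord nu y = z%:~R.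
  rewrite -hz.
  have -> : eps_coord nu x - eps_coord nu y = \sum_(l < n | (i <= l)%N && (l < j)%N) (lam l + 1).
    have := @telescope_ord (fun l => eps_coord nu ((w^-1)%g (inord l))) i j (ltnW ij) hj.
    by rewrite /x /y => <-; apply: eq_bigr => l _; rewrite lamE /dot_act /weyl_act subrK.
  rewrite big_split /=.
  have := @eps_coord_diff lam (inord i) (inord j); rewrite !inordK; [|lia|lia].
  move=> <-; last exact: ltnW.
  have t1 := @telescope_ord (fun l => - l%:R) i j (ltnW ij) hj.
  rewrite (eq_bigr (fun _ => 1)) in t1; last by move=> l _ /=; rewrite -[l.+1%:R]natr1; ring.
  by rewrite t1; ring.
have key (s t : I) : (s < t)%N -> exists (A : nat) (m : int), [/\ (0 < A)%N, (A < p)%N,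
    m = \sum_(l < n | (s <= l)%N && (l < t)%N) eta l &
    eps_coord nu s - eps_coord nu t = A%:R - p%:R / q%:R * m%:~R].
  move=> st; exists (\sum_(l < n | (s <= l)%N && (l < t)%N) (mu l).+1)%N, (\sum_(l < n | (s <= l)%N && (l < t)%N) eta l).
  have hs : (s < n)%N by have := ord_le t; lia.
  split=> //.
  - by rewrite (bigD1 (Ordinal hs)) //= leqnn.
  (* The labels of [mu] sum to at most [p - n - 1], and the shift by rho adds at most [n]. *)
  - apply: leq_ltn_trans (_ : (\sum_(l < n) (mu l).+1 < p)%N).
      by rewrite [X in (_ <= X)%N](bigID (fun l : 'I_n => (s <= l)%N && (l < t)%N)) /= leq_addr.
    under eq_bigr => l _ do rewrite -addn1.
    rewrite big_split /= sum1_card card_ord.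
    by move: hmu Hp; rewrite /PrZ; move: (\sum_(l < n) mu l)%N => S; lia.
  rewrite eps_coord_diff; last exact: ltnW.
  rewrite natr_sum rmorph_sum mulr_sumr -sumrB; apply: eq_bigr => l _.
  by rewrite /nu -natr1 /=; ring.
have q0 : (q%:R : C) != 0 by rewrite pnatr_eq0 -lt0n.
have int_key (A : nat) (m z' : int) : A%:R - p%:R / q%:R * m%:~R = z'%:~R :> C -> q%:Z * (A%:Z - z') = p%:Z * m.
  move=> e; apply: (@intC_inj C); rewrite !rmorphM rmorphB /= -e -!pmulrn; field.
  by rewrite q0.
have dvd (A : nat) (m z' : int) : q%:Z * (A%:Z - z') = p%:Z * m -> 0 <= m -> exists2 r : nat, m = (r * q)%N%:Z & A%:Z - z' = p%:Z * r%:Z.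
  move=> e m0; have : (q %| p * absz m)%N.
    by rewrite -[p]/(absz p%:Z) -abszM -e abszM dvdn_mulr.
  rewrite Gauss_dvdr 1?coprime_sym // => /dvdnP[r hr]; exists r; first by rewrite -hr gez0_abs.
  have : q%:Z * (A%:Z - z') = q%:Z * (p%:Z * r%:Z) by rewrite e -[m]gez0_abs // hr PoszM; ring.
  by apply: mulfI; rewrite -lt0n.
have wx : w x = inord i by rewrite permKV.
have wy : w y = inord j by rewrite permKV.
case: (ltngtP x y) => xy.
- have [A [m [A0 Ap mE e]]] := key x y xy.
  have := hC x y xy; rewrite wx wy !inordK; [|lia|lia]; rewrite ij -mE => /andP[m0 mq].
  have [r mr e2] := dvd A m z (int_key A m z (etrans (esym e) hz')) m0.
  have r0 : r = 0%N by move: mq; rewrite mr; case: r {mr e2} => // r; rewrite mulSn; lia.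
  by move: e2; rewrite r0 mulr0 => /eqP; rewrite subr_eq0 => /eqP <-.
- have [A [m [A0 Ap mE e]]] := key y x xy.
  have hzN : eps_coord nu y - eps_coord nu x = (- z)%:~R by rewrite rmorphN /= -hz' opprB.
  have := hC y x xy; rewrite wx wy !inordK; [|lia|lia]; rewrite ltnNge (ltnW ij) /= -mE => /andP[m0 mq].
  have [r mr e2] := dvd A m (- z) (int_key A m (- z) (etrans (esym e) hzN)) (le_trans ler01 m0).
  have r1 : r = 1%N.
    move: m0 mq; rewrite mr; case: r {mr e2} => [|[|r]] //; rewrite !mulSn; lia.
  by move: e2; rewrite r1 mulr1; lia.
- have xy' : x = y by exact: val_inj.
  have : w x = w y by rewrite xy'.
  by rewrite wx wy => /(congr1 val) /=; rewrite !inordK; lia.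
Qed.
End Admissible.

Lemma zclosure_sub (C : numClosedFieldType) n (y : 'M[C]_n.+1) : Oprin y -> zclosure (@Oprin C n) y.
Proof. by move=> Oy; split; [exact: Oprin_sl|move=> f _; apply]. Qed.

Theorem mainTheorem15 (C : numClosedFieldType) (n : nat) (Hn : (1 <= n)%N)
  (p q : nat) (Hq : (0 < q)%N) (Hpq : coprime p q) (Hp : (n.+1 <= p)%N)
  (lam : 'I_n -> C)
  (V : lmodType C) (rho : 'M[C]_(n.+1) -> V -> V)
  (Hmod : is_gmodule rho) (Hsimple : simple_gmodule rho)
  (Hhw : exists v : V, hw_vector rho lam v)
  (Hlam : Pr_adm_prin rho p q lam) :
  forall w : 'S_n.+1, strongly_tame_GT_base rho w.
Proof.
have [v hv] := Hhw; have [adm Hass] := Hlam; have [v0 _] := hv.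
(* The epsilon coordinates of lambda + rho, with rho normalized to have coordinate [-k] at position
   [k]. *)
pose L k := eps_coord lam (inord k) - k%:R.
have domL := admissible_dom Hq Hpq Hp adm.
have hw : hwv (fun i => i) (fun x => rho (hat x)) (hatchi (fun a : 'I_n.+1 => L a + a%:R)) v.
  rewrite (_ : (fun a : 'I_n.+1 => L a + a%:R) = eps_coord lam); first exact: hw_hat.
  by apply/funext => a; rewrite /L subrK inord_val.
have ass y : Oprin y -> assoc_var rho y by move=> Oy; apply/Hass; exact: zclosure_sub.
have [uA [_ monA]] := has_lift_all C (wA Hn).
have nint := nonintegral Hmod Hsimple v0 hw domL ass monA.
have glR := glmod_hat Hmod; have sR := simple_hat Hsimple.
move=> w; have [u [Wu mon]] := has_lift_all C w.
exists u; split=> //; first exact: monomial_same_base mon.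
(* Twisting by the lift [u] turns the standard Borel subalgebra into the one given by the ranks [w],
   for which [v] remains a highest weight vector. *)
pose pw i : nat := w (inord i).
have pwE i : (i <= n)%N -> pw i = w (inord i) by [].
have hw1 : hwv (fun i => i) (fun x => rho (hat x)) (chiW (fun i => i) L) v.
  have [h1 h2] := hw; split=> // a; rewrite h2 (chiW_perm _ (w := 1%g)) // => i hi.
  by rewrite perm1 inordK.
have nintw i j : (i <= n)%N -> (j <= n)%N -> i <> j -> ~ isZ (L (pw i) - L (pw j)).
  move=> hi hj ne; apply: nint; [exact: ord_le|exact: ord_le|move=> e; apply: ne].
  
exact: (perm_pw_inj pwE hi hj e).
have := strongly_tame_nint v0 nint glR sR hw1 pwE nintw (glmod_monomial mon glR)
   (simple_monomial mon sR) (hw_perm pwE mon glR hw).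
have h0E x : rho (hat (u (h0 C n pw))) x = rho (hat (h0 C n (fun i => i))) x.
  by rewrite (h0_monomial mon) // => a; rewrite pwE ?ord_le // inord_val.
move=> /(_ h0E)[S [T [s1 s2 s3 s4 s5]]]; exists S, T; split=> // z Sz k.
have sl x : in_sl x -> hat (u x) = u x by move=> sx; apply: hat_id; rewrite /in_sl (monomial_tr mon).
have := s5 z Sz k; rewrite !sl //; [exact: hch_sl|exact: fch_sl|exact: ech_sl].
Qed.
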